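(* Let $\Pi=(\Pi_n)_{n\ge1}$ be an exchangeable Gibbs partition EGP$(\alpha,V)$ with index $\alpha\in(-\infty,1)$, for some $V$. Let $\mathbf{i}=(i_1<i_2<\cdots)$ be its limit sequence of record indices and let $X_1,X_2,\ldots$ be its age-ordered limit frequencies as $n\to\infty$. A regular conditional distribution of $(X_1,X_2,\ldots)$ given the record indices $\mathbf{i}$ is given by $$X_j\overset{d}{=}\xi_{j-1}\prod_{m=j}^{\infty}(1-\xi_m),\qquad j\ge 1\quad\text{(jointly in } j),$$ almost surely, where $\xi_0\equiv1$ and $\xi_1,\xi_2,\ldots$ are independent, $\xi_j$ ($j\ge1$) being a Beta random variable in $[0,1]$ with parameters $(1-\alpha,\ i_{j+1}-j\alpha-1)$.
   Context: A random partition of $[n]=\{1,\ldots,n\}$ is written $\Pi_n=(\Pi_{n1},\ldots,\Pi_{nk})$ with classes ordered by their least elements, and age-ordered frequencies $n_j=|\Pi_{nj}|$. For a consistent family $\Pi=(\Pi_n)$ (a random partition of $\mathbb{N}$), the record indices $1=i_1<i_2<\cdots$ are the least elements of its classes and the age-ordered limit frequencies are $X_j=\lim_{n\to\infty}n_j/n$ (which exist almost surely). If $K_\infty$ denotes the total number of classes of $\Pi$, the convention is $i_k=\infty$ for every $k>K_\infty$ (and a Beta variable with second parameter $\infty$ is identically $0$). Let $\alpha\in(-\infty,1]$ and let $V=(V_{n,k}:1\le k\le n)$ be nonnegative coefficients with $V_{1,1}=1$ and $V_{n,k}=(n-\alpha k)V_{n+1,k}+V_{n+1,k+1}$. The exchangeable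 Gibbs partition EGP$(\alpha,V)$ is the random partition $\Pi=(\Pi_n)$ of $\mathbb{N}$ generated by: $\Pi_1=(\{1\})$; for $n\ge1$, given $\Pi_n=(\pi_{n1},\ldots,\pi_{nk})$ with class sizes $n_j=|\pi_{nj}|$, the element $n+1$ starts a new class with probability $V_{n+1,k+1}/V_{n,k}$, and joins the class $\pi_{nj}$ with probability $\frac{n_j-\alpha}{n-\alpha k}\left(1-\frac{V_{n+1,k+1}}{V_{n,k}}\right)$, $j=1,\ldots,k$. *)

(* Defs.v *)
(* MathComp-Analysis, over an arbitrary real field R : realType.
   Age-ordered sequences (classes, frequencies, records) are indexed from 0:
   index j stands for the (j+1)-st class in order of appearance. *)
From HB Require Import structures.
From mathcomp Require Import all_boot all_order all_algebra finmap.
From mathcomp Require Import all_classical all_reals all_analysis.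
From mathcomp Require Import measurable_realfun.
Set Implicit Arguments.
Unset Strict Implicit.
Unset Printing Implicit Defensive.
Import Order.TTheory GRing.Theory Num.Theory.
Import numFieldNormedType.Exports.
Local Open Scope classical_set_scope.
Local Open Scope ring_scope.

Definition interval_fset (n : nat) : {fset nat} := seq_fset tt (iota 1 n).

(* A partition of {1, ..., n} is the list of its classes, ordered by their
   least elements (last clause). *)
Definition ordered_partition (n : nat) (p : seq {fset nat}) : Prop :=
  [/\ fset0 \notin p,
      forall x, (x \in interval_fset n) = has (fun B : {fset nat} => x \in B) p,
      pairwise (fun B C : {fset nat} => [disjoint B & C]%fset) p
    & forall j k, (j < k < size p)%N ->
        exists2 x, x \in nth fset0 p j &
          forall y, y \in nth fset0 p k -> (x < y)%N].

Definition restrict_partition (n : nat) (p : seq {fset nat}) : seq {fset nat} :=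
  [seq B <- [seq (B `&` interval_fset n)%fset | B <- p] | B != fset0].

Definition open_class (x : nat) (p : seq {fset nat}) : seq {fset nat} :=
  rcons p [fset x]%fset.

Definition join_class (x j : nat) (p : seq {fset nat}) : seq {fset nat} :=
  set_nth fset0 p j (x |` nth fset0 p j)%fset.

(* Random partition of the positive integers: a consistent family of random
   partitions of {1, ..., n}, n >= 1; Pi 0 is irrelevant. *)
Definition random_partition (d : measure_display) (T : measurableType d)
    (Pi : nat -> T -> seq {fset nat}) : Prop :=
  [/\ forall n w, (0 < n)%N -> ordered_partition n (Pi n w),
      forall n w, (0 < n)%N -> restrict_partition n (Pi n.+1 w) = Pi n w
    & forall n p, (0 < n)%N -> measurable [set w | Pi n w = p]].

Definition cond_prob (d : measure_display) (T : measurableType d)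
    (R : realType) (P : probability T R) (A B : set T) : R :=
  fine (P (A `&` B)) / fine (P B).

Definition gibbs_coefficients (R : realType) (alpha : R) (V : nat -> nat -> R) :
    Prop :=
  [/\ forall n k, (1 <= k <= n)%N -> 0 <= V n k,
      V 1%N 1%N = 1
    & forall n k, (1 <= k <= n)%N ->
        V n k = (n%:R - alpha * k%:R) * V n.+1 k + V n.+1 k.+1].

Definition is_EGP (d : measure_display) (T : measurableType d) (R : realType)
    (P : probability T R) (alpha : R) (V : nat -> nat -> R)
    (Pi : nat -> T -> seq {fset nat}) : Prop :=
  [/\ gibbs_coefficients alpha V,
      random_partition Pi
    & forall n (p : seq {fset nat}), (0 < n)%N ->
        let k := size p in
        let past := [set w | Pi n w = p] in
        let q := V n.+1 k.+1 / V n k in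
        (0 < P past)%E ->
        cond_prob P [set w | Pi n.+1 w = open_class n.+1 p] past = q /\
        forall j, (j < k)%N ->
          cond_prob P [set w | Pi n.+1 w = join_class n.+1 j p] past =
          (#|` nth fset0 p j|%:R - alpha) / (n%:R - alpha * k%:R) * (1 - q)].

Definition limit_class (T : Type) (Pi : nat -> T -> seq {fset nat}) (j : nat)
    (w : T) : set nat :=
  \bigcup_(n in [set n | (0 < n)%N]) [set` nth fset0 (Pi n w) j].

(* Least element of the (j+1)-st class; +oo, the infimum of the empty set, when
   the partition has at most j classes. *)
Definition record_index (R : realType) (T : Type)
    (Pi : nat -> T -> seq {fset nat}) (w : T) (j : nat) : \bar R :=
  ereal_inf [set (x%:R)%:E | x in limit_class Pi j w].

Definition limit_frequency (R : realType) (T : Type)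
    (Pi : nat -> T -> seq {fset nat}) (w : T) (j : nat) : R :=
  limn (fun n => #|` nth fset0 (Pi n w) j|%:R / n%:R : R).

Definition cylinders (S : Type) (G : set (set S)) : set (set (nat -> S)) :=
  [set C | exists j, exists2 B, G B & C = (fun s : nat -> S => s j) @^-1` B].

(* Sequence spaces with the product of the Borel sigma-algebras. *)
Definition real_seq (R : realType) :=
  g_sigma_algebraType (cylinders (@measurable _ (measurableTypeR R))).

Definition ereal_seq (R : realType) :=
  g_sigma_algebraType (cylinders (measurable : set (set (\bar R)))).

(* Beta density for real parameters; beta_pdf of the library has natural
   number parameters. *)
Definition real_beta_weight (R : realType) (a b t : R) : R :=
  t `^ (a - 1) * (1 - t) `^ (b - 1).

Definition real_beta_fun (R : realType) (a b : R) : R :=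
  \int[lebesgue_measure]_(t in `[0, 1]) real_beta_weight a b t.

Definition beta_distributed (d : measure_display) (T : measurableType d)
    (R : realType) (P : probability T R) (xi : T -> R) (a : R) (b : \bar R) :
    Prop :=
  match b with
  | b'%:E => forall B : set R, measurable B ->
      P (xi @^-1` B) =
      (\int[lebesgue_measure]_(t in B `&` `[0%R, 1%R])
         (real_beta_weight a b' t / real_beta_fun a b')%:E)%E
  | +oo%E => forall w, xi w = 0
  | -oo%E => False
  end.

Definition mutually_independent (d : measure_display) (T : measurableType d)
    (R : realType) (P : probability T R) (xi : nat -> T -> R) : Prop :=
  forall (J : {fset nat}) (B : nat -> set R),
    (forall j, measurable (B j)) ->
    P (\bigcap_(j in [set` J]) xi j @^-1` B j) =
    (\prod_(j <- J) P (xi j @^-1` B j))%E.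

(* Coordinate j is xi_j * prod_{m >= j+1} (1 - xi_m). *)
Definition residual_products (R : realType) (xi : nat -> R) (j : nat) : R :=
  xi j * limn (fun M => \prod_(j.+1 <= m < M) (1 - xi m)).

(* mu is the law of the residual products built from xi_0 = 1 and independent
   xi_j (j >= 1) distributed as Beta(1 - alpha, i_{j+1} - j alpha - 1), where
   i_{j+1} is coordinate j of i. *)
Definition is_residual_law (R : realType) (alpha : R) (i : nat -> \bar R)
    (mu : set (nat -> R) -> \bar R) : Prop :=
  exists (d : measure_display) (T : measurableType d) (P : probability T R)
    (xi : nat -> {RV P >-> R}),
    [/\ forall w, xi 0%N w = 1,
        forall j, (0 < j)%N ->
          beta_distributed P (xi j) (1 - alpha)
            (i j - (j%:R * alpha)%:E - 1)%E,
        mutually_independent P (fun j => xi j.+1)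
      & forall A : set (real_seq R), measurable A ->
          mu A = P [set w | A (residual_products (fun j => xi j w))]].

Definition is_regular_conditional_distribution (d d1 d2 : measure_display)
    (T : measurableType d) (Y : measurableType d1) (Z : measurableType d2)
    (R : realType) (P : probability T R) (X : T -> Y) (I : T -> Z)
    (kappa : R.-pker Z ~> Y) : Prop :=
  [/\ measurable_fun [set: T] X,
      measurable_fun [set: T] I
    & forall (A : set Y) (B : set Z), measurable A -> measurable B ->
        P (X @^-1` A `&` I @^-1` B) =
        (\int[P]_(w in I @^-1` B) kappa (I w) A)%E].

(* Main.v *)
(* Encode the partition by the labels c_m (the index of the class of m, in order
   of age). By the prediction rule, the probability of a prefix of labels is a
   product of two factors: the probability of its record pattern, and the weight
   of the choices made at the non-records, which no longer depends on V. Replace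
   these choices by a sampling scheme: take independent sticks xi_j distributed as
   in the theorem, and let each non-record choose class j among the first k with
   probability xi_j (1 - xi_(j+1)) ... (1 - xi_(k-1)). Beta moments show that the
   averaged weights are the Gibbs weights (a telescoping product), so the new
   labels have the law of the old ones, jointly with the records. Given the
   records and the sticks the choices are independent, so a law of large numbers
   gives the frequencies. The records themselves, which are not sampled, disturb
   the averages only if they have positive upper density; but then the products of
   the 1 - xi_m vanish almost surely, and the limit is the same. *)
Require Import Defs.
From HB Require Import structures.
From mathcomp Require Import all_boot all_order all_algebra finmap.
From mathcomp Require Import all_classical all_reals all_analysis.
From mathcomp Require Import measurable_realfun.
From mathcomp Require Import ring lra zify.
Set Implicit Arguments.
Unset Strict Implicit.
Unset Printing Implicit Defensive.
Import Order.TTheory GRing.Theory Num.Theory.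
Import numFieldNormedType.Exports.
Local Open Scope classical_set_scope.
Local Open Scope ring_scope.

(** * Beta integrals with real parameters *)

Section RealBeta.
Context {R : realType}.
Implicit Types a b t : R.
Local Notation leb := (@lebesgue_measure R).
Local Notation weight := (@real_beta_weight R).

(** The kernel has to depend measurably on the record indices and to be a residual law at every
    sample point, not only almost surely. For this all sticks are read off one sequence [u] of
    independent uniform variables on the unit interval: stick [j] is a Beta quantile of [u j], with
    parameters fixed by the record index, and the kernel is the law of a map that is jointly
    measurable in the records and the uniform point. The same [u], evaluated at a second independent
    point, drives the resampled choices.

    Frequencies and record indices are both measurable functions of the label sequence, so an
    equality of label laws carries over to their joint law; and since labels are integers, that
    equality only has to be checked on finite prefixes.

    A partition with finitely many classes needs no separate treatment: a missing class has record
    index [+oo] and stick 0, which leaves the tail products unchanged. *)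

Lemma real_beta_weight_ge0 a b t : 0 <= weight a b t.
Proof. by rewrite mulr_ge0 ?powR_ge0. Qed.

Lemma measurable_real_beta_weight a b : measurable_fun setT (weight a b).
Proof.
apply: measurable_funM; first exact: measurable_powR.
apply: (measurableT_comp (f := fun x => x `^ (b - 1))) => //.
exact: measurable_funB.
Qed.

Lemma measurable_EFin_real_beta_weight D a b :
  measurable_fun D (fun t => (weight a b t)%:E).
Proof.
apply: measurable_funTS; apply/measurable_EFinP.
exact: measurable_real_beta_weight.
Qed.

Lemma real_beta_weightDl a b t : 0 < a -> 0 <= t ->
  weight (a + 1) b t = t * weight a b t.
Proof.
by move=> a0 t0; rewrite /real_beta_weight addrK mulrA mulr_powRB1.
Qed.

Lemma real_beta_weightDr a b t : 0 < b -> t <= 1 ->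
  weight a (b + 1) t = (1 - t) * weight a b t.
Proof.
move=> b0 t1.
by rewrite /real_beta_weight addrK mulrCA mulr_powRB1// subr_ge0.
Qed.

(** The extended value is kept because [real_beta_fun] is a [fine], which would turn an infinite
    integral into 0. The recursions are proved here first, and finiteness is deduced from them. *)
Definition ebeta a b : \bar R :=
  (\int[leb]_(t in `[0%R, 1%R]) (weight a b t)%:E)%E.

Lemma ebeta_ge0 a b : (0 <= ebeta a b)%E.
Proof. by apply: integral_ge0 => t _; rewrite lee_fin real_beta_weight_ge0. Qed.

(** Split the weight by [1 = t + (1 - t)]. *)
Lemma ebetaD a b : 0 < a -> 0 < b ->
  ebeta a b = (ebeta (a + 1) b + ebeta a (b + 1))%E.
Proof.
move=> a0 b0; rewrite /ebeta -ge0_integralD//.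
- apply: eq_integral => t; rewrite inE/= in_itv/= => /andP[t0 t1].
  by rewrite -EFinD real_beta_weightDl// real_beta_weightDr// -mulrDl addrC subrK mul1r.
- by move=> t _; rewrite lee_fin real_beta_weight_ge0.
- exact: measurable_EFin_real_beta_weight.
- by move=> t _; rewrite lee_fin real_beta_weight_ge0.
- exact: measurable_EFin_real_beta_weight.
Qed.

(** The weight may be singular at 0 and at 1, so integration by parts is done on
    [[cut n, 1 - cut n]] and passed to the limit. The offset 3 makes this interval nondegenerate
    already for [n = 0]. *)
Let cut (n : nat) : R := n.+3%:R^-1.

Let cut_gt0 n : 0 < cut n. Proof. by rewrite invr_gt0 ltr0n. Qed.

Let cut_lt n : cut n < 1 - cut n.
Proof.
rewrite ltrBrDr -mulr2n -mulr_natr -ltr_pdivlMr// mul1r ltf_pV2 ?posrE//.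
by rewrite ltr_nat.
Qed.

Let cut_bigcup : \bigcup_n `[cut n, 1 - cut n]%classic = `]0%R, 1%R[%classic.
Proof.
apply/seteqP; split=> [t [n _]|t] /=; rewrite !in_itv/=.
  move=> /andP[ct tc]; rewrite (lt_le_trans _ ct)//= (le_lt_trans tc)//.
  by rewrite ltrBlDr ltrDl.
move=> /andP[t0 t1].
pose e := Num.min t (1 - t); have e0 : 0 < e by rewrite lt_min t0 subr_gt0.
have [n ne] : exists n, cut n <= e.
  exists (Num.trunc e^-1); rewrite -[leRHS]invrK lef_pV2 ?posrE ?invr_gt0//.
  apply: ltW; apply: lt_le_trans (truncnS_gt _) _.
  by rewrite ler_nat ltnS leqW.
exists n => //=; rewrite in_itv/= (le_trans ne)/= ?ge_min ?lexx//.
by rewrite lerBrDr -lerBrDl (le_trans ne)// ge_min lexx orbT.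
Qed.

Let cut_cvg a b :
  (\int[leb]_(t in `[cut n, (1 - cut n)%R]) (weight a b t)%:E)%E @[n --> \oo]
  --> ebeta a b.
Proof.
have -> : ebeta a b = (\int[leb]_(t in \bigcup_n `[cut n, (1 - cut n)%R]%classic)
    (weight a b t)%:E)%E.
  rewrite cut_bigcup /ebeta [LHS]integral_itv_bndoo//.
  exact: measurable_EFin_real_beta_weight.
apply: ge0_nondecreasing_set_cvg_integral => //.
- move=> m n mn; apply/subsetPset; apply: subset_itv; rewrite bnd_simp.
    by rewrite lef_pV2 ?posrE ?ltr0n// ler_nat.
  by rewrite lerD2l lerN2 lef_pV2 ?posrE ?ltr0n// ler_nat.
- by move=> i; exact: measurable_EFin_real_beta_weight.
- by move=> i x _; rewrite lee_fin real_beta_weight_ge0.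
Qed.

Let prim a b t : R := t `^ a * (1 - t) `^ b.

Let is_derive_prim a b t : 0 < t < 1 ->
  is_derive t 1 (prim a b) (a * weight a (b + 1) t - b * weight (a + 1) b t).
Proof.
move=> /andP[t0 t1].
have H1 : is_derive t 1 (cst 1 - @id R) (- 1 : R).
  by rewrite -(sub0r 1); apply: is_deriveB.
have H2 : is_derive (1 - t) 1 (fun x : R => x `^ b) (b * (1 - t) `^ (b - 1)).
  by apply: is_derive1_powR; rewrite subr_gt0.
have H3 := @is_derive1_comp _ (fun x : R => x `^ b) (cst 1 - @id R) t _ _ H2 H1.
have H4 := is_derive1_powR a t0.
have := @is_deriveM _ _ _ _ _ _ _ _ H4 H3.
move=> H5; apply: (is_derive_eq H5).
rewrite /GRing.scale/= /real_beta_weight !addrK mulrN1 mulrN addrC.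
by rewrite !fctE/=; ring.
Qed.

Let cut_FTC a b n :
  (a%:E * (\int[leb]_(t in `[cut n, (1 - cut n)%R]) (weight a (b + 1) t)%:E)
   + (prim a b (cut n))%:E =
   b%:E * (\int[leb]_(t in `[cut n, (1 - cut n)%R]) (weight (a + 1) b t)%:E)
   + (prim a b (1 - cut n))%:E)%E.
Proof.
have sub01 t : t \in `[cut n, 1 - cut n] -> 0 < t < 1.
  rewrite in_itv/= => /andP[ct tc]; rewrite (lt_le_trans _ ct)//=.
  by rewrite (le_lt_trans tc)// ltrBlDr ltrDl.
have cw a' b' t : t \in `[cut n, 1 - cut n] -> {for t, continuous (weight a' b')}.
  move=> /sub01 /andP[t0 t1].
  have := @is_derive_prim (a' - 1) (b' - 1) t.
  rewrite t0 t1 => /(_ isT) [dF _].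
  by apply/differentiable_continuous/derivable1_diffP.
have cwi a' b' : {within `[cut n, 1 - cut n], continuous (weight a' b')}.
  apply: continuous_in_subspaceT => t; rewrite inE; exact: cw.
have iw a' b' : leb.-integrable `[cut n, 1 - cut n] (EFin \o weight a' b').
  by apply: continuous_compact_integrable => //; exact: segment_compact.
have iaw c a' b' : leb.-integrable `[cut n, 1 - cut n] (fun t => (c * weight a' b' t)%:E).
  rewrite (_ : (fun t => _) = (fun t => c%:E * (EFin \o weight a' b') t)%E).
    by apply: integrableZl => //; exact: iw.
  by apply/funext => t /=; rewrite EFinM.
have cF t : t \in `[cut n, 1 - cut n] -> {for t, continuous (prim a b)}.
  move=> /sub01 t01; have [dF _] := @is_derive_prim a b t t01.
  by apply/differentiable_continuous/derivable1_diffP.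
have := @continuous_FTC2 _ (fun t => a * weight a (b + 1) t - b * weight (a + 1) b t)
  (prim a b) (cut n) (1 - cut n) (cut_lt n) => /(_ _ _ _)/wrap[].
- apply: continuous_in_subspaceT => t; rewrite inE => tn.
  apply: cvgB; (apply: cvgM; [exact: cvg_cst|exact: cw]).
- split.
  + move=> t tn; have t01 : 0 < t < 1.
      by apply: sub01; move: tn; rewrite !in_itv/= => /andP[/ltW-> /ltW->].
    by have [dF _] := @is_derive_prim a b t t01.
  + apply: cvg_at_right_filter; apply: cF.
    by rewrite in_itv/= lexx/= ltW// cut_lt.
  + apply: cvg_at_left_filter; apply: cF.
    by rewrite in_itv/= lexx/= andbT ltW// cut_lt.
- move=> t tn; have t01 : 0 < t < 1.
    by apply: sub01; move: tn; rewrite !in_itv/= => /andP[/ltW-> /ltW->].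
  by rewrite derive1E; have [_ ->] := @is_derive_prim a b t t01.
under eq_integral do rewrite EFinB.
rewrite integralB_EFin//; [|exact: iaw|exact: iaw].
have lin c a' b' : (\int[leb]_(t in `[cut n, (1 - cut n)%R]) (c * weight a' b' t)%:E =
    c%:E * \int[leb]_(t in `[cut n, (1 - cut n)%R]) (weight a' b' t)%:E)%E.
  by under eq_integral do rewrite EFinM; rewrite integralZl//; exact: iw.
rewrite !lin.
have fi a' b' : (\int[leb]_(t in `[cut n, (1 - cut n)%R]) (weight a' b' t)%:E \is a fin_num)%E.
  by apply: integrable_fin_num => //; exact: iw.
rewrite -[X in (a%:E * X)%E]fineK// -[X in (b%:E * X)%E]fineK//.
rewrite -!EFinM -!EFinB -!EFinD => -[E]; congr EFin.
by move: E; lra.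
Qed.

Let cut_cvg0 : cut n @[n --> \oo] --> 0.
Proof.
rewrite /cut; have := @cvg_harmonic R; rewrite -(cvg_shiftn 2) => h.
apply: cvg_trans h; apply: near_eq_cvg; apply: nearW => n /=.
by rewrite /harmonic/= addn2.
Qed.

Let powR_le1 b t : 0 <= b -> 0 <= t -> t <= 1 -> t `^ b <= 1.
Proof.
move=> b0 t0 t1; have -> : 1 = 1 `^ b :> R by rewrite powR1.
by apply: ge0_ler_powR; rewrite ?nnegrE.
Qed.

Let prim_le a b t : 0 < b -> 0 <= t <= 1 -> 0 <= prim a b t <= t `^ a.
Proof.
move=> b0 /andP[t0 t1]; rewrite mulr_ge0 ?powR_ge0//=.
by rewrite ler_piMr ?powR_ge0// powR_le1 ?(ltW b0)// ?subr_ge0// gerBl.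
Qed.

Let cut_prim0 a b : 0 < a -> 0 < b ->
  prim a b (cut n) @[n --> \oo] --> 0.
Proof.
move=> a0 b0.
have h : cut n `^ a @[n --> \oo] --> 0.
  have /cvg_at_rightP := powR_cvg0 a0; apply; split => //.
apply: (@squeeze_cvgr _ _ _ _ (fun=> 0) (fun n => cut n `^ a)) => //.
  apply: nearW => n; apply: prim_le => //; rewrite ltW//=.
  by have := cut_lt n; have := cut_gt0 n; lra.
exact: cvg_cst.
Qed.

Let primC a b t : prim a b (1 - t) = prim b a t.
Proof. by rewrite /prim mulrC subKr. Qed.

(** Both sides are limits of the same sequence, written in the two ways given by [cut_FTC]; the
    boundary terms vanish because [a] and [b] are positive. *)
Lemma ebeta_parts a b : 0 < a -> 0 < b ->
  (a%:E * ebeta a (b + 1) = b%:E * ebeta (a + 1) b)%E.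
Proof.
move=> a0 b0.
pose u n := (a%:E * (\int[leb]_(t in `[cut n, (1 - cut n)%R]) (weight a (b + 1) t)%:E)
   + (prim a b (cut n))%:E)%E.
have hu : u n @[n --> \oo] --> (a%:E * ebeta a (b + 1) + 0%:E)%E.
  apply: cvgeD.
  - by rewrite fin_num_adde_defl.
  - by apply: cvgeZl => //; exact: cut_cvg.
  - by apply: cvg_EFin; [exact: nearW|exact: cut_prim0].
have hv : u n @[n --> \oo] --> (b%:E * ebeta (a + 1) b + 0%:E)%E.
  rewrite /u; under eq_fun do rewrite cut_FTC primC.
  apply: cvgeD.
  - by rewrite fin_num_adde_defl.
  - by apply: cvgeZl => //; exact: cut_cvg.
  - by apply: cvg_EFin; [exact: nearW|exact: cut_prim0].
by have := cvg_unique _ hu hv; rewrite !adde0; apply.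
Qed.

Let ebeta_fin11 a b : 0 < a -> 0 < b -> (ebeta (a + 1) (b + 1) < +oo)%E.
Proof.
move=> a0 b0; apply: (@le_lt_trans _ _ (\int[leb]_(t in `[0%R, 1%R]) 1%:E)%E).
  apply: ge0_le_integral => //=.
  - by move=> t _; rewrite lee_fin real_beta_weight_ge0.
  - exact: measurable_EFin_real_beta_weight.
  - move=> t; rewrite in_itv/= => /andP[t0 t1].
    rewrite lee_fin /real_beta_weight !addrK mulr_ile1 ?powR_ge0// powR_le1 ?(ltW a0) ?(ltW b0)// ?subr_ge0//.
    by rewrite gerBl.
by rewrite integral_cst//= lebesgue_measure_itv/= lte_fin ltr01 mul1e ltry.
Qed.

(** Finiteness starts at parameters [a + 1, b + 1], where the weight is at most 1, and is pulled
    down: [ebetaD] splits an integral into the two with one parameter raised, and [ebeta_parts]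
    transfers finiteness from one of these to the other. *)
Lemma ebeta_lty a b : 0 < a -> 0 < b -> (ebeta a b < +oo)%E.
Proof.
have step a' b' (c : R) : 0 < c -> (c%:E * ebeta a' b' < +oo)%E -> (ebeta a' b' < +oo)%E.
  move=> c0; have := ebeta_ge0 a' b'; case: (ebeta a' b') => [r||]//.
    by rewrite !ltry.
  by rewrite gt0_muley.
have mulfin c x : (x < +oo)%E -> 0 < c -> (0 <= x)%E -> (c%:E * x < +oo :> \bar R)%E.
  by move: x => [r||]// _ c0 _; rewrite -EFinM ltry.
have r1 a' b' : 0 < a' -> 0 < b' -> (ebeta (a' + 1) b' < +oo)%E.
  move=> a0 b0; have a1 : 0 < a' + 1 by rewrite addr_gt0.
  rewrite (ebetaD a1 b0); apply: lte_add_pinfty; last exact: ebeta_fin11.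
  apply: (step _ _ b') => //; rewrite -ebeta_parts//.
  by apply: mulfin; rewrite ?ebeta_ge0 ?ebeta_fin11.
move=> a0 b0; rewrite (ebetaD a0 b0); apply: lte_add_pinfty; first exact: r1.
apply: (step _ _ a) => //; rewrite ebeta_parts//.
by apply: mulfin; rewrite ?ebeta_ge0 ?r1.
Qed.

Lemma EFin_real_beta_fun a b : 0 < a -> 0 < b ->
  (real_beta_fun a b)%:E = ebeta a b.
Proof.
move=> a0 b0; rewrite /real_beta_fun /Rintegral fineK//.
by rewrite ge0_fin_numE ?ebeta_lty// ebeta_ge0.
Qed.

Lemma real_beta_funDl a b : 0 < a -> 0 < b ->
  real_beta_fun (a + 1) b = a / (a + b) * real_beta_fun a b.
Proof.
move=> a0 b0; have a1 : 0 < a + 1 by rewrite addr_gt0.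
have b1 : 0 < b + 1 by rewrite addr_gt0.
have := ebetaD a0 b0; have := ebeta_parts a0 b0.
rewrite -!EFin_real_beta_fun// -!EFinM -EFinD => -[E1] [E2].
rewrite E2 mulrAC mulrDr E1 -mulrDl mulrAC divff ?mul1r//.
by rewrite gt_eqF// addr_gt0.
Qed.

Lemma real_beta_funDr a b : 0 < a -> 0 < b ->
  real_beta_fun a (b + 1) = b / (a + b) * real_beta_fun a b.
Proof.
move=> a0 b0; have a1 : 0 < a + 1 by rewrite addr_gt0.
have b1 : 0 < b + 1 by rewrite addr_gt0.
have := ebetaD a0 b0; have := ebeta_parts a0 b0.
rewrite -!EFin_real_beta_fun// -!EFinM -EFinD => -[E1] [E2].
rewrite E2 mulrAC mulrDr -E1 -mulrDl mulrAC divff ?mul1r//.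
by rewrite gt_eqF// addr_gt0.
Qed.

Lemma real_beta_fun_gt0 a b : 0 < a -> 0 < b -> 0 < real_beta_fun a b.
Proof.
move=> a0 b0; rewrite -lte_fin EFin_real_beta_fun//.
rewrite lt0e ebeta_ge0 andbT; apply/eqP => B0.
have := @ae_eq_integral_abs _ _ _ leb `[0%R, 1%R]%classic (measurable_itv _)
  (fun t => (weight a b t)%:E) (@measurable_EFin_real_beta_weight _ a b).
under eq_integral do rewrite gee0_abs ?lee_fin ?real_beta_weight_ge0//.
rewrite -/(ebeta a b) B0 => -[/(_ erefl) + _].
move=> [N [mN N0 sN]].
have : (leb `]0%R, 1%R[%classic <= leb N)%E.
  apply: le_measure; rewrite ?inE// => t; rewrite /= in_itv/= => /andP[t0 t1].
  apply: sN => /= /(_ _) E; have : t \in `[0, 1] by rewrite in_itv/= !ltW.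
  move=> /E [] /eqP.
  by rewrite mulf_eq0 !powR_eq0 (gt_eqF t0)/= gt_eqF ?subr_gt0.
by rewrite N0 lebesgue_measure_itv/= lte_fin ltr01 lee_fin; lra.
Qed.

End RealBeta.

(** * Independent uniform variables on the unit interval *)

Definition to_mfun d d' (T : measurableType d) (T' : measurableType d')
    (f : T -> T') (mf : measurable_fun setT f) : {mfun T >-> T'} :=
  HB.pack f (isMeasurableFun.Build _ _ _ _ _ mf).

Section Rays.
Context {R : realType}.
Local Open Scope ereal_scope.

(** Finite total mass turns left rays into right rays by complements, and the open right rays are an
    intersection-stable generator of the Borel sets. *)
Lemma finite_measure_eq_rays
    (m1 m2 : {measure set (measurableTypeR R) -> \bar R}) :
  m1 setT < +oo -> m1 setT = m2 setT ->
  (forall x : R, m1 `]-oo, x]%classic = m2 `]-oo, x]%classic) ->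
  forall A, measurable A -> m1 A = m2 A.
Proof.
move=> m1oo m12T m12.
have ray x : `]x, +oo[%classic = setT `\` `]-oo, x]%classic :> set R.
  by rewrite setTD setCitvl.
have H (x : R) : m1 `]x, +oo[%classic = m2 `]x, +oo[%classic.
  rewrite ray measureD// [RHS]measureD//; last by rewrite /= -m12T.
  by rewrite !setTI; congr (_ - _)%E; [exact: m12T|exact: m12].
move=> A mA; apply: (@measure_unique _ R (measurableTypeR R) (@RGenOInfty.G R) (fun n => `](- n%:R)%R, +oo[%classic)) => //.
- exact: RGenOInfty.measurableE.
- move=> _ _ [x ->] [y ->]; exists (Num.max x y).
  apply/seteqP; split => z /=; rewrite !in_itv/= !andbT gt_max; first by move=> [-> ->].
  by move=> /andP[].
- by move=> n; exists (- n%:R)%R.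
- apply/seteqP; split => // x _; exists (Num.trunc `|x|).+1 => //=.
  rewrite in_itv/= andbT ltrNl (le_lt_trans (ler_norm _))// normrN.
  exact: truncnS_gt.
- by move=> _ [x ->]; exact: H.
- by move=> n; rewrite (le_lt_trans _ m1oo)// le_measure ?inE.
Qed.

(** Freeze one event [D] at a time: [A |-> P (Z in A, D)] and [A |-> P D * P (Z in A)] are finite
    measures that agree on rays. This is applied first to [Y], then to [X]. *)
Lemma independent_rays d (T : measurableType d) (P : probability T R)
    (X Y : T -> measurableTypeR R) :
  measurable_fun setT X -> measurable_fun setT Y ->
  (forall s t : R, P ([set w | X w <= s]%R `&` [set w | Y w <= t]%R) =
     P [set w | X w <= s]%R * P [set w | Y w <= t]%R) ->
  forall A B, measurable A -> measurable B ->
    P (X @^-1` A `&` Y @^-1` B) = P (X @^-1` A) * P (Y @^-1` B).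
Proof.
move=> mX mY indep.
have pre (Z : T -> measurableTypeR R) A : measurable_fun setT Z -> measurable A ->
    measurable (Z @^-1` A).
  by move=> mZ mA; rewrite -[X in measurable X]setTI; exact: mZ.
have rayE (Z : T -> measurableTypeR R) x : Z @^-1` `]-oo, x]%classic = [set w | Z w <= x]%R.
  by apply/seteqP; split => w /=; rewrite in_itv.
have prod_rays (Z : T -> measurableTypeR R) (mZ : measurable_fun setT Z) D
    (mD : measurable D) :
    (forall s, P ([set w | Z w <= s]%R `&` D) = P [set w | Z w <= s]%R * P D) ->
    forall A, measurable A -> P (Z @^-1` A `&` D) = P (Z @^-1` A) * P D.
  move=> ZD A mA.
  have PD : (0 <= fine (P D))%R by exact: fine_ge0.
  pose c := NngNum PD.
  pose X' : {mfun T >-> measurableTypeR R} := to_mfun mZ.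
  have := @finite_measure_eq_rays (pushforward (mrestr P mD) X') (mscale c (pushforward P X')).
  rewrite /= /mscale/= /pushforward/= /mrestr/= => /(_ mZ mZ _ _ _ A mA) ->.
  - by rewrite muleC fineK// fin_num_measure.
  - by rewrite preimage_setT setTI (le_lt_trans (probability_le1 _ _))// ltry.
  - by rewrite preimage_setT setTI probability_setT mule1 fineK// fin_num_measure.
  - by move=> x; rewrite rayE ZD muleC fineK// fin_num_measure.
move=> A B mA mB.
apply: (prod_rays X mX) => //; first exact: pre.
move=> s; rewrite setIC [RHS]muleC; apply: (prod_rays Y mY) => //.
  by rewrite -rayE; exact: pre.
by move=> t; rewrite setIC indep muleC.
Qed.

End Rays.

(** * Two independent uniform variables from the binary digits of one *)

Section DigitSplit.
Context {R : realType}.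
Local Notation U := (uniform_prob (@ltr01 R)).

Fixpoint digits (b : nat -> nat) (n m : nat) : nat :=
  if n is n'.+1 then (digits b n' (m %/ 4) * 2 + b m)%N else 0%N.

(* The alternate binary digits of a [2n]-bit number, which is read in base 4. *)
Definition even_digits := digits (fun m => m %% 4 %/ 2)%N.
Definition odd_digits := digits (fun m => m %% 2)%N.

(** The two digit maps together are a bijection from the integers below [4 ^ n] to the pairs of
    integers below [2 ^ n]: the discrete form of the independence of the two digit sums. *)
Lemma sum_digits n (f : nat -> nat -> R) :
  \sum_(0 <= m < 4 ^ n) f (even_digits n m) (odd_digits n m) =
  \sum_(0 <= p < 2 ^ n) \sum_(0 <= q < 2 ^ n) f p q.
Proof.
elim: n f => [|n IH] f; first by rewrite !expn0 !big_nat1.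
have blocks b k (F : nat -> R) : \sum_(0 <= i < k * b) F i =
    \sum_(0 <= i < k) \sum_(0 <= j < b) F (i * b + j)%N.
  rewrite big_nat_mul; apply: eq_bigr => i _.
  rewrite -{1}[(i * b)%N]add0n big_addn mulSn addnK.
  by apply: eq_bigr => j _; rewrite addnC.
rewrite expnSr blocks expnSr !blocks.
under eq_bigr.
  move=> m _.
  have dE j : (j < 4)%N -> f (even_digits n.+1 (m * 4 + j)) (odd_digits n.+1 (m * 4 + j)) =
      f (even_digits n m * 2 + j %/ 2)%N (odd_digits n m * 2 + j %% 2)%N.
    move=> j4 /=; congr (f (_ * 2 + _) (_ * 2 + _))%N.
    - by rewrite divnMDl// divn_small// addn0.
    - by rewrite modnMDl modn_small.
    - by rewrite divnMDl// divn_small// addn0.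
    - by rewrite (_ : 4 = 2 * 2)%N// mulnA modnMDl.
  rewrite unlock /= !dE// /= addr0.
  over.
pose g i j := fun p q : nat => f (p * 2 + i)%N (q * 2 + j)%N.
rewrite (IH (fun p q => g 0%N 0%N p q + (g 0%N 1%N p q + (g 1%N 0%N p q + g 1%N 1%N p q)))).
apply: eq_bigr => p _.
rewrite [RHS](big_nat_recr 1)//= big_nat1 !blocks -big_split/=; apply: eq_bigr => q _.
by rewrite !(big_nat_recr 1)//= !big_nat1 /g !addrA.
Qed.

Lemma uniform_probE (A : set R) : measurable A ->
  U A = lebesgue_measure (A `&` `[0, 1]%classic).
Proof.
move=> mA; rewrite /uniform_prob integral_uniform_pdf.
have mI : measurable (A `&` `[0%R, 1%R]%classic) by exact: measurableI.
rewrite -[RHS]mul1e -integral_cst//; apply: eq_integral => x.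
by rewrite inE/= in_itv/= /uniform_pdf subr0 invr1 => -[_ ->].
Qed.

Lemma uniform_prob_sub (A : set R) : measurable A -> A `<=` `[0, 1]%classic ->
  U A = lebesgue_measure A.
Proof. by move=> mA /setIidl A01; rewrite uniform_probE// A01. Qed.

Lemma uniform_prob01 (A : set R) : measurable A ->
  U A = U (A `&` `[0, 1[%classic).
Proof.
move=> mA; have mI : measurable (`[0, 1[%classic : set R) by [].
have UI : U `[0, 1[%classic = 1%E.
  rewrite uniform_probE// setIidl; last exact: subset_itv_co_cc.
  by rewrite lebesgue_measure_itv/= lte_fin ltr01 sube0.
have U0 : U (A `\` `[0, 1[%classic) = 0%E.
  apply/eqP; rewrite eq_le measure_ge0 andbT.
  have <- : U (~` `[0, 1[%classic) = 0%E.
    by rewrite probability_setC// [X in (1 - X)%E]UI subee.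
  by rewrite le_measure ?inE//; [exact: measurableD|exact: measurableC].
rewrite -{1}(setUIDK A `[0, 1[%classic) measureU ?U0 ?adde0//.
- by rewrite [X in (_ + X)%E]U0 adde0.
- by apply: measurableI.
- by apply: measurableD.
- by rewrite setDE setIACA setICr setI0.
Qed.

(** Passing to the coarser grid drops the last base [b] digit, which makes the approximations
    increase with [n]. For negative [x] both truncations are 0. *)
Lemma truncM_div (b n : nat) (x : R) : (0 < b)%N ->
  (Num.trunc ((b ^ n.+1)%:R * x) %/ b)%N = Num.trunc ((b ^ n)%:R * x).
Proof.
move=> b0; have [x0|x0] := leP 0 x; last first.
  have neg k : Num.trunc ((b ^ k)%:R * x) = 0%N.
    apply/eqP; rewrite -leqn0 truncn_le_nat.
    by rewrite (le_lt_trans _ ltr01)// mulr_ge0_le0 ?ler0n// ltW.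
  by rewrite !neg div0n.
have y0 k : 0 <= (b ^ k)%:R * x by rewrite mulr_ge0.
apply/esym/truncn_def; have /andP[lo hi] := truncn_itv (y0 n.+1).
have bE : (b ^ n.+1)%:R * x = b%:R * ((b ^ n)%:R * x).
  by rewrite expnS natrM mulrA.
have bp : 0 < b%:R :> R by rewrite ltr0n.
apply/andP; split.
  rewrite -(ler_pM2l bp) -bE (le_trans _ lo)// -natrM ler_nat mulnC.
  exact: leq_divM.
rewrite -(ltr_pM2l bp) -bE (lt_le_trans hi)// -natrM ler_nat mulnC.
by rewrite ltn_ceil.
Qed.

Lemma measurable_trunc_comp (N : nat) (g : nat -> R) :
  measurable_fun setT (fun x : R => g (Num.trunc (N%:R * x))).
Proof.
move=> _ B mB; rewrite setTI.
rewrite (_ : _ @^-1` B = \bigcup_(m in [set m | B (g m)])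
    [set x : R | Num.trunc (N%:R * x) = m]); last first.
  apply/seteqP; split => x /=; first by move=> Bx; exists (Num.trunc (N%:R * x)).
  by move=> [m /= Bm ->].
apply: bigcup_measurable => m _.
have mM : measurable_fun setT (fun x : R => N%:R * x) by exact: measurable_funM.
case: m => [|m].
  rewrite (_ : [set x | _] = (fun x : R => N%:R * x) @^-1` `]-oo, 1[%classic).
    by rewrite -[X in measurable X]setTI; exact: mM.
  apply/seteqP; split => x /=; rewrite in_itv/=.
    by move=> /eqP; rewrite -leqn0 truncn_le_nat.
  by move=> x1; apply/eqP; rewrite -leqn0 truncn_le_nat.
rewrite (_ : [set x | _] = (fun x : R => N%:R * x) @^-1` `[m.+1%:R, m.+2%:R[%classic).
  by rewrite -[X in measurable X]setTI; exact: mM.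
apply/seteqP; split => x /=; rewrite in_itv/=.
  move=> xm; have x0 : 0 <= N%:R * x.
    by have := truncn_gt0 (N%:R * x); rewrite xm => /esym/(le_trans ler01).
  by have := truncn_itv x0; rewrite xm.
exact: truncn_def.
Qed.

(** Turns probabilities at level [N] into counts of grid points, so that [sum_digits] applies. The
    induction adds one cell of length [1 / N] at a time. *)
Lemma uniform_prob_trunc (N : nat) (g : pred nat) : (0 < N)%N ->
  U [set x | 0 <= x < 1 /\ g (Num.trunc (N%:R * x))] =
  (\sum_(0 <= m < N) (g m)%:R / N%:R)%:E.
Proof.
move=> N0; have Np : 0 < N%:R :> R by rewrite ltr0n.
pose S (M : nat) : set R := [set x | 0 <= x < M%:R / N%:R /\ g (Num.trunc (N%:R * x))].
pose J (m : nat) : set R := `[m%:R / N%:R, m.+1%:R / N%:R[%classic.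
suff H M : (M <= N)%N -> measurable (S M) /\
    U (S M) = (\sum_(0 <= m < M) (g m)%:R / N%:R)%:E.
  rewrite (_ : [set x | _] = S N); first by have [] := H N (leqnn N).
  by apply/seteqP; split=> x; rewrite /S/= divff ?gt_eqF.
elim: M => [_|M IH MN].
  have -> : S 0%N = set0.
    rewrite -subset0 => x [/andP[x0]]; rewrite mul0r => /(le_lt_trans x0).
    by rewrite ltxx.
  by rewrite measure0 big_geq.
have [mS US] := IH (ltnW MN).
have SE : S M.+1 = S M `|` (if g M then J M else set0).
  apply/seteqP; split => x.
    move=> [/andP[x0 xM] gx].
    have [xM'|xM'] := ltP x (M%:R / N%:R); first by left; rewrite /S/= x0.
    right; have xJ : J M x by rewrite /J/= in_itv/= xM' xM.
    have tM : Num.trunc (N%:R * x) = M.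
      by apply: truncn_def; rewrite mulrC -ler_pdivrMr// xM' -ltr_pdivlMr.
    by move: gx; rewrite tM => ->.
  move=> [[/andP[x0 xM] gx]|]; first split => //.
    by rewrite x0 (lt_le_trans xM)// ler_pM2r ?invr_gt0// ler_nat.
  case: ifPn => // gM; rewrite /J/= in_itv/= => /andP[Mx xM].
  have x0 : 0 <= x by rewrite (le_trans _ Mx).
  split; first by rewrite x0.
  suff -> : Num.trunc (N%:R * x) = M by [].
  by apply: truncn_def; rewrite mulrC -ler_pdivrMr// Mx -ltr_pdivlMr.
have mJ : measurable (if g M then J M else set0 : set R).
  by case: ifP => _; [exact: measurable_itv|exact: measurable0].
split; first by rewrite SE; exact: measurableU.
rewrite SE measureU//; last first.
  rewrite -subset0 => x [[/andP[_ xM] _]]; case: ifP => // _.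
  by rewrite /J/= in_itv/= leNgt xM.
rewrite big_nat_recr//= US EFinD; congr (_ + _)%E.
case: ifP => gM; last by rewrite measure0 mul0r.
rewrite [LHS]uniform_prob_sub; last 2 first.
- exact: measurable_itv.
- move=> x; rewrite /J/= !in_itv/= => /andP[Mx xM].
  rewrite (le_trans _ Mx)//= (le_trans (ltW xM))// ler_pdivrMr// mul1r.
  by rewrite ler_nat.
rewrite lebesgue_measure_itv/= lte_fin ltr_pM2r ?invr_gt0// ltr_nat ltnSn.
by rewrite -EFinB -mulrBl -natrB// subSnn.
Qed.

Definition digit_approx (b : nat -> nat) (n : nat) (x : R) : R :=
  (digits b n (Num.trunc ((4 ^ n)%:R * x)))%:R / (2 ^ n)%:R.

Definition digit_sum b (x : R) : R := limn (fun n => digit_approx b n x).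

Section Approximation.
Variable b : nat -> nat.
Hypothesis b2 : forall m, (b m < 2)%N.

Let p2 n : 0 < (2 ^ n)%:R :> R. Proof. by rewrite ltr0n expn_gt0. Qed.

Lemma digits_lt n m : (digits b n m < 2 ^ n)%N.
Proof.
elim: n m => [|n IH] m //=; rewrite expnSr.
by have := IH (m %/ 4)%N; have := b2 m; lia.
Qed.

Lemma digit_approx_nd x : nondecreasing_seq (fun n => digit_approx b n x).
Proof.
apply/nondecreasing_seqP => n; rewrite /digit_approx /= (@truncM_div 4)//.
rewrite ler_pdivrMr// mulrAC ler_pdivlMr// -!natrM ler_nat expnSr.
set d := digits _ _ _; set e := b _; nia.
Qed.

Lemma digit_approx_le1 n x : digit_approx b n x <= 1.
Proof. by rewrite ler_pdivrMr// mul1r ler_nat ltnW// digits_lt. Qed.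

Lemma is_cvg_digit_approx x : cvgn (fun n => digit_approx b n x).
Proof.
apply: nondecreasing_is_cvgn; first exact: digit_approx_nd.
by exists 1 => _ [n _ <-]; exact: digit_approx_le1.
Qed.

(** The approximations increase to their limit, so the event with [<=] is a decreasing intersection
    of events at finite levels, to which continuity from above applies. *)
Lemma digit_sum_le x s : (digit_sum b x <= s) <-> forall n, digit_approx b n x <= s.
Proof.
split=> [xs n|xs].
  apply: le_trans xs; apply: nondecreasing_cvgn_le.
    exact: digit_approx_nd.
  exact: is_cvg_digit_approx.
apply: limr_le; first exact: is_cvg_digit_approx.
exact: nearW.
Qed.

Lemma measurable_digit_approx n : measurable_fun setT (digit_approx b n).
Proof.
exact: (measurable_trunc_comp (4 ^ n) (fun m => (digits b n m)%:R / (2 ^ n)%:R)).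
Qed.

Lemma measurable_digit_sum : measurable_fun setT (digit_sum b : R -> R).
Proof.
apply: (measurable_fun_cvg (fun n => measurable_digit_approx n)) => x _.
exact: is_cvg_digit_approx.
Qed.

End Approximation.

Let grid_cdf (n : nat) (s : R) : R :=
  \sum_(0 <= p < 2 ^ n) (p%:R / (2 ^ n)%:R <= s)%R%:R / (2 ^ n)%:R.

Let even_lt2 m : (m %% 4 %/ 2 < 2)%N. Proof. by rewrite ltn_divLR// ltn_mod. Qed.
Let odd_lt2 m : (m %% 2 < 2)%N. Proof. by rewrite ltn_mod. Qed.

Let even_sum := digit_sum (fun m => m %% 4 %/ 2)%N.
Let odd_sum := digit_sum (fun m => m %% 2)%N.

Let approx_cvg (A : nat -> set R) (B : set R) (u : nat -> R) :
  (forall n, measurable (A n)) -> (forall n, A n.+1 `<=` A n) ->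
  B = \bigcap_n A n -> (forall n, U (A n) = (u n)%:E) ->
  (u n)%:E @[n --> \oo] --> U B.
Proof.
move=> mA Asub -> UA.
have := @nonincreasing_cvg_mu _ _ _ U A.
rewrite (_ : (U \o A) = (fun n => (u n)%:E)); last by apply/funext => n /=; rewrite UA.
apply => //.
- by rewrite [X in (X < _)%E]UA ltry.
- by apply: bigcap_measurable => // n _; exact: mA.
- apply/nonincreasing_seqP => n; apply/subsetPset; exact: Asub.
Qed.

Let le_set (f : R -> R) s : set R := [set x | f x <= s].

Let measurable_le_set (f : R -> R) s : measurable_fun setT f -> measurable (le_set f s).
Proof.
move=> mf; rewrite (_ : le_set f s = f @^-1` `]-oo, s]%classic).
  by rewrite -[X in measurable X]setTI; exact: mf.
by apply/seteqP; split => x; rewrite /le_set/= in_itv.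
Qed.

Let joint_approx s t :
  (grid_cdf n s * grid_cdf n t)%:E @[n --> \oo] -->
  U (le_set even_sum s `&` le_set odd_sum t).
Proof.
apply: (@approx_cvg (fun n => le_set (digit_approx (fun m => m %% 4 %/ 2)%N n) s `&`
   le_set (digit_approx (fun m => m %% 2)%N n) t)).
- move=> n; apply: measurableI; apply: measurable_le_set;
    exact: measurable_digit_approx.
- move=> n; apply: setISS => x; rewrite /le_set/=; apply: le_trans.
    by move/nondecreasing_seqP: (@digit_approx_nd (fun m => m %% 4 %/ 2)%N x); apply.
  by move/nondecreasing_seqP: (@digit_approx_nd (fun m => m %% 2)%N x); apply.
- apply/seteqP; split => x.
    move=> [/= /(digit_sum_le even_lt2) xs /(digit_sum_le odd_lt2) xt] n _.
    by split; [exact: xs|exact: xt].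
  move=> H; split; apply/digit_sum_le => // n; by have [] := H n I.
- move=> n.
  pose g (m : nat) := ((even_digits n m)%:R / (2 ^ n)%:R <= s) &&
                  ((odd_digits n m)%:R / (2 ^ n)%:R <= t).
  have mAB : measurable (le_set (digit_approx (fun m => m %% 4 %/ 2)%N n) s `&`
      le_set (digit_approx (fun m => m %% 2)%N n) t).
    by apply: measurableI; apply: measurable_le_set; exact: measurable_digit_approx.
  have p4 : (0 < 4 ^ n)%N by rewrite expn_gt0.
  rewrite uniform_prob01//.
  transitivity (U [set x | 0 <= x < 1 /\ g (Num.trunc ((4 ^ n)%:R * x))]).
    congr (U _); apply/seteqP; split => x.
      by move=> [[xs xt]]; rewrite /= in_itv/= => x01; split=> //; apply/andP.
    by move=> [x01 /andP[xs xt]]; split; rewrite /= ?in_itv.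
  rewrite uniform_prob_trunc//; congr EFin.
  rewrite (sum_digits n (fun p q => ((p%:R / (2 ^ n)%:R <= s) &&
     (q%:R / (2 ^ n)%:R <= t))%R%:R / (4 ^ n)%:R)).
  rewrite /grid_cdf big_distrl/=; apply: eq_bigr => p _.
  rewrite big_distrr/=; apply: eq_bigr => q _.
  rewrite mulrACA -natrM mulnb -invfM -natrM -expnMn.
  by [].
Qed.

Let cdf_approx s : (grid_cdf n s)%:E @[n --> \oo] --> U (le_set id s).
Proof.
pose f n (x : R) : R := (Num.trunc ((2 ^ n)%:R * x))%:R / (2 ^ n)%:R.
have p2 n : 0 < (2 ^ n)%:R :> R by rewrite ltr0n expn_gt0.
have mf n : measurable_fun setT (f n).
  exact: (measurable_trunc_comp (2 ^ n) (fun m => m%:R / (2 ^ n)%:R)).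
have nf n x : f n x <= f n.+1 x.
  rewrite /f -(@truncM_div 2)// ler_pdivrMr// mulrAC ler_pdivlMr// -!natrM ler_nat.
  by rewrite expnSr; set d := Num.trunc _; have := leq_divM d 2; nia.
rewrite uniform_prob01; last exact: measurable_le_set.
apply: (@approx_cvg (fun n => le_set (f n) s `&` `[0, 1[%classic)).
- by move=> n; apply: measurableI => //; exact: measurable_le_set.
- by move=> n; apply: setSI => x; apply: le_trans; exact: nf.
- apply/seteqP; split => x.
    move=> [xs x01] n _; split=> //; move: xs x01; rewrite /le_set/= in_itv/=.
    move=> xs /andP[x0 x1]; apply: le_trans xs; rewrite /f ler_pdivrMr//.
    by rewrite mulrC truncn_le mulr_ge0.
  move=> H; have x01 : `[0, 1[%classic x by have [] := H 0%N I.
  split => //; rewrite /le_set/= leNgt; apply/negP => sx.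
  have {H}xs n : f n x <= s by have [] := H n I.
  pose n := Num.trunc (x - s)^-1.
  have : 1 <= (2 ^ n)%:R * (x - s).
    rewrite -ler_pdivrMr ?subr_gt0// mul1r ltW//.
    by rewrite (lt_le_trans (truncnS_gt _))// ler_nat ltn_expl.
  have := xs n; rewrite /f ler_pdivrMr// => h1.
  have := truncnS_gt ((2 ^ n)%:R * x); rewrite -natr1 => h2.
  by rewrite mulrBr; lra.
- move=> n; rewrite (_ : _ `&` _ = [set x | 0 <= x < 1 /\
    (fun m : nat => m%:R / (2 ^ n)%:R <= s) (Num.trunc ((2 ^ n)%:R * x))]).
    by rewrite (@uniform_prob_trunc _ (fun m : nat => m%:R / (2 ^ n)%:R <= s))// expn_gt0.
  by apply/seteqP; split => x; rewrite /le_set/= in_itv/= => -[? ?].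
Qed.

(** The values of [grid_cdf] are never computed. The joint law of the digit sums and the product of
    two copies of [U] are limits of the same product of [grid_cdf], hence equal. Taking [s = 1] or
    [t = 1] then gives the marginals. *)
Let joint_rays s t : (U (le_set even_sum s `&` le_set odd_sum t) =
  U (le_set id s) * U (le_set id t))%E.
Proof.
apply: (cvg_unique _ (@joint_approx s t)) => //.
apply: cvgeM (@cdf_approx s) (@cdf_approx t).
by rewrite mule_def_fin// fin_num_measure//; exact: measurable_le_set.
Qed.

Let sum_le1 b : (forall m, b m < 2)%N -> le_set (digit_sum b) 1 = setT.
Proof.
move=> b2; apply/seteqP; split => // x _; apply/digit_sum_le => // n.
exact: digit_approx_le1.
Qed.

Let id_le1 : U (le_set id 1) = 1%E.
Proof.
rewrite uniform_probE; last exact: measurable_le_set.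
rewrite setIidr.
  by rewrite lebesgue_measure_itv/= lte_fin ltr01 sube0.
by move=> x; rewrite /= in_itv/= => /andP[].
Qed.

Let even_rays s : U (le_set even_sum s) = U (le_set id s).
Proof. by have := joint_rays s 1; rewrite sum_le1// setIT id_le1 mule1. Qed.

Let odd_rays s : U (le_set odd_sum s) = U (le_set id s).
Proof. by have := joint_rays 1 s; rewrite sum_le1// setTI id_le1 mul1e. Qed.

Let measurable_even_sum : measurable_fun setT even_sum.
Proof. exact: measurable_digit_sum. Qed.

Let measurable_odd_sum : measurable_fun setT odd_sum.
Proof. exact: measurable_digit_sum. Qed.

Let same_law (f : R -> R) : measurable_fun setT f ->
  (forall s, U (le_set f s) = U (le_set id s)) ->
  forall A, measurable A -> U (f @^-1` A) = U A.
Proof.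
move=> mf fU A mA.
have rayE (g : R -> R) x : g @^-1` `]-oo, x]%classic = le_set g x.
  by apply/seteqP; split => w /=; rewrite in_itv.
have := @finite_measure_eq_rays R (pushforward U (f : measurableTypeR R -> measurableTypeR R)) U.
move=> /(_ mf); apply => //=.
by rewrite /pushforward/= preimage_setT [X in (X < _)%E]probability_setT ltry.
Qed.

Lemma uniform_split : exists f g : R -> R,
  [/\ measurable_fun setT f, measurable_fun setT g &
    forall A B, measurable A -> measurable B ->
      U (f @^-1` A `&` g @^-1` B) = (U A * U B)%E].
Proof.
exists even_sum, odd_sum; split => // A B mA mB.
rewrite (@independent_rays _ _ _ U even_sum odd_sum)//.
  by rewrite [X in (X * _)%E]same_law// [X in (_ * X)%E]same_law.
move=> s t; rewrite -[LHS]/(U (le_set even_sum s `&` le_set odd_sum t)).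
by rewrite joint_rays -even_rays -odd_rays.
Qed.

End DigitSplit.

Section UniformSequence.
Context {R : realType}.
Local Notation U := (uniform_prob (@ltr01 R)).
Local Open Scope ereal_scope.

(** Split a uniform point into a head [h x] and a tail [t x], keep the head and split the tail
    again: [u n = h (t^n x)]. As the pair of head and tail has law [U \x U], Tonelli takes off the
    factor [f 0], and the induction applies to the tail with [f] shifted. *)
Lemma uniform_sequence : exists u : nat -> R -> R,
  (forall n, measurable_fun setT (u n)) /\
  forall n (f : nat -> R -> R), (forall j, measurable_fun setT (f j)) ->
    (forall j x, (0 <= f j x)%R) ->
    \int[U]_x (\prod_(j < n) f j (u j x))%:E = \prod_(j < n) \int[U]_x (f j x)%:E.
Proof.
have [h [t [mh mt split]]] := @uniform_split R.
exists (fun n x => h (iter n t x)).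
have mu n : measurable_fun setT (fun x => h (iter n t x)).
  apply: measurableT_comp => //.
  elim: n => [|n IH]; first exact: measurable_id.
  exact: (measurableT_comp mt IH).
split=> // n; elim: n => [|n IH] f mf f0.
  under eq_integral do rewrite big_ord0.
  by rewrite big_ord0 integral_cst// [X in _ * X]probability_setT mule1.
pose G (y : R) := (\prod_(j < n) f j.+1 (h (iter j t y)))%R.
have mG : measurable_fun setT G by apply: measurable_prod => j _; exact: measurableT_comp.
have G0 y : (0 <= G y)%R by exact: prodr_ge0.
pose ht (x : measurableTypeR R) : measurableTypeR R * measurableTypeR R := (h x, t x).
have mht : measurable_fun setT ht by exact: measurable_fun_pair.
pose F (z : measurableTypeR R * measurableTypeR R) := (f 0%N z.1 * G z.2)%:E.
have mF : measurable_fun setT F.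
  apply/measurable_EFinP; apply: measurable_funM.
    exact: (measurableT_comp (mf 0%N)).
  exact: (measurableT_comp mG).
have F0 z : 0 <= F z by rewrite lee_fin mulr_ge0.
transitivity (\int[U]_x (F \o ht) x).
  apply: eq_integral => x _; rewrite /F/= big_ord_recl /=; congr (_ * _)%:E.
  by apply: eq_bigr => j _; rewrite -iterS iterSr.
rewrite -[LHS](@ge0_integral_pushforward _ _ _ _ _ ht mht U setT F)//.
rewrite (@eq_measure_integral _ _ _ setT (U \x U)%E); last first.
  move=> A mA _; symmetry; exact: product_measure_unique.
rewrite fubini_tonelli1// /fubini_F/=.
under eq_integral.
  move=> x _; rewrite /F/=; under eq_integral do rewrite EFinM.
  rewrite ge0_integralZl//; last 3 first.
  - exact/measurable_EFinP.
  - by move=> y _; rewrite lee_fin.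
  - by rewrite lee_fin.
  over.
rewrite ge0_integralZr//; last 3 first.
- by apply/measurable_EFinP; exact: (mf 0%N).
- by move=> y _; rewrite lee_fin.
- by apply: integral_ge0 => y _; rewrite lee_fin.
by rewrite big_ord_recl (IH (fun j => f j.+1)).
Qed.

(** The product formula encodes independence and uniform marginals at once. The bounds hold at every
    point, since the painted labels are required to be well formed everywhere. *)
Definition iid_uniform (u : nat -> R -> R) : Prop :=
  [/\ forall n, measurable_fun setT (u n),
      forall n x, (0 <= u n x < 1)%R
    & forall n (f : nat -> R -> R), (forall j, measurable_fun setT (f j)) ->
        (forall j x, (0 <= f j x)%R) ->
        \int[U]_x (\prod_(j < n) f j (u j x))%:E =
        \prod_(j < n) \int[U]_x (f j x)%:E].

Lemma iid_uniform_ex : exists u, iid_uniform u.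
Proof.
have [u [mu uprod]] := uniform_sequence.
(* Points outside the half-open unit interval form a null set and are sent to 0. *)
pose v (x : R) : R := if (0 <= x < 1)%R then x else 0%R.
have mv : measurable_fun setT v.
  apply: measurable_fun_if => //.
  by apply: measurable_and => //; [exact: measurable_fun_ler|exact: measurable_fun_ltr].
have vU A : measurable A -> U (v @^-1` A) = U A.
  move=> mA; rewrite (uniform_prob01 mA) uniform_prob01; last first.
    by rewrite -[X in measurable X]setTI; exact: mv.
  congr (U _); apply/seteqP; split => x [Ax]; rewrite /= in_itv/= => x01.
    by split => //; move: Ax; rewrite /v/= x01.
  by split => //=; rewrite /v x01.
exists (fun n x => v (u n x)); split.
- by move=> n; exact: (measurableT_comp mv).
- move=> n x; rewrite /v; case: ifP => // _.
  by rewrite lexx ltr01.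
- move=> n f mf f0.
  rewrite (uprod n (fun j => f j \o v)) => [|j|j x]; last 2 first.
  + exact: (measurableT_comp (mf j)).
  + exact: f0.
  apply: eq_bigr => j _.
  pose v' : measurableTypeR R -> measurableTypeR R := v.
  have mf' : measurable_fun setT (EFin \o f j : measurableTypeR R -> \bar R).
    by apply/measurable_EFinP; exact: (mf j).
  rewrite -[LHS](@ge0_integral_pushforward _ _ _ _ _ v' mv U setT (EFin \o f j))//.
    by apply: eq_measure_integral => A mA _; exact: vU.
  by move=> y _; rewrite lee_fin f0.
Qed.

End UniformSequence.

(** * Quantile transforms of the Beta laws *)

Section Quantile.
Context {R : realType}.
Local Notation U := (uniform_prob (@ltr01 R)).

(** Defined for any set function, so that it applies to [beta_law a b] for all [a] and [b]. The
    infimum of the empty set is 0, so the value always lies in the unit interval. *)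
Definition quantile (m : set R -> \bar R) (u : R) : R :=
  inf [set t | 0 <= t <= 1 /\ (u%:E <= m `]-oo, t]%classic)%E].

Let quantile_set (m : set R -> \bar R) u : set R :=
  [set t | 0 <= t <= 1 /\ (u%:E <= m `]-oo, t]%classic)%E].

Let lbound0 m u : has_lbound (quantile_set m u).
Proof. by exists 0 => t [/andP[]]. Qed.

Lemma quantile_ge0 m u : 0 <= quantile m u.
Proof.
rewrite /quantile -/(quantile_set m u).
have [->|/set0P ne] := eqVneq (quantile_set m u) set0; first by rewrite inf0.
by apply: lb_le_inf => // t [/andP[]].
Qed.

Lemma quantile_le1 m u : quantile m u <= 1.
Proof.
rewrite /quantile -/(quantile_set m u).
have [->|/set0P [t tS]] := eqVneq (quantile_set m u) set0; first by rewrite inf0.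
have /andP[_ t1] := tS.1; apply: le_trans t1.
by apply: ge_inf.
Qed.

Variable m : probability (measurableTypeR R) R.
Hypothesis m01 : m `[0, 1]%classic = 1%E.

Let F (t : R) : \bar R := m `]-oo, t]%classic.

Let F_nd s t : s <= t -> (F s <= F t)%E.
Proof.
move=> st; rewrite /F le_measure ?inE//.
by apply: subset_itvl; rewrite bnd_simp.
Qed.

Let F1 t : 1 <= t -> F t = 1%E.
Proof.
move=> t1; apply/eqP; rewrite eq_le probability_le1//= -m01.
rewrite /F le_measure ?inE// => x; rewrite /= !in_itv/= => /andP[_ x1].
exact: le_trans t1.
Qed.

Let F0 t : t < 0 -> F t = 0%E.
Proof.
move=> t0; apply/eqP; rewrite eq_le measure_ge0 andbT.
have <- : m (~` `[0, 1]%classic) = 0%E.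
  by rewrite probability_setC// [X in (1 - X)%E]m01 subee.
rewrite /F le_measure ?inE//; first exact: measurableC.
move=> x; rewrite /= !in_itv/= => xt; apply/negP; rewrite negb_and -ltNge.
by rewrite (le_lt_trans xt).
Qed.

Let F_fin t : F t \is a fin_num.
Proof. by rewrite /F fin_num_measure. Qed.

Let F_right t (u : R) : (forall s, t < s -> (u%:E <= F s)%E) -> (u%:E <= F t)%E.
Proof.
move=> uF.
pose X : {RV m >-> R} := @to_mfun _ _ (measurableTypeR R) R idfun (@measurable_id _ _ setT).
have FX s : cdf X s = F s by [].
have cv := @cdf_right_continuous _ _ _ _ X t.
rewrite -(FX t) -(cvg_lim _ cv)//.
apply: lime_ge; first by apply/cvg_ex; eexists; exact: cv.
near=> s; rewrite FX; apply: uF; near: s; exact: nbhs_right_gt.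
Unshelve. all: by end_near. Qed.

(** Right continuity of the distribution function [F] makes the infimum attained, hence an
    equivalence between conditions on [t] and on [u]; measurability and the law of the quantile both
    follow from it. *)
Let quantile_leE t u : 0 <= t -> 0 <= u <= 1 ->
  (quantile m u <= t) = (u%:E <= F t)%E.
Proof.
move=> t0 /andP[u0 u1].
have S1 : quantile_set m u 1.
  by split; rewrite ?ler01 ?lexx// -[m _]/(F 1) F1// lee_fin.
apply/idP/idP => [qt|uF].
  apply: F_right => s ts.
  have : inf (quantile_set m u) < s by apply: le_lt_trans ts.
  move=> /inf_lt[|x [_ ux] xs]; first by exists 1.
  by apply: (le_trans ux); apply: F_nd; exact: ltW.
have [t1|t1] := ltP 1 t; first by rewrite (le_trans (quantile_le1 _ _))// ltW.
apply: ge_inf; first exact: (lbound0 m u).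
by split; rewrite ?t0.
Qed.

Let quantile_out u : ~~ (0 <= u <= 1) -> quantile m u = 0.
Proof.
rewrite negb_and -!ltNge => /orP[u0|u1].
  apply/eqP; rewrite eq_le quantile_ge0 andbT; apply: ge_inf; first exact: (lbound0 m u).
  split; first by rewrite lexx ler01.
  by rewrite (@le_trans _ _ 0%E)// ?lee_fin ?ltW.
rewrite /quantile (_ : [set t | _] = set0) ?inf0// -subset0 => t [_].
rewrite leNgt => /negP; apply; exact: le_lt_trans (probability_le1 m _) _.
Qed.

Let quantile_set_leE t : [set u | quantile m u <= t] =
  if t < 0 then set0 else
  ~` `[0, 1]%classic `|` `[0, fine (F t)]%classic.
Proof.
case: ltP => t0.
  by rewrite -subset0 => u /= ut; have := quantile_ge0 m u; rewrite leNgt (le_lt_trans ut).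
apply/seteqP; split => u /=; rewrite !in_itv/=.
  have [u01|u01] := boolP (0 <= u <= 1); last by left; apply/negP.
  rewrite quantile_leE// => uF; right; have /andP[-> _] := u01.
  by rewrite -lee_fin fineK.
have [u01|u01] := boolP (0 <= u <= 1); last by rewrite quantile_out.
move=> [//|/andP[u0 uF]]; rewrite quantile_leE// -(fineK (F_fin t)) lee_fin.
exact: uF.
Qed.

Lemma measurable_quantile : measurable_fun setT (quantile m).
Proof.
apply: (@measurability _ _ _ _ _ _ (@RGenOInfty.G R)).
  exact: RGenOInfty.measurableE.
move=> _ [_ [t ->] <-]; rewrite setTI.
rewrite (_ : _ @^-1` _ = ~` [set u | quantile m u <= t]).
  apply: measurableC; rewrite quantile_set_leE; case: ifP => // _.
  by apply: measurableU => //; exact: measurableC.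
by apply/seteqP; split => u /=; rewrite in_itv/= andbT ltNge => /negP.
Qed.

Lemma quantile_uniform A : measurable A -> U (quantile m @^-1` A) = m A.
Proof.
move=> mA.
have := @finite_measure_eq_rays R (pushforward U (quantile m : measurableTypeR R -> measurableTypeR R)) m.
move=> /(_ measurable_quantile); apply => //=.
- by rewrite /pushforward/= preimage_setT [X in (X < _)%E]probability_setT ltry.
- rewrite /pushforward/= preimage_setT.
  by rewrite [LHS]probability_setT [RHS]probability_setT.
move=> t; rewrite /pushforward/=.
rewrite (_ : _ @^-1` _ = [set u | quantile m u <= t]); last first.
  by apply/seteqP; split => u /=; rewrite in_itv.
rewrite quantile_set_leE; case: ltP => t0; first by rewrite measure0 -/(F t) F0.
have F1' : fine (F t) <= 1 by rewrite -lee_fin fineK// probability_le1.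
have F0' : 0 <= fine (F t) by rewrite -lee_fin fineK.
rewrite uniform_probE; last by apply: measurableU => //; exact: measurableC.
rewrite setIUl setICl set0U setIidl; last first.
  by apply: subset_itvl; rewrite bnd_simp.
rewrite lebesgue_measure_itv/= lte_fin -/(F t).
case: ltP => [_|F0'']; first by rewrite oppr0 adde0 fineK.
by apply/esym; rewrite -[LHS]fineK//; congr EFin; apply/le_anti; rewrite F0' F0''.
Qed.

End Quantile.

Section Density.
Context d (T : measurableType d) (R : realType).
Variables (mu nu : {measure set T -> \bar R}) (g : T -> R).
Hypotheses (mg : measurable_fun setT g) (g0 : forall x, 0 <= g x).
Hypothesis nuE : forall A, measurable A -> nu A = (\int[mu]_(x in A) (g x)%:E)%E.
Local Open Scope ereal_scope.
Import HBNNSimple.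

Let EFin_measurable D : measurable_fun D (fun x => (g x)%:E).
Proof. by apply: measurable_funTS; apply/measurable_EFinP. Qed.

Let density_nnsfun (f : {nnsfun T >-> R}) :
  \int[nu]_x (f x)%:E = \int[mu]_x ((f x)%:E * (g x)%:E).
Proof.
under [LHS]eq_integral do rewrite fimfunE -fsumEFin//.
rewrite [LHS]ge0_integral_fsum//; last 2 first.
  - by move=> r; exact/measurable_EFinP/measurableT_comp.
  - by move=> n x _; rewrite EFinM nnfun_muleindic_ge0.
under [RHS]eq_integral.
  move=> x _; rewrite fimfunE -fsumEFin// ge0_mule_fsuml; last first.
    by move=> r; rewrite EFinM nnfun_muleindic_ge0.
  over.
rewrite [RHS]ge0_integral_fsum//; last 2 first.
  - move=> r; apply: emeasurable_funM => //.
    exact/measurable_EFinP/measurableT_comp.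
  - by move=> r x _; rewrite mule_ge0 ?lee_fin// -lee_fin EFinM nnfun_muleindic_ge0.
apply: eq_fsbigr => r rf.
have mfr : measurable (f @^-1` [set r]) by [].
rewrite integralZl_indic_nnsfun//= integral_indic// setIT [in LHS]nuE//.
under [RHS]eq_integral do rewrite EFinM -muleA.
rewrite ge0_integralZl//; last 3 first.
- by apply: emeasurable_funM => //; exact/measurable_EFinP.
- by move=> x _; rewrite mule_ge0 ?lee_fin.
- have := set_mem rf; move=> /= [x _ <-]; by rewrite lee_fin.
congr (_ * _); rewrite integral_mkcond; apply: eq_integral => x _.
by rewrite patchE indicE; case: ifPn => _; rewrite ?mul1e ?mul0e.
Qed.

Lemma ge0_integral_density (f : T -> \bar R) :
  measurable_fun setT f -> (forall x, 0 <= f x) ->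
  \int[nu]_x f x = \int[mu]_x (f x * (g x)%:E).
Proof.
move=> mf f0.
pose f_ := nnsfun_approx measurableT mf.
have f_f x : (f_ n x)%:E @[n --> \oo] --> f x by exact: cvg_nnsfun_approx.
transitivity (lim (\int[nu]_x (f_ n x)%:E @[n --> \oo])).
  rewrite -monotone_convergence//=.
  - by apply: eq_integral => x _; apply/esym/cvg_lim.
  - by move=> n; exact/measurable_EFinP/measurable_funTS.
  - by move=> n x _; rewrite lee_fin.
  - by move=> x _ a b ab; rewrite lee_fin; exact/lefP/nd_nnsfun_approx.
transitivity (lim (\int[mu]_x ((f_ n x)%:E * (g x)%:E) @[n --> \oo])).
  by apply: congr_lim; apply/funext => n; exact: density_nnsfun.
rewrite -monotone_convergence//=.
- apply: eq_integral => x _; apply/cvg_lim => //.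
  by apply: cvgeZr => //; exact: f_f.
- move=> n; apply: emeasurable_funM => //.
  exact/measurable_EFinP/measurable_funTS.
- by move=> n x _; rewrite mule_ge0 ?lee_fin.
- move=> x _ a b ab; rewrite lee_wpmul2r ?lee_fin//.
  exact/lefP/nd_nnsfun_approx.
Qed.

End Density.

Section BetaLaw.
Context {R : realType}.
Implicit Types a b : R.
Local Notation leb := (@lebesgue_measure R).
Local Notation U := (uniform_prob (@ltr01 R)).

Definition beta_density a b (t : R) : R :=
  if 0 <= t <= 1 then real_beta_weight a b t / real_beta_fun a b else 0.

Definition beta_law a b (A : set R) : \bar R :=
  (\int[leb]_(t in A) (beta_density a b t)%:E)%E.

Lemma measurable_beta_density a b : measurable_fun setT (beta_density a b).
Proof.
apply: measurable_fun_if => //.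
- by apply: measurable_and => //; exact: measurable_fun_ler.
- apply: measurable_funTS; apply: measurable_funM => //.
  exact: measurable_real_beta_weight.
Qed.

Lemma beta_lawE a b (A : set R) : measurable A ->
  beta_law a b A = (\int[leb]_(t in A `&` `[0%R, 1%R])
    (real_beta_weight a b t / real_beta_fun a b)%:E)%E.
Proof.
move=> mA; rewrite /beta_law [RHS]integral_mkcondr; apply: eq_integral => t _.
rewrite patchE /beta_density; case: ifPn => [|/negP] t01.
  by case: ifPn => //; rewrite notin_setE/= in_itv/= t01.
by case: ifPn => //; rewrite inE/= in_itv/=.
Qed.

Variables (a b : R).
(** The positivity proofs are arguments so that the probability instance, which depends on them, can
    be attached, while [beta_law] stays a plain set function. *)
Definition beta_prob_law (a0 : 0 < a) (b0 : 0 < b) :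
  set (measurableTypeR R) -> \bar R := beta_law a b.
Hypotheses (a0 : 0 < a) (b0 : 0 < b).

Lemma beta_density_ge0 t : 0 <= beta_density a b t.
Proof.
rewrite /beta_density; case: ifP => // _.
by rewrite divr_ge0 ?real_beta_weight_ge0// ltW// real_beta_fun_gt0.
Qed.

Let law0 : beta_prob_law a0 b0 set0 = 0%E.
Proof. exact: integral_set0. Qed.

Let law_ge0 A : (0 <= beta_prob_law a0 b0 A)%E.
Proof. by apply: integral_ge0 => t _; rewrite lee_fin beta_density_ge0. Qed.

Let law_sigma_additive : semi_sigma_additive (beta_prob_law a0 b0).
Proof.
move=> /= A mA tA mUA; rewrite /beta_prob_law /beta_law; apply: cvg_toP.
  apply: ereal_nondecreasing_is_cvgn => m n mn.
  by apply: lee_sum_nneg_natr => // k _ _; exact: law_ge0.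
rewrite ge0_integral_bigcup//=.
- apply: measurable_funTS; apply/measurable_EFinP.
  exact: measurable_beta_density.
- by move=> x _; rewrite lee_fin beta_density_ge0.
Qed.

HB.instance Definition _ := isMeasure.Build _ _ _ (beta_prob_law a0 b0)
  law0 law_ge0 law_sigma_additive.

Let scaled_weight x y : 0 < x -> 0 < y ->
  (\int[leb]_(t in `[0%R, 1%R]) (real_beta_weight x y t / real_beta_fun a b)%:E =
  (real_beta_fun x y / real_beta_fun a b)%:E)%E.
Proof.
move=> x0 y0.
under eq_integral do rewrite EFinM.
rewrite ge0_integralZr//.
- by rewrite EFinM EFin_real_beta_fun.
- exact: measurable_EFin_real_beta_weight.
- by move=> t _; rewrite lee_fin real_beta_weight_ge0.
- by rewrite lee_fin invr_ge0 ltW// real_beta_fun_gt0.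
Qed.

Let law01 : beta_prob_law a0 b0 `[0, 1]%classic = 1%E.
Proof.
rewrite /beta_prob_law beta_lawE// setIid scaled_weight// divff//.
by rewrite gt_eqF// real_beta_fun_gt0.
Qed.

Let law_setT : beta_prob_law a0 b0 setT = 1%E.
Proof. by rewrite -law01 /beta_prob_law !beta_lawE// setTI setIid. Qed.

HB.instance Definition _ := @Measure_isProbability.Build _ _ R
  (beta_prob_law a0 b0) law_setT.

Lemma measurable_beta_quantile : measurable_fun setT (quantile (beta_law a b)).
Proof.
have H := @measurable_quantile _ (beta_prob_law a0 b0) law01.
exact: H.
Qed.

Lemma beta_quantile_uniform A : measurable A ->
  U (quantile (beta_law a b) @^-1` A) = beta_law a b A.
Proof.
have H := @quantile_uniform _ (beta_prob_law a0 b0) law01 A.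
exact H.
Qed.

Lemma real_beta_weight_moment (x y : nat) t : 0 <= t <= 1 ->
  real_beta_weight (a + x%:R) (b + y%:R) t =
  t ^+ x * (1 - t) ^+ y * real_beta_weight a b t.
Proof.
move=> /andP[t0 t1]; elim: x => [|x IH].
  rewrite addr0 expr0 mul1r; elim: y => [|y IH].
    by rewrite addr0 mul1r.
  rewrite -natr1 addrA real_beta_weightDr ?IH// ?ltr_wpDr//.
  by rewrite exprS mulrA.
rewrite -natr1 addrA real_beta_weightDl ?IH// ?ltr_wpDr//.
by rewrite exprS !mulrA.
Qed.

Lemma beta_quantile_moment (x y : nat) :
  (\int[U]_u (quantile (beta_law a b) u ^+ x *
     (1 - quantile (beta_law a b) u) ^+ y)%:E)%E =
  (real_beta_fun (a + x%:R) (b + y%:R) / real_beta_fun a b)%:E.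
Proof.
pose q := quantile (beta_law a b).
(* The absolute value makes [f] nonnegative on the whole line, as the change of variables for
   nonnegative functions asks; on the unit interval it changes nothing. *)
pose f (t : R) : R := `|t ^+ x * (1 - t) ^+ y|.
have mf : measurable_fun setT f.
  apply: measurableT_comp => //; apply: measurable_funM; apply: measurable_funX => //.
  exact: measurable_funB.
transitivity (\int[U]_u ((EFin \o f) \o (q : measurableTypeR R -> measurableTypeR R)) u)%E.
  apply: eq_integral => u _ /=; rewrite /f ger0_norm// mulr_ge0 ?exprn_ge0//.
    exact: quantile_ge0.
  by rewrite subr_ge0 quantile_le1.
have mq : measurable_fun setT (q : measurableTypeR R -> measurableTypeR R).
  exact: measurable_beta_quantile.
have mEf : measurable_fun setT (EFin \o f : measurableTypeR R -> \bar R).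
  by apply/measurable_EFinP.
rewrite -(@ge0_integral_pushforward _ _ _ _ _ _ mq U setT (EFin \o f))//=; last first.
  by move=> t _; rewrite lee_fin /f normr_ge0.
rewrite (@eq_measure_integral _ _ _ setT (beta_prob_law a0 b0)); last first.
  by move=> A mA _; exact: beta_quantile_uniform.
rewrite (@ge0_integral_density _ _ _ leb (beta_prob_law a0 b0) (beta_density a b))//; last first.
- by move=> t; rewrite lee_fin /f normr_ge0.
- exact: beta_density_ge0.
- exact: measurable_beta_density.
rewrite -scaled_weight; last 2 first.
- by rewrite ltr_wpDr.
- by rewrite ltr_wpDr.
rewrite [RHS]integral_mkcond; apply: eq_integral => t _.
rewrite patchE -EFinM /beta_density.
have [t01|t01] := boolP (0 <= t <= 1).
  rewrite mem_set/= ?in_itv//= real_beta_weight_moment// mulrA; congr (_ * _ * _)%:E.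
  have /andP[t0 t1] := t01.
  by rewrite /f ger0_norm// mulr_ge0 ?exprn_ge0// subr_ge0.
by rewrite memNset/= ?mulr0// in_itv/=; exact/negP.
Qed.

End BetaLaw.

(** * Law of large numbers and vanishing products *)

Section LawOfLargeNumbers.
Context {R : realType}.
Local Notation U := (uniform_prob (@ltr01 R)).
Variables (u : nat -> R -> R) (theta : nat -> R).
Hypotheses (iid : iid_uniform u) (theta01 : forall n, 0 <= theta n <= 1).

(** From [1 - x <= expR (- x)], the exponential is at most [1 / (1 - x)], and [(1 + x + 2 x^2) (1 -
    x) = 1 + x^2 (1 - 2 x)] is at least 1. *)
Lemma expR_le_quad (x : R) : x <= 2^-1 -> expR x <= 1 + x + 2 * x ^+ 2.
Proof.
move=> x2.
have h : 1 - x <= (expR x)^-1 by rewrite -expRN -[leLHS]/(1 + - x) expR_ge1Dx.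
have p : 0 < 1 - x by lra.
have : expR x <= (1 - x)^-1 by rewrite -[expR x]invrK lef_pV2 ?posrE ?invr_gt0 ?expR_gt0.
move=> /le_trans; apply.
rewrite -[leLHS]mul1r ler_pdivrMr//.
have -> : (1 + x + 2 * x ^+ 2) * (1 - x) = 1 + x ^+ 2 * (1 - 2 * x) by ring.
by rewrite lerDl mulr_ge0 ?sqr_ge0//; lra.
Qed.

Let centered (m : nat) (x : R) : R := (x < theta m)%R%:R - theta m.

Let measurable_centered m : measurable_fun setT (centered m).
Proof.
apply: measurable_funB => //.
rewrite (_ : (fun x => _) = \1_(`]-oo, theta m[%classic : set R)).
  exact: measurable_indic.
by apply/funext => x; rewrite indicE mem_setE in_itv.
Qed.

Let indic_lt m : (\int[U]_x ((x < theta m)%R%:R)%:E = (theta m)%:E)%E.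
Proof.
have /andP[t0 t1] := theta01 m.
transitivity (\int[U]_x (\1_(`]-oo, theta m[%classic : set R) x)%:E)%E.
  by apply: eq_integral => x _; rewrite indicE mem_setE in_itv.
rewrite integral_indic// setIT [LHS]uniform_prob01//.
rewrite [LHS](_ : _ = U `[0, theta m[%classic); last first.
  congr (U _); apply/seteqP; split => x /=; rewrite !in_itv/=.
    by move=> [-> /andP[->]].
  by move=> /andP[-> xt]; rewrite xt (lt_le_trans xt).
rewrite [LHS]uniform_prob_sub//; last first.
  by apply: subset_itvl; rewrite bnd_simp.
rewrite lebesgue_measure_itv/= lte_fin.
by case: ltP => [_|h]; rewrite ?oppr0 ?adde0//; congr EFin; apply/le_anti; rewrite t0 h.
Qed.

(** In the quadratic bound the linear term integrates to 0, and the square of [centered] is at most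
    1. *)
Let centered_exp m h : `|h| <= 2^-1 ->
  (\int[U]_x (expR (h * centered m x))%:E <= (1 + 2 * h ^+ 2)%:E)%E.
Proof.
move=> h2; have /andP[t0 t1] := theta01 m.
have c1 x : `|centered m x| <= 1.
  by rewrite /centered ler_norml; case: (x < theta m) => /=; apply/andP; split; lra.
have quad_ge0 x : 0 <= 1 + h * centered m x + 2 * h ^+ 2.
  have : `|h * centered m x| <= 2^-1.
    by rewrite normrM (le_trans _ h2)// ler_piMr.
  by rewrite ler_norml => /andP[? _]; have := sqr_ge0 h; lra.
apply: (@le_trans _ _ (\int[U]_x (1 + h * centered m x + 2 * h ^+ 2)%:E)%E).
  apply: ge0_le_integral => //.
  - apply/measurable_EFinP; apply: measurableT_comp => //.
    by apply: measurable_funM => //; exact: measurable_centered.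
  - apply/measurable_EFinP; apply: measurable_funD => //; apply: measurable_funD => //.
    by apply: measurable_funM => //; exact: measurable_centered.
  - move=> x _; rewrite lee_fin.
    have hc : h * centered m x <= 2^-1.
      by rewrite (le_trans (ler_norm _))// normrM (le_trans _ h2)// ler_piMr.
    apply: le_trans (expR_le_quad hc) _.
    rewrite lerD2l exprMn ler_wpM2l// ler_piMr ?sqr_ge0//.
    by rewrite -(real_normK (num_real _)) expr_le1.
have UE c : (\int[U]_x c%:E = c%:E :> \bar R)%E.
  by rewrite integral_cst// [X in (_ * X)%E]probability_setT mule1.
have mi : measurable_fun setT (fun x : R => ((x < theta m)%R%:R : R)).
  have := measurable_funD (measurable_centered m) (measurable_cst (theta m)).
  apply: eq_measurable_fun => x _; by rewrite /centered/= subrK.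
pose c := 1 - h * theta m + 2 * h ^+ 2.
have E0 : (fun x => (1 + h * centered m x + 2 * h ^+ 2)%:E) =
    (fun x : R => c%:E + h%:E * ((x < theta m)%R%:R)%:E)%E.
  by apply/funext => x; rewrite -EFinM -EFinD /centered /c; congr EFin; ring.
have int1 : U.-integrable setT (fun x : R => ((x < theta m)%R%:R : R)%:E).
  apply/integrableP; split; first exact/measurable_EFinP.
  under eq_integral do rewrite gee0_abs ?lee_fin//.
  by rewrite indic_lt ltry.
have intc : U.-integrable setT (fun x : R => c%:E).
  apply/integrableP; split; first exact: measurable_cst.
  by under eq_integral do rewrite abse_EFin; rewrite UE ltry.
rewrite E0 integralD//; last exact: integrableZl.
rewrite UE integralZl// indic_lt -EFinM -EFinD lee_fin /c.
by rewrite le_eqVlt; apply/orP; left; apply/eqP; ring.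
Qed.

Let partial_sum (n : nat) (x : R) : R := \sum_(m < n) centered m (u m x).

Let measurable_partial_sum n : measurable_fun setT (partial_sum n).
Proof.
have [mu _ _] := iid; apply: measurable_sum => m.
by apply: measurableT_comp; [exact: measurable_centered|exact: mu].
Qed.

Let tail_set (b : bool) (e : R) (n : nat) : set R :=
  [set x | n%:R * e <= (-1) ^+ b * partial_sum n x].

Let measurable_tail_set b e n : measurable (tail_set b e n).
Proof.
rewrite (_ : tail_set b e n =
    (fun x => (-1) ^+ b * partial_sum n x) @^-1` `[n%:R * e, +oo[%classic); last first.
  by apply/seteqP; split => x; rewrite /tail_set/= in_itv/= andbT.
have : measurable_fun setT (fun x => (-1) ^+ b * partial_sum n x).
  by apply: measurable_funM => //; exact: measurable_partial_sum.
by move=> /(_ measurableT) mf; rewrite -[X in measurable X]setTI; exact: mf.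
Qed.

(** Chernoff's bound with [h] equal to [e / 4] up to the sign that selects the tail: each factor
    contributes the exponent [2 h^2 - e^2 / 4 = - e^2 / 8]. The condition [e <= 1] keeps [h] in the
    range of [centered_exp]. *)
Let tail_bound b e n : 0 < e -> e <= 1 ->
  (U (tail_set b e n) <= (expR (- (e ^+ 2 / 8)) ^+ n)%:E)%E.
Proof.
move=> e0 e1; have [mu _ uprod] := iid.
pose h := (-1) ^+ b * (e / 4).
have h2 : `|h| <= 2^-1.
  by rewrite normrM normrX normrN1 expr1n mul1r ger0_norm; lra.
have hh : h ^+ 2 = (e / 4) ^+ 2 by rewrite exprMn -exprM mulnC exprM sqrrN expr1n expr1n mul1r.
pose f m x := expR (h * centered m x).
have mf m : measurable_fun setT (f m).
  by apply: measurableT_comp => //; exact: measurable_funM.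
have f0 m x : 0 <= f m x by exact: expR_ge0.
have step m : (\int[U]_x (f m x)%:E <= (expR (2 * h ^+ 2))%:E)%E.
  by apply: le_trans (centered_exp m h2) _; rewrite lee_fin expR_ge1Dx.
have mP : measurable_fun setT (fun x => \prod_(m < n) f m (u m x)).
  by apply: measurable_prod => m _; apply: measurableT_comp; [exact: mf|exact: mu].
have P0 x : 0 <= \prod_(m < n) f m (u m x) by exact: prodr_ge0.
have bound : (\int[U]_x (\prod_(m < n) f m (u m x))%:E <=
    (expR (2 * h ^+ 2) ^+ n)%:E)%E.
  rewrite uprod//; elim: n {mP P0} => [|n IH].
    by rewrite big_ord0 expr0.
  rewrite big_ord_recr /= exprSr EFinM; apply: lee_pmul => //.
    by apply: prode_ge0 => m _; apply: integral_ge0 => x _; rewrite lee_fin.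
  by apply: integral_ge0 => x _; rewrite lee_fin.
have : ((expR (e / 4 * (n%:R * e)))%:E * U (tail_set b e n) <=
    \int[U]_x (\prod_(m < n) f m (u m x))%:E)%E.
  rewrite -[U _]mul1e -[1%E]/(1%:E) -integral_cst; last exact: measurable_tail_set.
  rewrite -ge0_integralZl//; last exact: measurable_tail_set.
  apply: (@le_trans _ _ (\int[U]_(x in tail_set b e n) (\prod_(m < n) f m (u m x))%:E)%E).
    apply: ge0_le_integral => //.
    - exact: measurable_tail_set.
    - by move=> x _; rewrite /cst mule1 lee_fin expR_ge0.
    - by apply: measurable_funTS; apply/measurable_EFinP.
    - move=> x xt; rewrite /cst mule1 lee_fin -expR_sum ler_expR.
      rewrite -mulr_sumr (_ : h * _ = e / 4 * ((-1) ^+ b * partial_sum n x)); last first.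
        by rewrite /h mulrAC mulrC.
      by rewrite ler_wpM2l// divr_ge0// ltW.
  apply: ge0_subset_integral => //.
  - exact: measurable_tail_set.
  - exact/measurable_EFinP.
  - by move=> x _; rewrite lee_fin.
move=> /le_trans /(_ bound).
rewrite -lee_pdivlMl ?expR_gt0// -EFinM => /le_trans; apply.
rewrite lee_fin -expRN -!expRM_natl -expRD ler_expR hh.
by rewrite le_eqVlt; apply/orP; left; apply/eqP; field.
Qed.

Let tail_limsup b e : 0 < e -> e <= 1 -> U (lim_sup_set (tail_set b e)) = 0%E.
Proof.
move=> e0 e1; apply: lim_sup_set_cvg0; first by move=> k; exact: measurable_tail_set.
pose r := expR (- (e ^+ 2 / 8)).
have r1 : `|r| < 1.
  rewrite ger0_norm ?expR_ge0// -expR0 ltr_expR oppr_lt0.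
  by rewrite divr_gt0// exprn_gt0.
apply: (@le_lt_trans _ _ ((1 - r)^-1)%:E); last by rewrite ltry.
apply: lime_le; first by apply: is_cvg_nneseries => n _ _; exact: measure_ge0.
apply: nearW => n.
apply: (@le_trans _ _ (\sum_(0 <= k < n) (geometric 1 r k)%:E)%E).
  by apply: lee_sum => k _; rewrite /geometric/= mul1r; exact: tail_bound.
by rewrite sumEFin lee_fin -[leRHS]mul1r; apply: geometric_le_lim; rewrite ?expR_gt0.
Qed.

(** The thresholds vary with [m], so the indicators are independent but not identically distributed.
    The tails are geometrically small, so Borel-Cantelli applies; the null set collects both tails
    at the levels [1 / (k + 1)]. *)
Lemma uniform_slln : exists N : set R, [/\ measurable N, U N = 0%E &
  forall x, ~ N x ->
    n%:R^-1 * (\sum_(m < n) ((u m x < theta m)%R%:R - theta m)) @[n --> \oo] --> (0 : R)].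
Proof.
pose N (k : nat) : set R := lim_sup_set (tail_set false k.+1%:R^-1) `|`
  lim_sup_set (tail_set true k.+1%:R^-1).
have mL b e : measurable (lim_sup_set (tail_set b e)).
  apply: bigcap_measurable => // n _; apply: bigcup_measurable => m _.
  exact: measurable_tail_set.
have mN k : measurable (N k) by exact: measurableU.
have N0 b k : U (lim_sup_set (tail_set b k.+1%:R^-1)) = 0%E.
  apply: tail_limsup; first by rewrite invr_gt0 ltr0n.
  by rewrite invf_le1 ?ltr0n// ler1n.
exists (\bigcup_k N k); split.
- exact: bigcupT_measurable.
- apply/eqP; rewrite eq_le measure_ge0 andbT.
  apply: (le_trans (measure_sigma_subadditive _ _ _ (@subset_refl _ _))) => //.
    exact: bigcupT_measurable.
  rewrite eseries0// => k _ _; apply/eqP; rewrite eq_le measure_ge0 andbT.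
  rewrite /N; apply: le_trans; first by apply: measureU2; exact: mL.
  by rewrite [X in (X + _)%E]N0 [X in (_ + X)%E]N0 adde0.
move=> x Nx; apply/cvgr0Pnorm_lt => e e0.
have [k ke] : exists k : nat, k.+1%:R^-1 < e.
  exists (Num.trunc e^-1); rewrite -[ltRHS]invrK ltf_pV2 ?posrE ?invr_gt0//.
  exact: truncnS_gt.
have ev (b : bool) : \forall n \near \oo, (-1) ^+ b * partial_sum n x < n%:R * k.+1%:R^-1.
  have : ~ lim_sup_set (tail_set b k.+1%:R^-1) x.
    by move=> Nkb; apply: Nx; exists k => //; case: b Nkb => ?; [right|left].
  move=> /existsNP[n /not_implyP[_ nx]]; exists n => // m /= nm; rewrite ltNge.
  by apply/negP => mx; apply: nx; exists m.
near=> n.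
have n0 : 0 < n%:R :> R by rewrite ltr0n; near: n; exact: nbhs_infty_gt.
rewrite normrM ger0_norm ?invr_ge0// mulrC ltr_pdivrMr//.
rewrite (le_lt_trans (_ : _ <= n%:R * k.+1%:R^-1))//; last first.
  by rewrite mulrC ltr_pM2r.
rewrite -/(partial_sum n x) ler_norml; apply/andP; split.
  rewrite lerNl -mulN1r ltW//; near: n; exact: (ev true).
rewrite ltW// -[ltLHS]mul1r; near: n; exact: (ev false).
Unshelve. all: by end_near. Qed.

End LawOfLargeNumbers.

(** * Almost sure vanishing of products of independent factors *)

Section VanishingProduct.
Context {R : realType}.
Local Notation U := (uniform_prob (@ltr01 R)).
Variables (u : nat -> R -> R).
Hypothesis iid : iid_uniform u.

(** The partial products decrease to a nonnegative limit whose mean is at most every product of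
    means, hence 0; such a limit vanishes almost everywhere. *)
Lemma ae_prod_cvg0 (F : nat -> R -> R) (j0 : nat) :
  (forall j, measurable_fun setT (F j)) -> (forall j x, 0 <= F j x <= 1) ->
  ((\prod_(j0 <= j < n) \int[U]_x (F j x)%:E)%E @[n --> \oo] --> 0%E) ->
  exists N : set R, [/\ measurable N, U N = 0%E &
    forall x, ~ N x -> \prod_(j0 <= j < n) F j (u j x) @[n --> \oo] --> (0 : R)].
Proof.
move=> mF F01 cv0; have [mu _ uprod] := iid.
pose p n x := \prod_(j0 <= j < n) F j (u j x).
have mp n : measurable_fun setT (p n).
  by apply: measurable_prod => j _; apply: measurableT_comp; [exact: mF|exact: mu].
have F0 j x : 0 <= F j x by have /andP[] := F01 j x.
have p0 n x : 0 <= p n x by exact: prodr_ge0.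
have pS n x : p n.+1 x <= p n x.
  rewrite /p; have [jn|nj] := leqP j0 n; last by rewrite !big_geq// ltnW.
  rewrite big_nat_recr//= ler_piMr//; first exact: prodr_ge0.
  by have /andP[] := F01 n (u n x).
have pd x : nonincreasing_seq (p ^~ x) by apply/nonincreasing_seqP => n; exact: pS.
have pcv x : cvgn (p ^~ x).
  apply: nonincreasing_is_cvgn; first exact: pd.
  by exists 0 => _ [n _ <-]; exact: p0.
pose l x := limn (p ^~ x).
have ml : measurable_fun setT l by apply: (measurable_fun_cvg mp) => x _; exact: pcv.
have l0 x : 0 <= l x by apply: limr_ge; [exact: pcv|exact: nearW].
have intp n : (\int[U]_x (p n x)%:E = \prod_(j0 <= j < n) \int[U]_x (F j x)%:E)%E.
  (* Factors 1 below [j0], since the product formula of [iid] starts at index 0. *)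
  pose G j := if (j0 <= j)%N then F j else cst 1.
  have -> : (fun x => (p n x)%:E) = (fun x => (\prod_(j < n) G j (u j x))%:E).
    apply/funext => x; congr EFin; rewrite /p (big_nat_widenl _ 0)// big_mkcond big_mkord.
    by apply: eq_bigr => j _; rewrite /G /=; case: ifP.
  rewrite uprod.
  - rewrite [RHS](big_nat_widenl _ 0)// [RHS]big_mkcond [RHS]big_mkord.
    apply: eq_bigr => j _; rewrite /G; case: ifP => // _.
    by rewrite [LHS](integral_cst U measurableT 1%:E) [X in (_ * X)%E]probability_setT mule1.
  - by move=> j; rewrite /G; case: ifP => // _; exact: measurable_cst.
  - by move=> j x; rewrite /G; case: ifP => // _; rewrite ler01.
have intl : (\int[U]_x (l x)%:E = 0)%E.
  apply/eqP; rewrite eq_le integral_ge0 ?andbT; last by move=> x _; rewrite lee_fin.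
  rewrite -(cvg_lim _ cv0)//; apply: lime_ge; first by apply/cvg_ex; eexists; exact: cv0.
  apply: nearW => n; rewrite -intp; apply: ge0_le_integral => //.
  - by move=> x _; rewrite lee_fin.
  - exact/measurable_EFinP.
  - by apply/measurable_EFinP; exact: mp.
  - move=> x _; rewrite lee_fin; apply: nonincreasing_cvgn_ge; [exact: pd|exact: pcv].
exists [set x | l x != 0]; split.
- rewrite (_ : [set x | _] = ~` (l @^-1` [set 0])).
    by apply: measurableC; rewrite -[X in measurable X]setTI; exact: ml.
  by apply/seteqP; split => x /=; [move/eqP|move/eqP].
- have := @ae_eq_integral_abs _ _ _ U setT measurableT (fun x => (l x)%:E).
  move=> [|]; first exact/measurable_EFinP.
  move=> /(_ _)[]; first by under eq_integral do rewrite gee0_abs ?lee_fin//.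
  move=> M [mM M0 sM] _.
  apply/eqP; rewrite eq_le measure_ge0 andbT -M0 le_measure ?inE//.
    rewrite (_ : [set x | _] = ~` (l @^-1` [set 0])).
      by apply: measurableC; rewrite -[X in measurable X]setTI; exact: ml.
    by apply/seteqP; split => x /=; [move/eqP|move/eqP].
  move=> x /= lx; apply: sM => /= /(_ I) [lx0].
  by rewrite lx0 eqxx in lx.
- move=> x /= /negP; rewrite negbK => /eqP lx0.
  have : p n x @[n --> \oo] --> l x by exact: pcv.
  by rewrite lx0.
Qed.

End VanishingProduct.

Section VanishingRatios.
Context {R : realType}.
Variables (alpha : R) (a : nat -> nat).
Hypotheses (alpha1 : alpha < 1) (a_inc : forall j, (a j < a j.+1)%N).

(** The mean of [1 - xi_j]: if class [j] opens at position [a j], counted from 0, its record index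
    is [a j + 1], the second Beta parameter is [b = a j - j alpha], and the mean is
    [b / (1 - alpha + b)]. *)
Let ratio (j : nat) : R := ((a j)%:R - j%:R * alpha) / ((a j)%:R + 1 - (j.+1)%:R * alpha).

Let a_ge j : (j <= a j)%N.
Proof. by elim: j => // j IH; exact: leq_ltn_trans (a_inc j). Qed.

Let num_ge0 j : 0 <= (a j)%:R - j%:R * alpha.
Proof.
rewrite subr_ge0; have ja : j%:R <= (a j)%:R :> R by rewrite ler_nat.
have [a0|a0] := leP 0 alpha; last first.
  by rewrite (@le_trans _ _ 0)// nmulr_lle0.
by rewrite (le_trans _ ja)// ler_piMr// ltW.
Qed.

Let denE j : (a j)%:R + 1 - (j.+1)%:R * alpha = ((a j)%:R - j%:R * alpha) + (1 - alpha).
Proof. by rewrite -(natr1 j); ring. Qed.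

Let den_gt j : (a j)%:R - j%:R * alpha < (a j)%:R + 1 - (j.+1)%:R * alpha.
Proof. by rewrite denE ltrDl subr_gt0. Qed.

Let den_gt0 j : 0 < (a j)%:R + 1 - (j.+1)%:R * alpha.
Proof. exact: le_lt_trans (den_gt j). Qed.

Let ratio_ge0 j : 0 <= ratio j.
Proof. by rewrite divr_ge0// ltW. Qed.

Let ratio_le1 j : ratio j <= 1.
Proof. by rewrite ler_pdivrMr// mul1r ltW. Qed.

(** For [j <= a j < n] one has [a j - j alpha <= n (1 + |alpha|)], so this times [c / n] is at most
    [1 - alpha], the gap between the numerator and the denominator of [ratio]. *)
Let c : R := (1 - alpha) / (1 + `|alpha|).

Let c_gt0 : 0 < c. Proof. by rewrite divr_gt0 ?subr_gt0// ltr_pwDl. Qed.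

Let ratio_le n j : (a j < n)%N -> ratio j <= (1 + c / n%:R)^-1.
Proof.
move=> an; have n0 : 0 < n%:R :> R by rewrite ltr0n; lia.
have cn0 : 0 <= c / n%:R by rewrite divr_ge0// ltW.
rewrite -[leRHS]mul1r ler_pdivlMr ?ltr_wpDr// mulrAC ler_pdivrMr// mul1r.
rewrite mulrDr mulr1.
suff : ((a j)%:R - j%:R * alpha) * (c / n%:R) <= 1 - alpha.
  by rewrite denE lerD2l.
rewrite mulrA ler_pdivrMr// /c mulrA ler_pdivrMr ?ltr_pwDl// mulrC -mulrA.
rewrite ler_wpM2l ?subr_ge0 ?(ltW alpha1)//.
have an' : (a j)%:R <= n%:R :> R by rewrite ler_nat ltnW.
have jn : j%:R <= n%:R :> R by rewrite ler_nat (leq_trans (a_ge j))// ltnW.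
rewrite mulrDr mulr1 lerD// -mulrN (le_trans (ler_norm _))//.
by rewrite normrM normrN normr_nat ler_wpM2r.
Qed.

(* If a positive fraction of the integers up to [n] are records for infinitely many [n],
   the factors over a block of records are at most [1 / (1 + c / n)], with order [n] of them. *)
Lemma prod_ratio_cvg0 (K : nat -> nat) (e : R) (j0 : nat) : 0 < e ->
  (forall n j, (j < K n)%N -> (a j < n)%N) ->
  (forall n0, exists n, (n0 <= n)%N /\ e * n%:R <= (K n)%:R) ->
  \prod_(j0 <= j < n) ratio j @[n --> \oo] --> (0 : R).
Proof.
move=> e0 Ka Ke.
pose p n := \prod_(j0 <= j < n) ratio j.
have p0 n : 0 <= p n by exact: prodr_ge0.
have pS n : p n.+1 <= p n.
  rewrite /p; have [jn|nj] := leqP j0 n; last by rewrite !big_geq// ltnW.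
  by rewrite big_nat_recr//= ler_piMr//; exact: p0.
have pd : nonincreasing_seq p by apply/nonincreasing_seqP => n; exact: pS.
have pcv : cvgn p.
  apply: nonincreasing_is_cvgn; first exact: pd.
  by exists 0 => _ [n _ <-]; exact: p0.
(* Choose [n] with [M0 <= e n / 2] and at least [e n] records: the block from [M0] to [K n] has at
   least [e n / 2] factors, each at most [1 / (1 + c / n)]. Bernoulli's inequality bounds their
   product by [rho], so the limit [L] satisfies [L <= rho L]. *)
pose rho := (1 + e / 2 * c)^-1.
have ec0 : 0 < e / 2 * c by rewrite mulr_gt0// divr_gt0.
have block M0 : (j0 <= M0)%N -> exists2 M1, (M0 <= M1)%N & p M1 <= rho * p M0.
  move=> jM.
  have [n [n0 nK]] := Ke (Num.trunc (M0%:R * 2 / e)).+1.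
  have np : 0 < n%:R :> R by rewrite ltr0n; lia.
  have M0n : M0%:R <= e / 2 * n%:R.
    have : M0%:R * 2 / e <= n%:R.
      by rewrite ltW// (lt_le_trans (truncnS_gt _))// ler_nat.
    by rewrite ler_pdivrMr//; lra.
  have en : 0 < e * n%:R by rewrite mulr_gt0.
  have KM : (M0 <= K n)%N by rewrite -(ler_nat R); lra.
  exists (K n) => //.
  rewrite /p (big_cat_nat jM KM)/= mulrC ler_wpM2r//; first exact: p0.
  apply: (@le_trans _ _ (\prod_(M0 <= j < K n) (1 + c / n%:R)^-1)).
    rewrite big_nat [leRHS]big_nat; apply: ler_prod => j /andP[_ jK].
    by rewrite ratio_ge0 ratio_le//; exact: Ka.
  have cn0 : 0 < c / n%:R by rewrite divr_gt0.
  rewrite prodr_const_nat exprVn lef_pV2 ?posrE ?exprn_gt0 ?addr_gt0//.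
  apply: (@le_trans _ _ (1 + (K n - M0)%:R * (c / n%:R))).
    rewrite lerD2l (_ : e / 2 * c = e / 2 * n%:R * (c / n%:R)); last first.
      by field; rewrite gt_eqF.
    by rewrite ler_wpM2r ?(ltW cn0)// natrB//; lra.
  rewrite mulr_natl; elim: (K n - M0)%N => [|k IH]; first by rewrite mulr0n addr0 expr0.
  rewrite exprS mulrSr addrA.
  apply: (@le_trans _ _ ((1 + c / n%:R) * (1 + (c / n%:R) *+ k))).
    have : 0 <= c / n%:R *+ k by rewrite mulrn_wge0// (ltW cn0).
    move: (c / n%:R *+ k) => y y0.
    rewrite (_ : (1 + c / n%:R) * (1 + y) = 1 + y + c / n%:R + c / n%:R * y); last by ring.
    by rewrite lerDl mulr_ge0// (ltW cn0).
  by rewrite ler_wpM2l// addr_ge0// (ltW cn0).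
have L0 : 0 <= limn p by apply: limr_ge; [exact: pcv|exact: nearW].
have Lp n : limn p <= p n by apply: nonincreasing_cvgn_ge; [exact: pd|exact: pcv].
have rho1 : rho < 1 by rewrite invf_lt1; lra.
have rho0 : 0 < rho by rewrite invr_gt0; lra.
have LL : limn p <= rho * limn p.
  rewrite -ler_pdivrMl//; apply: limr_ge => //; near=> n.
  have jn : (j0 <= n)%N by near: n; exact: nbhs_infty_ge.
  have [M _ pM] := block n jn.
  by rewrite ler_pdivrMl// (le_trans _ pM).
have -> : 0 = limn p; last exact: pcv.
apply/le_anti; rewrite L0/= -(pmulr_rle0 (limn p) (_ : 0 < 1 - rho)) ?subr_gt0//.
by rewrite mulrBl mul1r subr_le0.
Unshelve. all: by end_near. Qed.

End VanishingRatios.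

(** * Class labels and the Gibbs prediction rule *)

Section Labels.
Implicit Types (c s : nat -> nat) (n m j k x : nat).

Lemma mem_interval_fset n x : (x \in interval_fset n) = (0 < x <= n)%N.
Proof. by rewrite seq_fsetE mem_iota add1n ltnS. Qed.

Definition add_element x j (p : seq {fset nat}) : seq {fset nat} :=
  if j == size p then open_class x p else join_class x j p.

Lemma set_nth_cat (T : Type) (x0 : T) (s1 s2 : seq T) a b :
  set_nth x0 (s1 ++ a :: s2) (size s1) b = s1 ++ b :: s2.
Proof. by elim: s1 => //= y s1 ->. Qed.

(** Only the class of [n.+1] changes under restriction. If it keeps another element it stays in
    place; if it was a singleton it disappears, and the age order forces it to have been the last
    class. *)
Lemma ordered_partitionS n p : ordered_partition n.+1 p ->
  let c := find (fun B : {fset nat} => n.+1 \in B) p in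
  (c <= size (restrict_partition n p))%N /\
  p = add_element n.+1 c (restrict_partition n p).
Proof.
move=> [p0 pcover pdisj pord] c.
have hasx : has (fun B : {fset nat} => n.+1 \in B) p.
  by rewrite -pcover mem_interval_fset ltn0Sn leqnn.
have csz : (c < size p)%N by rewrite -has_find.
have sub D y : D \in p -> y \in D -> (0 < y <= n.+1)%N.
  by move=> Dp yD; rewrite -mem_interval_fset pcover; apply/hasP; exists D.
set B := nth fset0 p c; have xB : n.+1 \in B := nth_find fset0 hasx.
have pE : p = take c p ++ B :: drop c.+1 p by rewrite -drop_nth// cat_take_drop.
have cE : size (take c p) = c by rewrite size_takel// ltnW.
set p1 := take c p in pE cE; set p2 := drop c.+1 p in pE.
have xp1 D : D \in p1 -> n.+1 \notin D.
  move=> Dp1; apply/negP => xD.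
  have /(before_find fset0) : (index D p1 < c)%N by rewrite -cE index_mem.
  have -> : nth fset0 p (index D p1) = D by rewrite pE nth_cat index_mem Dp1 nth_index.
  by rewrite xD.
have xp2 D : D \in p2 -> n.+1 \notin D.
  move=> Dp2; move: pdisj; rewrite pE pairwise_cat/= => /and3P[_ _ /andP[/allP BD _]].
  by have := BD _ Dp2 => /fdisjointP/(_ _ xB).
have keep D : D \in p -> n.+1 \notin D ->
    (D `&` interval_fset n)%fset = D /\ D != fset0.
  move=> Dp xD; split; last by apply: contraNneq p0 => <-.
  apply/fsetP => y; rewrite inE mem_interval_fset.
  case yD: (y \in D) => //=; have /andP[-> yn] := sub _ _ Dp yD.
  move: yn; rewrite leq_eqVlt ltnS => /orP[/eqP yx|->//].
  by rewrite yx in yD; rewrite yD in xD.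
have keeps q : {subset q <= p} -> (forall D, D \in q -> n.+1 \notin D) ->
    [seq C <- [seq (D `&` interval_fset n)%fset | D <- q] | C != fset0] = q.
  elim: q => //= D q IH qp xq.
  have [-> ->] := keep D (qp D (mem_head _ _)) (xq D (mem_head _ _)).
  by rewrite IH// => E Eq; [apply: qp|apply: xq]; rewrite in_cons Eq orbT.
have sub1 : {subset p1 <= p} by move=> D Dp1; rewrite pE mem_cat Dp1.
have sub2 : {subset p2 <= p} by move=> D Dp2; rewrite pE mem_cat in_cons Dp2 !orbT.
have resE : restrict_partition n p = p1 ++
    (if (B `&` interval_fset n)%fset != fset0
     then (B `&` interval_fset n)%fset :: p2 else p2).
  rewrite /restrict_partition [in LHS]pE map_cat filter_cat/= (keeps p1)// (keeps p2)//.
have Bp : B \in p by rewrite /B mem_nth.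
have BE : (n.+1 |` (B `&` interval_fset n))%fset = B.
  apply/fsetP => y; rewrite !inE mem_interval_fset.
  have [->|yx] /= := eqVneq y n.+1; first by rewrite xB.
  case yB: (y \in B) => //=; have /andP[-> /=] := sub _ _ Bp yB.
  by rewrite leq_eqVlt (negbTE yx) ltnS.
rewrite resE; case: ifPn => [B0|]; last first.
  rewrite negbK => /eqP B0; rewrite B0 fsetU0 in BE.
  (* A class after the singleton of [n.+1] would have all its elements above [n.+1], although they
     are at most [n.+1]. *)
  have p20 : p2 = [::].
    case p2E : p2 => [//|D q]; exfalso.
    have c1 : (c.+1 < size p)%N.
      by rewrite pE size_cat cE p2E/= addnS ltnS addnS ltnS leq_addr.
    have [y yB yD] := pord c c.+1 (introT andP (conj (ltnSn c) c1)).
    have Dp : nth fset0 p c.+1 \in p by rewrite mem_nth.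
    have /fset0Pn [z zD] : nth fset0 p c.+1 != fset0 by apply: contraNneq p0 => <-.
    have := yD _ zD; rewrite -/B -BE inE in yB; rewrite (eqP yB).
    by have /andP[_] := sub _ _ Dp zD; lia.
  rewrite p20 cats0 cE leqnn; split=> //.
  by rewrite /add_element cE eqxx /open_class BE -cats1 -p20.
split; first by rewrite size_cat cE leq_addr.
rewrite /add_element size_cat cE /= -{1}[c]addn0 eqn_add2l /= /join_class.
by rewrite nth_cat cE ltnn subnn/= BE -cE set_nth_cat.
Qed.

Fixpoint nclasses c n : nat :=
  if n is m.+1 then (nclasses c m + (c m == nclasses c m))%N else 0%N.

(* [c m] is the index, in order of age, of the class of the element [m.+1]. *)
Definition is_record c m : bool := c m == nclasses c m.

Lemma nclassesS c n : nclasses c n.+1 = (nclasses c n + is_record c n)%N.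
Proof. by []. Qed.

Definition class_size c j n : nat := (\sum_(m < n) (c m == j))%N.

(** These are the restricted growth sequences, the usual code of set partitions with classes in
    order of least elements. *)
Definition growing c n : Prop := forall m, (m < n)%N -> (c m <= nclasses c m)%N.

Fixpoint partition_of c n : seq {fset nat} :=
  if n is m.+1 then add_element m.+1 (c m) (partition_of c m) else [::].

Lemma growingW c n m : (m <= n)%N -> growing c n -> growing c m.
Proof. by move=> mn cn i im; apply: cn; exact: leq_trans mn. Qed.

Lemma size_partition_of c n : growing c n ->
  size (partition_of c n) = nclasses c n.
Proof.
elim: n => //= n IH cn; rewrite /add_element IH; last exact: growingW cn.
rewrite -/(is_record c n) /is_record; case: eqP => [_|/eqP ck].
  by rewrite size_rcons IH ?addn1//; exact: growingW cn.
rewrite /join_class size_set_nth IH; last exact: growingW cn.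
have := cn n (ltnSn n); rewrite leq_eqVlt (negbTE ck)/= addn0 => ck'.
exact/maxn_idPr.
Qed.

Lemma nth_partition_of c n j : growing c n ->
  nth fset0 (partition_of c n.+1) j =
  if j == c n then (n.+1 |` nth fset0 (partition_of c n) j)%fset
  else nth fset0 (partition_of c n) j.
Proof.
move=> cn /=; rewrite /add_element size_partition_of//.
case: eqP => [ck|ck].
  rewrite /open_class nth_rcons size_partition_of// -ck.
  have [->|jc] := eqVneq j (c n).
    rewrite ltnn [in RHS]nth_default ?fsetU0// size_partition_of//.
    by rewrite ck.
  case: ltnP => // cj; by rewrite nth_default// size_partition_of// -ck.
rewrite /join_class nth_set_nth/=.
by case: eqP => // ->.
Qed.

Lemma mem_partition_of c n j x : growing c n ->
  (x \in nth fset0 (partition_of c n) j) = (0 < x <= n)%N && (c x.-1 == j).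
Proof.
elim: n j => [j _|n IH j cn].
  by rewrite nth_nil inE; case: x.
have cn' : growing c n by exact: growingW cn.
rewrite nth_partition_of//.
have [->|jc] := eqVneq j (c n).
  rewrite !inE IH//; have [->|xn] := eqVneq x n.+1; first by rewrite ltnSn eqxx.
  by rewrite /= (leq_eqVlt x n.+1) (negbTE xn) ltnS.
rewrite IH//; have [->|xn] := eqVneq x n.+1.
  by rewrite ltnn /= eq_sym (negbTE jc) !andbF.
by rewrite (leq_eqVlt x n.+1) (negbTE xn) ltnS.
Qed.

Lemma card_partition_of c n j : growing c n ->
  #|` nth fset0 (partition_of c n) j| = class_size c j n.
Proof.
elim: n => [_|n IH cn]; first by rewrite nth_nil cardfs0 /class_size big_ord0.
have cn' : growing c n by exact: growingW cn.
rewrite nth_partition_of// /class_size big_ord_recr/= -/(class_size c j n) -IH//.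
rewrite eq_sym; case: eqP => _; last by rewrite addn0.
by rewrite cardfsU1 mem_partition_of// ltnn andbF/= addnC.
Qed.

Lemma partition_of_inj c s n : growing c n -> growing s n ->
  partition_of c n = partition_of s n -> forall m, (m < n)%N -> c m = s m.
Proof.
move=> cn sn E m mn.
have := mem_partition_of (c m) m.+1 cn.
by rewrite E mem_partition_of// mn /= eqxx => /eqP.
Qed.

Lemma eq_nclasses c s n : (forall m, (m < n)%N -> c m = s m) ->
  nclasses c n = nclasses s n.
Proof.
elim: n => //= n IH cs; rewrite cs// IH// => m mn; apply: cs; exact: ltnW.
Qed.

Lemma eq_partition_of c s n : (forall m, (m < n)%N -> c m = s m) ->
  partition_of c n = partition_of s n.
Proof.
elim: n => //= n IH cs; rewrite cs// IH// => m mn; apply: cs; exact: ltnW.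
Qed.

Definition label (T : Type) (Pi : nat -> T -> seq {fset nat}) (w : T) (m : nat) : nat :=
  find (fun B : {fset nat} => m.+1 \in B) (Pi m.+1 w).

(** Consistency preserves the label given to an element on its arrival. The conclusion holds at
    every [w], and so do the later statements about record indices. *)
Lemma partition_label d (T : measurableType d) (Pi : nat -> T -> seq {fset nat}) w n :
  random_partition Pi ->
  growing (label Pi w) n.+1 /\ Pi n.+1 w = partition_of (label Pi w) n.+1.
Proof.
move=> [ord res _]; elim: n => [|n [IHg IH]].
  have [] := ordered_partitionS (ord 1%N w isT); rewrite -/(label Pi w 0).
  (* [Pi 0] is unconstrained, so the base case restricts [Pi 1] to the empty interval by hand. *)
  have -> : restrict_partition 0 (Pi 1%N w) = [::].
    rewrite /restrict_partition; elim: (Pi 1%N w) => //= B p ->.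
    rewrite (_ : (B `&` interval_fset 0)%fset = fset0) ?eqxx//.
    by apply/fsetP => y; rewrite !inE mem_interval_fset; case: y => [|y]; rewrite /= ?andbF.
  rewrite leqn0 => /eqP c0 E; split; last by rewrite E /= c0.
  by case=> // _; rewrite c0.
have [] := ordered_partitionS (ord n.+2 w isT); rewrite -/(label Pi w n.+1) res// IH.
rewrite size_partition_of// => cn E; split=> [m|].
  by rewrite ltnS leq_eqVlt => /orP[/eqP->|mn]; [exact: cn|exact: IHg].
by rewrite E.
Qed.

End Labels.

(** * Prefix probabilities from the prediction rule *)

Section PredictionRules.
Context d (T : measurableType d) (R : realType) (P : probability T R).
Variables (alpha : R) (V : nat -> nat -> R) (Pi : nat -> T -> seq {fset nat}).
Hypothesis egp : is_EGP P alpha V Pi.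

Let C := label Pi.

Let rpPi : random_partition Pi. Proof. by have [] := egp. Qed.

Lemma growing_label w n : growing (C w) n.
Proof.
case: n => [|n]; first by move=> m; rewrite ltn0.
exact: (partition_label w n rpPi).1.
Qed.

Let PiE w n : Pi n.+1 w = partition_of (C w) n.+1.
Proof. exact: (partition_label w n rpPi).2. Qed.

Lemma measurable_partition_fun n (Q : set (seq {fset nat})) :
  measurable [set w | Q (Pi n.+1 w)].
Proof.
have [_ _ mPi] := rpPi.
rewrite (_ : [set w | _] = \bigcup_(p in Q) [set w | Pi n.+1 w = p]).
  rewrite bigcup_mkcond; apply: countable_bigcupT_measurable => // p.
  by case: ifP => // _; exact: mPi.
apply/seteqP; split => w /=; first by move=> Qw; exists (Pi n.+1 w).
by move=> [p Qp ->].
Qed.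

Lemma measurable_label m (Q : set nat) : measurable [set w | Q (C w m)].
Proof.
exact: (measurable_partition_fun m [set p | Q (find (fun B : {fset nat} => m.+1 \in B) p)]).
Qed.

Definition label_prefix (s : nat -> nat) n : set T :=
  [set w | forall m, (m < n)%N -> C w m = s m].

Lemma label_prefixE s n : growing s n.+1 ->
  label_prefix s n.+1 = [set w | Pi n.+1 w = partition_of s n.+1].
Proof.
move=> gs; apply/seteqP; split => w.
  by move=> ws; rewrite /= PiE; exact: eq_partition_of.
rewrite /= PiE => E; apply: partition_of_inj => //; exact: growing_label.
Qed.

Lemma measurable_label_prefix s n : measurable (label_prefix s n).
Proof.
rewrite (_ : label_prefix s n = \bigcap_(m in [set m | (m < n)%N]) [set w | C w m = s m]).
  by apply: bigcap_measurableType => m _; exact: (measurable_label m [set s m]).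
by apply/seteqP; split => w H m mn; exact: H.
Qed.

Definition record_prefix (r : nat -> bool) n : set T :=
  [set w | forall m, (m < n)%N -> is_record (C w) m = r m].

Lemma measurable_record m (b : bool) : measurable [set w | is_record (C w) m = b].
Proof.
case: m => [|m].
  rewrite (_ : [set w | _] = if b then setT else set0); first by case: b.
  have r0 w : is_record (C w) 0.
    by have := @growing_label w 1%N 0%N isT; rewrite leqn0 /is_record.
  by apply/seteqP; split => w /=; rewrite r0; case: b.
have H : measurable [set w | is_record (C w) m.+1].
  rewrite (_ : [set w | _] = [set w | size (Pi m.+1 w) == find (fun B : {fset nat} => m.+2 \in B) (Pi m.+2 w)]).
    rewrite (_ : [set w | _] = \bigcup_k ([set w | size (Pi m.+1 w) = k] `&` [set w | C w m.+1 = k])).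
      apply: bigcupT_measurable => k; apply: measurableI.
        exact: (measurable_partition_fun m [set p | size p = k]).
      exact: (measurable_label m.+1 [set k]).
    apply/seteqP; split => w /=.
      by move=> /eqP E; exists (size (Pi m.+1 w)).
    by move=> [k _ [/= -> <-]].
  apply/seteqP; split => w /=;
    by rewrite PiE size_partition_of 1?eq_sym//; exact: growing_label.
case: b => //; rewrite (_ : [set w | _] = ~` [set w | is_record (C w) m.+1]).
  exact: measurableC.
by apply/seteqP; split => w /=; [move=> ->|move/negP/negbTE].
Qed.

Lemma measurable_record_prefix r n : measurable (record_prefix r n).
Proof.
rewrite (_ : record_prefix r n =
    \bigcap_(m in [set m | (m < n)%N]) [set w | is_record (C w) m = r m]).
  by apply: bigcap_measurableType => m _; exact: measurable_record.
by apply/seteqP; split => w H m mn; exact: H.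
Qed.

Let q n k : R := V n.+1 k.+1 / V n k.

Local Open Scope ereal_scope.

(** The prediction rule says nothing on a past of probability 0; in product form the identity holds
    there too, as both sides vanish. *)
Let cond_prob_mul (A B : set T) (x : R) : measurable A -> measurable B ->
  (0 < P B -> cond_prob P A B = x) -> P (A `&` B) = x%:E * P B.
Proof.
move=> mA mB; have [B0 _|B0 /(_ _)] := eqVneq (P B) 0.
  rewrite B0 mule0; apply/eqP; rewrite eq_le measure_ge0 andbT -B0.
  by rewrite le_measure ?inE//; exact: measurableI.
have Bgt : 0 < P B by rewrite lt0e B0 measure_ge0.
move=> /(_ Bgt) <-; rewrite /cond_prob.
have fB : P B \is a fin_num by rewrite fin_num_measure.
have fAB : P (A `&` B) \is a fin_num by rewrite fin_num_measure//; exact: measurableI.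
rewrite -[in RHS](fineK fB) -EFinM divfK ?fineK//.
by rewrite gt_eqF// fine_gt0// Bgt ltey_eq fB.
Qed.

Let prob_open s n : growing s n.+1 ->
  P (label_prefix s n.+1 `&` [set w | is_record (C w) n.+1]) =
  (q n.+1 (nclasses s n.+1))%:E * P (label_prefix s n.+1).
Proof.
move=> gs; have [_ _ /(_ n.+1 (partition_of s n.+1) isT)] := egp.
cbv zeta; rewrite size_partition_of// -label_prefixE// => H.
have mB := measurable_label_prefix s n.+1.
have [_ _ /(_ n.+2 (open_class n.+2 (partition_of s n.+1)) isT) mA] := rpPi.
rewrite -(cond_prob_mul mA mB (fun B0 => (H B0).1)).
congr (P _); rewrite setIC; apply/seteqP; split => w [h ws]; split => //.
  rewrite /mkset PiE; have E : partition_of (C w) n.+1 = partition_of s n.+1 by exact: eq_partition_of.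
  rewrite [LHS]/= -/(partition_of (C w) n.+1) E /add_element size_partition_of//.
  by rewrite (eqP h) (eq_nclasses ws) eqxx.
have E : partition_of (C w) n.+1 = partition_of s n.+1 by exact: eq_partition_of.
have Nw : nclasses (C w) n.+1 = nclasses s n.+1 by exact: eq_nclasses.
have {h} := congr1 size h.
rewrite PiE size_partition_of; last exact: growing_label.
rewrite /open_class size_rcons size_partition_of// -Nw nclassesS.
by rewrite /mkset; case: (is_record _ _) => //; rewrite addn0; lia.
Qed.

Let prob_join s n : growing s n.+2 -> ~~ is_record s n.+1 ->
  P (label_prefix s n.+2) =
  (((class_size s (s n.+1) n.+1)%:R - alpha) / (n.+1%:R - alpha * (nclasses s n.+1)%:R) *
   (1 - q n.+1 (nclasses s n.+1)))%:E * P (label_prefix s n.+1).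
Proof.
move=> gs2 nr; have gs : growing s n.+1 by exact: growingW gs2.
have sk : (s n.+1 < nclasses s n.+1)%N by rewrite ltn_neqAle -/(is_record s n.+1) nr gs2.
have [_ _ /(_ n.+1 (partition_of s n.+1) isT)] := egp.
cbv zeta; rewrite size_partition_of// -label_prefixE// => H.
have mB := measurable_label_prefix s n.+1.
have [_ _ /(_ n.+2 (join_class n.+2 (s n.+1) (partition_of s n.+1)) isT) mA] := rpPi.
rewrite -(card_partition_of (s n.+1) gs) -(cond_prob_mul mA mB (fun B0 => (H B0).2 _ sk)).
congr (P _).
have E : partition_of s n.+2 = join_class n.+2 (s n.+1) (partition_of s n.+1).
  by rewrite [LHS]/= -/(partition_of s n.+1) /add_element size_partition_of//
    -/(is_record s n.+1) (negbTE nr).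
rewrite -E -label_prefixE// setIidl// => w ws m mn; apply: ws; exact: ltnW.
Qed.

Definition nrecords (r : nat -> bool) n : nat := (\sum_(m < n) r m)%N.

Lemma nclasses_records c n : nclasses c n = nrecords (is_record c) n.
Proof.
elim: n => [|n IH]; first by rewrite /nrecords big_ord0.
by rewrite /nrecords big_ord_recr/= -/(nrecords _ n) -IH.
Qed.

Let prob_sum_partitions n A : measurable A ->
  P A = \sum_(k <oo) P (A `&` [set w | choice.pickle (Pi n.+1 w) = k]).
Proof.
move=> mA; rewrite -measure_semi_bigcup//.
- congr (P _); apply/seteqP; split => [w Aw|w [k _ []//]].
  by exists (choice.pickle (Pi n.+1 w)).
- move=> k; apply: measurableI => //.
  exact: (measurable_partition_fun n [set p | choice.pickle p = k]).
- by move=> i j _ _ [w [[_ <-] [_ <-]]].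
- apply: bigcupT_measurable => k; apply: measurableI => //.
  exact: (measurable_partition_fun n [set p | choice.pickle p = k]).
Qed.

(** The probability of a new class depends on the past only through [n] and the number of classes,
    which the record pattern determines. So [prob_open] can be summed over the countably many
    partitions with this pattern. *)
Let prob_records_open (r : nat -> bool) n :
  P (record_prefix r n.+1 `&` [set w | is_record (C w) n.+1]) =
  (q n.+1 (nrecords r n.+1))%:E * P (record_prefix r n.+1).
Proof.
have mD := measurable_record_prefix r n.+1.
rewrite (prob_sum_partitions n mD) (@prob_sum_partitions n); last first.
  by apply: measurableI => //; exact: (measurable_record n.+1 true).
have term k : P (record_prefix r n.+1 `&` [set w | is_record (C w) n.+1] `&`
      [set w | choice.pickle (Pi n.+1 w) = k]) =
    (q n.+1 (nrecords r n.+1))%:E * P (record_prefix r n.+1 `&` [set w | choice.pickle (Pi n.+1 w) = k]).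
  rewrite setIAC.
  have [->|/set0P [w0 [rw0 kw0]]] := eqVneq (record_prefix r n.+1 `&`
      [set w | choice.pickle (Pi n.+1 w) = k]) set0.
    by rewrite set0I measure0 mule0.
  have g0 : growing (C w0) n.+1 by exact: growing_label.
  have -> : record_prefix r n.+1 `&` [set w | choice.pickle (Pi n.+1 w) = k] =
      label_prefix (C w0) n.+1.
    rewrite label_prefixE// -PiE; apply/seteqP; split => [w [_ /=]|w /= E].
      by rewrite -kw0; exact: (pcan_inj choice.pickleK).
    split; last by rewrite /= E.
    have CE m : (m < n.+1)%N -> C w m = C w0 m.
      move=> mn; apply: (@partition_of_inj _ _ n.+1) => //; first exact: growing_label.
      by rewrite -!PiE.
    move=> m mn; rewrite -rw0// /is_record CE//; congr (_ == _).
    by apply: eq_nclasses => i im; apply: CE; exact: ltn_trans mn.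
  rewrite prob_open// nclasses_records; congr (_%:E * _); congr (q _ _).
  by apply: eq_bigr => m _; rewrite rw0.
under eq_eseriesr do rewrite term.
by rewrite nneseriesZl.
Qed.

Lemma nrecordsS r n : nrecords r n.+1 = (nrecords r n + r n)%N.
Proof. by rewrite /nrecords big_ord_recr. Qed.

Let prob_records_join (r : nat -> bool) n : r n.+1 = false ->
  P (record_prefix r n.+2) =
  (1 - q n.+1 (nrecords r n.+1))%:E * P (record_prefix r n.+1).
Proof.
move=> rn; have mD := measurable_record_prefix r n.+1.
have fD : P (record_prefix r n.+1) \is a fin_num by rewrite fin_num_measure.
have -> : record_prefix r n.+2 = record_prefix r n.+1 `\`
    (record_prefix r n.+1 `&` [set w | is_record (C w) n.+1]).
  apply/seteqP; split => w.
    move=> rw; split; first by move=> m mn; apply: rw; exact: ltnW.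
    by move=> [_ /=]; rewrite rw// rn.
  move=> [rw h] m; rewrite ltnS leq_eqVlt => /orP[/eqP->|mn]; last exact: rw.
  by rewrite rn; apply/negP => hw; apply: h.
rewrite measureD//; last 2 first.
- by apply: measurableI => //; exact: (measurable_record n.+1 true).
- by rewrite ltey_eq fD.
rewrite setIA setIid [X in _ - X](prob_records_open r) -(fineK fD).
rewrite [X in X - _](_ : _ = (fine (P (record_prefix r n.+1)))%:E); last by rewrite fineK.
by rewrite -!EFinM -EFinB mulrBl mul1r.
Qed.

Let prob_records_split (r : nat -> bool) n : r n.+1 ->
  P (record_prefix r n.+2) =
  (q n.+1 (nrecords r n.+1))%:E * P (record_prefix r n.+1).
Proof.
move=> rn; rewrite -prob_records_open; congr (P _); apply/seteqP; split => w.
  move=> rw; split; first by move=> m mn; apply: rw; exact: ltnW.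
  by rewrite /= rw// rn.
move=> [rw h] m; rewrite ltnS leq_eqVlt => /orP[/eqP->|mn]; last exact: rw.
by rewrite rn; exact: h.
Qed.

Definition prediction_weight (s : nat -> nat) n : R :=
  (\prod_(m < n) if is_record s m then 1 else
     ((class_size s (s m) m)%:R - alpha) / (m%:R - alpha * (nclasses s m)%:R))%R.

Lemma prediction_weightS s n : prediction_weight s n.+1 =
  (prediction_weight s n * if is_record s n then 1 else
     ((class_size s (s n) n)%:R - alpha) / (n%:R - alpha * (nclasses s n)%:R))%R.
Proof. by rewrite /prediction_weight big_ord_recr. Qed.

(** A new class multiplies both sides by [q]. A join multiplies the left side by its weight times
    [1 - q] and the record probability by [1 - q], which leaves the weight alone. *)
Lemma prob_label_prefix s n : growing s n.+1 ->
  P (label_prefix s n.+1) =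
  (prediction_weight s n.+1)%:E * P (record_prefix (is_record s) n.+1).
Proof.
elim: n => [g1|n IH g2].
  have s0 : s 0%N = 0%N by have := g1 0%N isT; rewrite leqn0 => /eqP.
  have C0 w : C w 0%N = 0%N.
    by have := @growing_label w 1%N 0%N isT; rewrite leqn0 => /eqP.
  rewrite /prediction_weight big_ord1 /is_record/= s0 eqxx mul1e; congr (P _).
  by apply/seteqP; split => w _ [|//] _; rewrite /is_record/= C0 ?s0.
have g1 : growing s n.+1 by exact: growingW g2.
rewrite prediction_weightS; have [rn|rn] := boolP (is_record s n.+1).
  rewrite mulr1 prob_records_split// muleCA -IH// -nclasses_records -prob_open//.
  congr (P _); apply/seteqP; split => w.
    move=> ws; have ws' m : (m < n.+1)%N -> C w m = s m by move=> mn; apply: ws; exact: ltnW.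
    by split => //; rewrite /= /is_record ws// (eq_nclasses ws').
  move=> [ws h] m; rewrite ltnS leq_eqVlt => /orP[/eqP->|mn]; last exact: ws.
  by rewrite (eqP h) (eqP rn); exact: eq_nclasses.
rewrite prob_join// IH// prob_records_join ?(negbTE rn)// -nclasses_records.
by rewrite !muleA -!EFinM; congr (_%:E * _); ring.
Qed.

End PredictionRules.

(** * Sequence spaces *)

Section SequenceSpaces.
Context d (T : measurableType d) (R : realType).

(** Frequencies and tail products are defined by [limn] whether or not the limit exists. The set of
    convergence is measurable by the Cauchy criterion, and off it [limn] is the default point. *)
Lemma measurable_fun_limn (h : nat -> T -> R) :
  (forall n, measurable_fun [set: T] (h n)) ->
  measurable_fun [set: T] (fun x => limn (h ^~ x)).
Proof.
move=> mh; pose D := [set x | cvgn (h ^~ x)].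
have DE : D = \bigcap_k \bigcup_N \bigcap_(n in [set n | (N <= n)%N])
    [set x | `|h n x - h N x| <= k.+1%:R^-1].
  apply/seteqP; split => x.
    move=> cx k _; have e0 : 0 < k.+1%:R^-1 / 2 :> R by rewrite divr_gt0// invr_gt0.
    move/cvgrPdist_le : cx => /(_ _ e0)[N _ HN]; exists N => // n Nn /=.
    have := HN n Nn; have := HN N (leqnn N) => /=.
    set l := lim _; move=> h1 h2; rewrite (_ : _ - _ = (l - h N x) - (l - h n x)); last by ring.
    by rewrite (le_trans (ler_normB _ _))// (splitr (k.+1%:R^-1)) lerD.
  move=> Hx; apply/cauchy_cvgP; apply: cauchy_exP => e e0.
  have [k] := ltr_add_invr e0; rewrite add0r => ke.
  have [N _ HN] := Hx k I; exists (h N x).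
  exists N => // n Nn; rewrite /= /ball/= distrC; exact: le_lt_trans (HN n Nn) ke.
have mD : measurable D.
  rewrite DE; apply: bigcap_measurableType => k _; apply: bigcupT_measurable => N.
  apply: bigcap_measurableType => n _.
  have := measurable_fun_ler (measurableT_comp (@normr_measurable R setT) (measurable_funB (mh n) (mh N)))
    (@measurable_cst _ _ T R setT k.+1%:R^-1).
  by move=> /(_ measurableT [set true] I); rewrite setTI.
rewrite -(setUv D); apply/measurable_funU; [by []|exact: measurableC|split].
  apply: (measurable_fun_cvg (h := h)) => [m|x Dx]; last exact: Dx.
  exact: measurable_funS (mh m).
apply: (eq_measurable_fun (cst point)); last exact: measurable_cst.
by move=> x; rewrite inE => Dx; rewrite dvgP.
Qed.

Definition prefix_set (s : nat -> nat) n : set (nat -> nat) :=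
  [set c | forall m, (m < n)%N -> c m = s m].

(** The empty set is added to obtain a family closed under intersection: incompatible prefixes are
    disjoint, compatible ones meet in the longer prefix. *)
Definition prefix_sets : set (set (nat -> nat)) :=
  [set A | A = set0 \/ exists s n, A = prefix_set s n].

Definition nat_seq := g_sigma_algebraType prefix_sets.

Lemma measurable_prefix_set s n : measurable (prefix_set s n : set nat_seq).
Proof. by apply: sub_sigma_algebra; right; exists s, n. Qed.

Lemma measurable_nat_coord m (Q : set nat) :
  measurable ([set c | Q (c m)] : set nat_seq).
Proof.
rewrite (_ : [set c | _] = \bigcup_(l in [set l : seq nat | Q (nth 0%N l m)])
    prefix_set (nth 0%N l) m.+1); last first.
  apply/seteqP; split => c.
    move=> Qc; exists (mkseq c m.+1); first by rewrite /= nth_mkseq.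
    by move=> i im; rewrite nth_mkseq.
  by move=> [l Ql /(_ m (ltnSn m)) E]; rewrite /= E.
rewrite bigcup_mkcond; apply: countable_bigcupT_measurable => // l.
by case: ifP => // _; exact: measurable_prefix_set.
Qed.

Lemma measurable_to_nat_seq (f : T -> nat_seq) :
  (forall s n, measurable [set w | forall m, (m < n)%N -> f w m = s m]) ->
  measurable_fun [set: T] f.
Proof.
move=> mf; apply: (measurability _ (erefl : @measurable _ nat_seq = _)).
move=> _ [A [->|[s [n ->]]] <-]; first by rewrite preimage_set0 setI0.
by rewrite setTI; exact: mf.
Qed.

Lemma nat_seq_measure_unique (m1 m2 : {measure set nat_seq -> \bar R}) :
  (m1 setT < +oo)%E ->
  (forall s n, m1 (prefix_set s n) = m2 (prefix_set s n)) ->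
  forall A, measurable A -> m1 A = m2 A.
Proof.
move=> m1T E A mA.
have pT : prefix_set (fun=> 0%N) 0 = setT by apply/seteqP; split.
apply: (@measure_unique _ R nat_seq prefix_sets (fun=> setT)) => //.
- move=> X Y [->|[s [n ->]]]; first by rewrite set0I; left.
  move=> [->|[t [k ->]]]; first by rewrite setI0; left.
  have [[c [sc tc]]|nc] := pselect (exists c, (prefix_set s n `&` prefix_set t k) c).
    right; exists c, (maxn n k); apply/seteqP; split => e.
      move=> [se te] m; rewrite leq_max => /orP[mn|mk].
        by rewrite se// sc.
      by rewrite te// tc.
    move=> ce; split => m mn.
      by rewrite ce ?leq_max ?mn// sc.
    by rewrite ce ?leq_max ?mn ?orbT// tc.
  by left; apply/seteqP; split => e // ee; apply: nc; exists e.
- by move=> _; right; exists (fun=> 0%N), 0%N.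
- by rewrite bigcup_const.
- by move=> X [->|[s [n ->]]]; [rewrite !measure0|exact: E].
Qed.

End SequenceSpaces.

Section Cylinders.
Context d (T : measurableType d) d' (S : measurableType d').

Lemma measurable_coord j :
  measurable_fun [set: g_sigma_algebraType (cylinders (@measurable _ S))]
    (fun s : g_sigma_algebraType (cylinders (@measurable _ S)) => s j).
Proof.
move=> _ B mB; rewrite setTI; apply: sub_sigma_algebra.
by exists j, B.
Qed.

Lemma measurable_to_seq (f : T -> g_sigma_algebraType (cylinders (@measurable _ S))) :
  (forall j, measurable_fun [set: T] (fun w => f w j)) -> measurable_fun [set: T] f.
Proof.
move=> mf; apply: (measurability _ (erefl : @measurable _
  (g_sigma_algebraType (cylinders (@measurable _ S))) = _)).
move=> _ [A [j [B mB ->]] <-].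
exact: (mf j measurableT B mB).
Qed.

End Cylinders.

Section LabelFunctionals.
Context (R : realType).

Definition label_frequency (c : nat -> nat) j : R :=
  limn (fun n => (class_size c j n)%:R / n%:R : R).

Definition label_record (c : nat -> nat) j : \bar R :=
  ereal_inf [set (m.+1%:R)%:E | m in [set m | c m = j]].

Lemma measurable_label_frequency :
  measurable_fun [set: nat_seq] (label_frequency : nat_seq -> real_seq R).
Proof.
apply: measurable_to_seq => j.
apply: (@measurable_fun_limn _ nat_seq R (fun n c => (class_size c j n)%:R / n%:R)) => n.
apply: measurable_funM; last exact: measurable_cst.
rewrite (_ : (fun _ => _) = (fun c : nat_seq => \sum_(m < n) \1_[set c : nat_seq | c m = j] c : R)).
  apply: measurable_sum => m; apply: measurable_indic.
  exact: (measurable_nat_coord m [set j]).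
apply/funext => c; rewrite /class_size natr_sum; apply: eq_bigr => m _.
rewrite indicE; congr (_%:R); congr (nat_of_bool _).
by apply/eqP/idP; rewrite inE.
Qed.

Lemma measurable_label_record :
  measurable_fun [set: nat_seq] (label_record : nat_seq -> ereal_seq R).
Proof.
apply: measurable_to_seq => j.
rewrite (_ : (fun _ => _) = (fun c : nat_seq =>
   einfs (fun m => if c m == j then (m.+1%:R)%:E else +oo%E) 0)).
  apply: (measurable_fun_einfs (f := fun m (c : nat_seq) => if c m == j then (m.+1%:R)%:E else +oo%E)) => m.
  apply: (measurable_fun_ifT (f := fun c : nat_seq => c m == j)); try exact: measurable_cst.
  apply: (measurable_fun_bool true); rewrite setTI.
  exact: (measurable_nat_coord m [set k | (k == j) = true]).
apply/funext => c; rewrite /label_record /einfs/=; apply/eqP; rewrite eq_le; apply/andP; split.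
  apply/ereal_infP => _ [m _ <-]; case: eqP => [cm|_]; last exact: leey.
  by apply: ereal_inf_lbound; exists m.
apply/ereal_infP => _ [m cm <-].
by apply: ereal_inf_lbound; exists m => //; rewrite cm eqxx.
Qed.

End LabelFunctionals.

Section LimitFunctionals.
Context d (T : measurableType d) (R : realType).
Variable Pi : nat -> T -> seq {fset nat}.
Hypothesis rpPi : random_partition Pi.

Lemma limit_frequencyE w : limit_frequency R Pi w = label_frequency R (label Pi w).
Proof.
apply/funext => j; rewrite /limit_frequency /label_frequency.
congr (limn _); apply/funext => -[|n].
  by rewrite invr0 !mulr0.
have [gc ->] := partition_label w n rpPi.
by rewrite card_partition_of.
Qed.

Lemma record_indexE w : record_index R Pi w = label_record R (label Pi w).
Proof.
apply/funext => j; congr (ereal_inf _); apply/seteqP; split => y [].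
  move=> x [[//|n] _]; rewrite /mkset /=.
  have [gc ->] := partition_label w n rpPi.
  rewrite mem_partition_of// => /andP[/andP[x0 xn] /eqP cx] <-{y}.
  by exists x.-1 => //; rewrite prednK.
move=> m cm <-{y}; exists m.+1 => //; exists m.+1 => //=.
have [gc ->] := partition_label w m rpPi.
by rewrite mem_partition_of// leqnn/= cm eqxx.
Qed.

End LimitFunctionals.

(** * The conditional law as a kernel *)

Section ResidualKernel.
Context {R : realType}.
Local Notation U := (uniform_prob (@ltr01 R)).
Variables (alpha : R) (u : nat -> R -> R).
Hypotheses (alpha1 : alpha < 1) (iid : iid_uniform u).

(** The bound holds since class [j], counted from 0, opens no earlier than element [j + 1]; it makes
    the second Beta parameter positive for [0 < j]. *)
Definition admissible_record j (x : \bar R) : Prop :=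
  exists2 n, (j < n)%N & x = (n%:R)%:E.

(** The value 0 at [x = +oo] is the convention for a Beta variable with infinite second parameter.
    At other inadmissible [x] it is a default that keeps [stick] total and measurable. *)
Definition stick (j : nat) (x : \bar R) (v : R) : R :=
  if j == 0%N then 1 else
  if `[< admissible_record j x >] then
    quantile (beta_law (1 - alpha) (fine x - j%:R * alpha - 1)) v
  else 0.

Lemma stick01 j x v : 0 <= stick j x v <= 1.
Proof.
rewrite /stick; case: ifP => _; first by rewrite ler01 lexx.
case: ifP => _; last by rewrite lexx ler01.
by rewrite quantile_ge0 quantile_le1.
Qed.

Lemma beta_param_gt0 j n : (0 < j < n)%N -> 0 < n%:R - j%:R * alpha - 1.
Proof.
move=> /andP[j0 jn]; have j1 : 1 <= j%:R :> R by rewrite ler1n.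
have jn1 : j%:R + 1 <= n%:R :> R by rewrite -(natrD R j 1) ler_nat addn1.
have : j%:R * alpha < j%:R by rewrite gtr_pMr// ltr0n.
lra.
Qed.

(** Admissible record values are countable, so the space splits into countably many slices on which
    [x] is constant and only measurability in [v] is at stake. *)
Lemma measurable_stick j :
  measurable_fun [set: \bar R * R] (fun p => stick j p.1 p.2).
Proof.
have [->|j0] := eqVneq j 0%N; first exact: measurable_cst.
pose E n : set (\bar R * R) := [set p | p.1 = (n%:R)%:E].
have mE n : measurable (E n).
  by have := @measurable_fst _ _ (\bar R) R measurableT _ (emeasurable_set1 (n%:R)%:E); rewrite setTI.
pose D := \bigcup_(n in [set n | (j < n)%N]) E n.
have mD : measurable D by apply: bigcup_measurable => n _; exact: mE.
rewrite -(setUv D); apply/measurable_funU; [by []|exact: measurableC|split].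
  rewrite /D bigcup_mkcond; apply/measurable_fun_bigcup => n.
    by case: ifP => // _; exact: mE.
  case: ifPn => [|_]; last exact: measurable_fun_set0.
  rewrite inE => jn.
  apply: (eq_measurable_fun (fun p : \bar R * R =>
      quantile (beta_law (1 - alpha) (n%:R - j%:R * alpha - 1)) p.2)).
    move=> p; rewrite inE /E/= => pn; rewrite /stick (negbTE j0) pn.
    by rewrite asboolT//; exists n.
  apply: (measurable_funS measurableT) => //.
  apply: measurableT_comp; last exact: measurable_snd.
  apply: measurable_beta_quantile; first by rewrite subr_gt0.
  by rewrite beta_param_gt0// lt0n j0.
apply: (eq_measurable_fun (cst (0 : R) : \bar R * R -> R)); last exact: measurable_cst.
move=> p; rewrite inE /stick (negbTE j0) => nD; rewrite asboolF// => -[n jn pn]; apply: nD; exists n => //.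
Qed.

Lemma measurable_stick_uniform j :
  measurable_fun [set: ereal_seq R * measurableTypeR R] (fun p => stick j (p.1 j) (u j p.2)).
Proof.
have [mu _ _] := iid.
apply: (@measurableT_comp _ _ _ (ereal_seq R * measurableTypeR R)%type (\bar R * R)%type R
  (fun p => stick j p.1 p.2) _ (fun p => (p.1 j, u j p.2)) (measurable_stick j)).
apply: measurable_fun_pair => /=.
  exact: (measurableT_comp (@measurable_coord _ (\bar R) j) measurable_fst).
exact: measurableT_comp (mu j) measurable_snd.
Qed.

Definition residual_map (i : ereal_seq R) (x : R) : real_seq R :=
  residual_products (fun j => stick j (i j) (u j x)).

Lemma measurable_residual_map :
  measurable_fun [set: ereal_seq R * measurableTypeR R] (fun p => residual_map p.1 p.2).
Proof.
apply: measurable_to_seq => j; apply: measurable_funM.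
  exact: measurable_stick_uniform.
apply: (@measurable_fun_limn _ _ R (fun M (p : ereal_seq R * measurableTypeR R) =>
  \prod_(j.+1 <= m < M) (1 - stick m (p.1 m) (u m p.2)))) => M.
apply: measurable_prod => m _; apply: measurable_funB; first exact: measurable_cst.
exact: measurable_stick_uniform.
Qed.

Lemma measurable_residual_map2 i : measurable_fun [set: measurableTypeR R] (residual_map i).
Proof.
exact: (measurableT_comp measurable_residual_map (@measurable_pair1 _ _ _ _ i)).
Qed.

Definition residual_kernel (i : ereal_seq R) : {measure set (real_seq R) -> \bar R} :=
  distribution U (to_mfun (measurable_residual_map2 i)).

Let measurable_residual_kernel A : measurable A ->
  measurable_fun [set: ereal_seq R] (residual_kernel ^~ A).
Proof.
move=> mA; pose S : set (ereal_seq R * measurableTypeR R) := [set p | A (residual_map p.1 p.2)].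
have mS : measurable S by have := measurable_residual_map measurableT mA; rewrite setTI.
have := @measurable_fun_xsection _ _ (ereal_seq R) (measurableTypeR R) R U S mS.
congr (measurable_fun _ _); apply/funext => i; congr (U _).
by apply/seteqP; split => x; rewrite xsectionE.
Qed.

HB.instance Definition _ := isKernel.Build _ _ _ _ _ residual_kernel
  measurable_residual_kernel.

Let residual_kernel_prob i : residual_kernel i [set: _] = 1%E.
Proof. exact: probability_setT. Qed.

HB.instance Definition _ := Kernel_isProbability.Build _ _ _ _ _
  residual_kernel residual_kernel_prob.

Definition residual_pkernel : R.-pker (ereal_seq R) ~> (real_seq R) := residual_kernel.

Lemma prod_natr_bool (I : eqType) (s : seq I) (b : I -> bool) :
  \prod_(j <- s) (b j)%:R = (all b s)%:R :> R.
Proof.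
elim: s => [|j s IH]; first by rewrite big_nil.
by rewrite big_cons IH /=; case: (b j); rewrite /= ?mul1r ?mul0r.
Qed.

Let measurable_stick1 (i : ereal_seq R) j :
  measurable_fun [set: R] (fun v => stick j (i j) v).
Proof.
exact: (measurableT_comp (measurable_stick j) (@measurable_pair1 _ _ _ _ (i j))).
Qed.

Let measurable_xi (i : ereal_seq R) j :
  measurable_fun [set: R] (fun x => stick j (i j) (u j x)).
Proof. by have [mu _ _] := iid; exact: (measurableT_comp (measurable_stick1 i j) (mu j)). Qed.

Let integral_one : (\int[U]_x (1 : R)%:E = 1)%E.
Proof. by rewrite integral_cst// mul1e; exact: probability_setT. Qed.

Lemma uniform_marginal (g : R -> R) j :
  measurable_fun setT g -> (forall x, 0 <= g x) ->
  (\int[U]_x (g (u j x))%:E = \int[U]_x (g x)%:E)%E.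
Proof.
move=> mg g0; have [_ _ uprod] := iid.
have := uprod j.+1 (fun k => if k == j then g else cst 1).
rewrite big_ord_recr/= eqxx big1 ?mul1e => [H|k _]; last first.
  rewrite ltn_eqF//; exact: integral_one.
rewrite -H => [|k|k x]; try by case: eqP.
apply: eq_integral => x _; rewrite big_ord_recr/= eqxx big1 ?mul1r// => k _.
by rewrite ltn_eqF.
Qed.

Let uniform_indic (A : set R) : measurable A -> (U A = \int[U]_x (\1_A x)%:E)%E.
Proof. by move=> mA; rewrite integral_indic//; congr (U _); rewrite setIT. Qed.

Lemma uniform_marginal_set (A : set R) j : measurable A -> U (u j @^-1` A) = U A.
Proof.
move=> mA; have [mu _ _] := iid.
have mB : measurable (u j @^-1` A) by rewrite -[X in measurable X]setTI; exact: mu.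
rewrite (uniform_indic mA) (uniform_indic mB) -(uniform_marginal (g := \1_A) j)//.
Qed.

Lemma stick_uniform_independent (i : ereal_seq R) :
  mutually_independent U (fun j x => stick j.+1 (i j.+1) (u j.+1 x)).
Proof.
have [mu _ uprod] := iid; move=> J B mB.
(* Independence over the finite set [J] becomes one instance of the product formula: the factor is
   an indicator for indices in [J] (shifted by one) and 1 elsewhere, including index 0. *)
pose f j v : R := if j is k.+1 then
    if k \in J then \1_(B k) (stick k.+1 (i k.+1) v) else 1
  else 1.
pose A j : set R := (fun x => stick j.+1 (i j.+1) (u j.+1 x)) @^-1` B j.
have mA j : measurable (A j) by rewrite -[A j]setTI; exact: (measurable_xi i j.+1).
have mf j : measurable_fun setT (f j).
  case: j => [|j]; first exact: measurable_cst.
  rewrite /f; case: (j \in J); last exact: measurable_cst.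
  exact: (measurableT_comp (@measurable_indic _ _ R setT _ (mB j)) (measurable_stick1 i j.+1)).
have f0 j v : 0 <= f j v.
  by case: j => [|j] //=; case: ifP => _ //; rewrite indicE.
pose N := (\max_(j <- J) j).+1.
have JN j : j \in J -> (j < N)%N by move=> jJ; rewrite ltnS; exact: leq_bigmax_seq.
have perm : perm_eq [seq j <- index_iota 0 N | j \in J] J.
  apply: uniq_perm; rewrite ?filter_uniq ?iota_uniq ?fset_uniq// => j.
  rewrite mem_filter mem_index_iota; apply/andP/idP => [[]//|jJ].
  by rewrite JN.
have red (V : Type) (idx : V) (op : Monoid.com_law idx) (g : nat -> V) :
    \big[op/idx]_(j < N) (if (nat_of_ord j) \in J then g j else idx) = \big[op/idx]_(j <- J) g j.
  rewrite -big_mkcond -(big_mkord (fun j => j \in J)) -big_filter.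
  exact: perm_big.
have := uprod N.+1 f mf f0.
have -> : (\prod_(j < N.+1) \int[U]_x (f j x)%:E = \prod_(j <- J) U (A j))%E.
  rewrite big_ord_recl/= integral_one mul1e -(red _ _ _ (fun j => U (A j))).
  apply: eq_bigr => j _; rewrite -(uniform_marginal j.+1 (mf j.+1) (f0 j.+1)) /f/=.
  case: ((j : nat) \in J); last exact: integral_one.
  by rewrite uniform_indic.
move=> H; apply: etrans H; rewrite [LHS](@uniform_indic (\bigcap_(j in [set` J]) A j)); last by apply: fin_bigcap_measurable => // j _; exact: mA.
apply: eq_integral => x _; congr (_%:E).
rewrite big_ord_recl mul1r /=.
rewrite (eq_bigr (fun j : 'I_N => if (j : nat) \in J then (x \in A j)%:R else 1)) => [|j _]; last first.
  by rewrite /f /=; case: ((j : nat) \in J).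
rewrite (red _ _ _ (fun j => (x \in A j)%:R)) prod_natr_bool indicE.
congr (_%:R); congr nat_of_bool; apply/idP/allP => [|H].
  rewrite inE => H j jJ; rewrite inE; exact: H.
by rewrite inE => j /= jJ; have := H j jJ; rewrite inE.
Qed.

Lemma stick_beta_distributed (i : ereal_seq R) j : (0 < j)%N ->
  (i j = +oo%E \/ admissible_record j (i j)) ->
  beta_distributed U (fun x => stick j (i j) (u j x)) (1 - alpha)
    (i j - (j%:R * alpha)%:E - 1)%E.
Proof.
move=> j0 [->|[n jn ijn]].
  by move=> x; rewrite /stick gtn_eqF// asboolF// => -[].
rewrite ijn -!EFinB => B mB.
have b0 : 0 < n%:R - j%:R * alpha - 1 by rewrite beta_param_gt0// j0.
have a0 : 0 < 1 - alpha by rewrite subr_gt0.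
rewrite -(beta_lawE _ _ mB) -(beta_quantile_uniform a0 b0 mB).
have -> : (fun x => stick j (n%:R)%:E (u j x)) @^-1` B =
    (quantile (beta_law (1 - alpha) (n%:R - j%:R * alpha - 1)) \o u j) @^-1` B.
  by apply/seteqP; split => x; rewrite /preimage/= /stick gtn_eqF// asboolT//; exists n.
rewrite -(@uniform_marginal_set _ j)//.
by rewrite -[X in measurable X]setTI; exact: measurable_beta_quantile.
Qed.

Lemma residual_kernel_law (i : ereal_seq R) :
  (forall j, (0 < j)%N -> i j = +oo%E \/ admissible_record j (i j)) ->
  is_residual_law alpha i (residual_pkernel i).
Proof.
move=> adm; exists _, (measurableTypeR R), U, 
  (fun j => @to_mfun _ _ (measurableTypeR R) R _ (measurable_xi i j)).
split=> //=.
- by move=> j j0; apply: stick_beta_distributed => //; exact: adm.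
- exact: stick_uniform_independent.
Qed.

End ResidualKernel.

(** * Resampling of the labels from the sticks *)

Section RecordPatterns.
Context (R : realType).
Implicit Types (r : nat -> bool) (c : nat -> nat).

Lemma nrecords_mono r m n : (m <= n)%N -> (nrecords r m <= nrecords r n)%N.
Proof.
elim: n => [|n IH]; first by rewrite leqn0 => /eqP->.
rewrite leq_eqVlt ltnS nrecordsS => /orP[/eqP->|/IH mn]; first by rewrite nrecordsS.
exact: leq_trans mn (leq_addr _ _).
Qed.

Lemma nrecords_lt r m n : r m -> (m < n)%N -> (nrecords r m < nrecords r n)%N.
Proof.
by move=> rm /(nrecords_mono r); apply: leq_trans; rewrite nrecordsS rm addn1.
Qed.

Lemma nrecords_le r n : (nrecords r n <= n)%N.
Proof.
elim: n => [|n IH]; first by rewrite /nrecords big_ord0.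
by rewrite nrecordsS; case: (r n); rewrite ?addn1 ?addn0 ?ltnS// ltnW.
Qed.

Lemma nrecords_ex r j n : (j < nrecords r n)%N ->
  exists m, [/\ (m < n)%N, r m & nrecords r m = j].
Proof.
elim: n => [|n IH]; first by rewrite /nrecords big_ord0.
rewrite nrecordsS; case rn: (r n) => /=; last first.
  by rewrite addn0 => /IH[m [mn rm <-]]; exists m; split=> //; exact: ltnW.
rewrite addn1 ltnS leq_eqVlt => /orP[/eqP->|/IH[m [mn rm <-]]]; first by exists n.
by exists m; split=> //; exact: ltnW.
Qed.

Lemma nrecords_inj r m n : r m -> r n -> nrecords r m = nrecords r n -> m = n.
Proof.
move=> rm rn E; case: (ltngtP m n) => // h.
  by have := nrecords_lt rm h; rewrite E ltnn.
by have := nrecords_lt rn h; rewrite E ltnn.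
Qed.

Lemma eq_nrecords r r' n : (forall m, (m < n)%N -> r m = r' m) ->
  nrecords r n = nrecords r' n.
Proof. by move=> E; apply: eq_bigr => m _; rewrite E. Qed.

Definition pattern_record r j : \bar R :=
  ereal_inf [set (m.+1%:R)%:E | m in [set m | r m /\ nrecords r m = j]].

Lemma pattern_recordE r m : r m -> pattern_record r (nrecords r m) = (m.+1%:R)%:E.
Proof.
move=> rm; rewrite /pattern_record (_ : [set _ | _ in _] = [set (m.+1%:R)%:E]).
  by rewrite ereal_inf1.
apply/seteqP; split => [_ [n [rn nm] <-]|_ ->]; last by exists m.
by rewrite (nrecords_inj rn rm nm).
Qed.

Lemma pattern_recordNE r j : (forall m, r m -> nrecords r m <> j) ->
  pattern_record r j = +oo%E.
Proof.
move=> H; rewrite /pattern_record (_ : [set _ | _ in _] = set0) ?ereal_inf0//.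
by apply/seteqP; split => // y [m [rm /(H m rm)]].
Qed.

Lemma pattern_record_admissible r j :
  pattern_record r j = +oo%E \/ admissible_record j (pattern_record r j).
Proof.
have [[m [rm <-]]|H] := pselect (exists m, r m /\ nrecords r m = j); last first.
  by left; apply: pattern_recordNE => m rm mj; apply: H; exists m.
by right; exists m.+1; rewrite ?pattern_recordE// ltnS nrecords_le.
Qed.

(** In a restricted growth sequence label [j] first occurs at a record, so the least element of a
    class can be read off the record pattern alone. *)
Lemma label_recordE c : (forall n, growing c n) ->
  label_record R c = pattern_record (is_record c).
Proof.
move=> gc; apply/funext => j; apply/eqP; rewrite eq_le; apply/andP; split.
  apply/ereal_infP => _ [m [/eqP cm mj] <-].
  by apply: ereal_inf_lbound; exists m => //=; rewrite cm nclasses_records.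
apply/ereal_infP => _ [m cm <-].
have [n [nm rn nj]] : exists n, [/\ (n <= m)%N, is_record c n & nrecords (is_record c) n = j].
  have := gc m.+1 m (ltnSn m); rewrite cm leq_eqVlt => /orP[/eqP jm|].
    by exists m; rewrite -nclasses_records jm leqnn /is_record cm jm eqxx.
  by rewrite nclasses_records => /nrecords_ex[n [nm rn nj]]; exists n; rewrite ltnW.
apply: (@le_trans _ _ (n.+1%:R)%:E); last by rewrite lee_fin ler_nat.
by apply: ereal_inf_lbound; exists n.
Qed.

End RecordPatterns.

(** * Sampling labels from sticks *)

Section PaintBox.
Context (R : realType).
Variables (r : nat -> bool) (xi : nat -> R).
Hypotheses (r0 : r 0%N) (xi0 : xi 0%N = 1) (xi01 : forall j, 0 <= xi j <= 1).

Definition tail_prod j k : R := \prod_(j <= l < k) (1 - xi l).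

Lemma tail_prod_ge j k : (k <= j)%N -> tail_prod j k = 1.
Proof. by move=> kj; rewrite /tail_prod big_geq. Qed.

Lemma tail_prod01 j k : 0 <= tail_prod j k <= 1.
Proof.
apply/andP; split.
  by apply: prodr_ge0 => l _; rewrite subr_ge0; case/andP: (xi01 l).
apply: prodr_ile1 => l _; rewrite subr_ge0 gerBl.
by case/andP: (xi01 l) => -> ->.
Qed.

Lemma tail_prodS j k : (j < k)%N -> tail_prod j k = (1 - xi j) * tail_prod j.+1 k.
Proof. by move=> jk; rewrite /tail_prod big_ltn. Qed.

Lemma tail_prod_mono i j k : (i <= j)%N -> tail_prod i k <= tail_prod j k.
Proof.
elim: j => [|j IH]; first by rewrite leqn0 => /eqP->.
rewrite leq_eqVlt ltnS => /orP[/eqP->//|/IH/le_trans]; apply.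
have [jk|kj] := ltnP j k; last by rewrite !tail_prod_ge// ltnW.
rewrite tail_prodS// ler_piMl ?gerBl//; last by case/andP: (xi01 j).
by case/andP: (tail_prod01 j.+1 k).
Qed.

Lemma tail_prod0 k : (0 < k)%N -> tail_prod 0 k = 0.
Proof. by move=> k0; rewrite tail_prodS// xi0 subrr mul0r. Qed.

Lemma nrecords_gt0 m : ~~ r m -> (0 < nrecords r m)%N.
Proof.
case: m => [|m] rm; first by rewrite r0 in rm.
by apply: leq_ltn_trans (nrecords_lt r0 (ltn0Sn m)).
Qed.

(* Element [m] gets a label below [j] when its uniform variable is below
   [threshold m j]: a non-record opens no class, so it chooses among the
   [nrecords r m] classes with the weights of the stick-breaking so far. *)
Definition threshold m j : R :=
  if r m then (nrecords r m < j)%N%:R else tail_prod j (nrecords r m).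

Lemma threshold01 m j : 0 <= threshold m j <= 1.
Proof.
rewrite /threshold; case: ifP => _; last exact: tail_prod01.
by case: (_ < _)%N; rewrite ?lexx ler01.
Qed.

(** Inverse distribution sampling. The weights [xi c * tail_prod xi c.+1 k] are differences of
    consecutive tail products, and [xi 0 = 1] makes the first tail product 0, so
    [tail_prod xi c.+1 k] is the cumulative weight of the classes up to [c]. *)
Definition paint_label (v : nat -> R) m : nat :=
  if r m then nrecords r m else
  find (fun c => v m < tail_prod c.+1 (nrecords r m)) (iota 0 (nrecords r m)).

Variable v : nat -> R.
Hypothesis v01 : forall m, 0 <= v m < 1.

Lemma paint_label_lt m j : (paint_label v m < j)%N = (v m < threshold m j).
Proof.
have /andP[v0 v1] := v01 m.
rewrite /paint_label /threshold; have [rm|rm] := boolP (r m).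
  by case: (_ < _)%N; rewrite ?v1// ltNge v0.
have k0 := nrecords_gt0 rm; set k := nrecords r m in k0 *.
case: j => [|j]; first by rewrite tail_prod0// ltn0 ltNge v0.
(* The search succeeds at the latest at class [k - 1], whose cumulative weight is an empty
   product. *)
set p := fun c => _; have hp : has p (iota 0 k).
  apply/hasP; exists k.-1; first by rewrite mem_iota/= add0n prednK.
  by rewrite /p prednK// tail_prod_ge.
have fk : (find p (iota 0 k) < k)%N by rewrite -[X in (_ < X)%N](size_iota 0 k) -has_find.
have [jk|kj] := ltnP j k; last first.
  by rewrite tail_prod_ge ?v1 ?(leq_trans kj)// (leq_trans fk)// (leq_trans kj).
apply/idP/idP => [fj|pj].
  have := nth_find 0%N hp; rewrite nth_iota// add0n /p => /lt_le_trans; apply.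
  exact: tail_prod_mono.
rewrite ltnS leqNgt; apply/negP => /(before_find 0%N).
by rewrite nth_iota// add0n /p pj.
Qed.

Lemma paint_label_nonrecord m : ~~ r m -> (paint_label v m < nrecords r m)%N.
Proof.
move=> rm; rewrite paint_label_lt /threshold (negbTE rm) tail_prod_ge//.
by case/andP: (v01 m).
Qed.

Lemma paint_label_nclasses m : nclasses (paint_label v) m = nrecords r m.
Proof.
elim: m => [|m IH]; first by rewrite /nrecords big_ord0.
rewrite nclassesS nrecordsS /is_record IH; congr (_ + _)%N; congr nat_of_bool.
case rm: (r m); first by rewrite /paint_label rm eqxx.
by rewrite ltn_eqF// paint_label_nonrecord// rm.
Qed.

Lemma paint_label_record : is_record (paint_label v) = r.
Proof.
apply/funext => m; rewrite /is_record paint_label_nclasses.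
case rm: (r m); first by rewrite /paint_label rm eqxx.
by rewrite ltn_eqF// paint_label_nonrecord// rm.
Qed.

Lemma paint_label_growing n : growing (paint_label v) n.
Proof.
move=> m _; rewrite paint_label_nclasses.
case rm: (r m); first by rewrite /paint_label rm.
by apply: ltnW; rewrite paint_label_nonrecord// rm.
Qed.

Lemma paint_label_eq m c : (paint_label v m == c) =
  (threshold m c <= v m < threshold m c.+1).
Proof. by rewrite leNgt -!paint_label_lt -leqNgt ltnS andbC -eqn_leq. Qed.

End PaintBox.

(** * Exponents of the sticks and the telescoping of Beta moments *)

Section JoinCounts.
Context (R : realType).
Variables (s : nat -> nat) (r : nat -> bool) (n : nat).
Hypotheses (gs : growing s n)
  (rs : forall m, (m < n)%N -> r m = is_record s m).

(* [hits j m] and [passes j m] are the exponents of [xi j] and [1 - xi j] in the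
   probability of the labels below [m]; see [prod_paint_weights]. *)
Definition hits j m : nat := (\sum_(i < m) (~~ r i && (s i == j)))%N.

Definition passes j m : nat := (\sum_(i < m) (~~ r i && (s i < j < nrecords r i)))%N.

Definition below j m : nat := (\sum_(i < m) (s i < j))%N.

Let nrE m : (m <= n)%N -> nclasses s m = nrecords r m.
Proof.
move=> mn; rewrite nclasses_records; apply: eq_nrecords => i im.
by rewrite rs// (leq_trans im).
Qed.

Let s_record m : (m < n)%N -> r m -> s m = nrecords r m.
Proof. by move=> mn; rewrite rs// => /eqP ->; rewrite nrE// ltnW. Qed.

Let s_nonrecord m : (m < n)%N -> ~~ r m -> (s m < nrecords r m)%N.
Proof.
by move=> mn; rewrite rs// => rm; rewrite ltn_neqAle -nrE ?(ltnW mn)// rm gs.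
Qed.

Lemma class_size_hits j m : (m <= n)%N ->
  class_size s j m = (hits j m + (j < nrecords r m))%N.
Proof.
elim: m => [_|m IH mn]; first by rewrite /class_size /hits /nrecords !big_ord0.
rewrite /class_size /hits !big_ord_recr/= -/(class_size s j m) -/(hits j m) nrecordsS.
rewrite IH ?(ltnW mn)//; case rm: (r m) => /=; last by lia.
by rewrite s_record//; lia.
Qed.

Lemma below_all j m : (m <= n)%N -> (nrecords r m <= j)%N ->
  below j m = m /\ passes j m = 0%N.
Proof.
elim: m => [_ _|m IH mn]; first by rewrite /below /passes !big_ord0.
rewrite nrecordsS => kj; rewrite /below /passes !big_ord_recr/= -/(below j m) -/(passes j m).
have [-> ->] := IH (ltnW mn) (leq_trans (leq_addr _ _) kj).
case rm: (r m) kj => /= kj; first by rewrite s_record//; lia.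
have sk := s_nonrecord mn (negbT rm); lia.
Qed.

(** Let [i] be the record that opens class [j]. The [i] earlier elements all have labels below [j];
    a later one with a label below [j] is a non-record that passes class [j]. *)
Lemma below_passes i m : (i < m <= n)%N -> r i ->
  below (nrecords r i) m = (i + passes (nrecords r i) m)%N.
Proof.
move=> /andP[+ +] ri; elim: m => [//|m IH]; rewrite ltnS leq_eqVlt => im mn.
rewrite /below /passes !big_ord_recr/= -/(below _ m) -/(passes _ m).
move: im => /orP[/eqP im|im].
  rewrite -im in mn *.
  have [-> ->] := below_all (ltnW mn) (leqnn (nrecords r i)).
  by rewrite s_record// ri; lia.
rewrite IH ?(ltnW mn)//; have ki := nrecords_lt ri im.
case rm: (r m) => /=; first by rewrite s_record//; lia.
by rewrite ki; lia.
Qed.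

Lemma belowS j m : below j.+1 m = (below j m + class_size s j m)%N.
Proof.
rewrite /below /class_size -big_split; apply: eq_bigr => i _ /=; lia.
Qed.

Lemma prod_block (F G : nat -> R) c k N : (c < k <= N)%N ->
  \prod_(j < N) (if (j : nat) == c then F j else if (c < j < k)%N then G j else 1) =
  F c * \prod_(c.+1 <= j < k) G j.
Proof.
move=> /andP[ck kN].
rewrite -(big_mkord xpredT (fun j => if j == c then F j else if (c < j < k)%N then G j else 1)).
rewrite (big_cat_nat (leq0n k) kN)/=.
rewrite [X in _ * X]big1_seq ?mulr1; last first.
  move=> j /andP[_]; rewrite mem_index_iota => /andP[kj _].
  by rewrite gtn_eqF ?(leq_trans ck)// ltnNge kj andbF.
rewrite (big_cat_nat (leq0n c) (ltnW ck))/=.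
rewrite [X in X * _]big1_seq ?mul1r; last first.
  move=> j /andP[_]; rewrite mem_index_iota => /andP[_ jc].
  by rewrite ltn_eqF// ltnNge (ltnW jc).
rewrite big_ltn// eqxx; congr (_ * _); apply: eq_big_nat => j /andP[cj jk].
by rewrite gtn_eqF// cj jk.
Qed.

(** Regrouping the factors by stick instead of by element puts each stick in a factor of its own,
    ready for independence. The range [n] serves all [m], with exponents 0 for classes not yet
    open. *)
Lemma prod_paint_weights (xi : nat -> R) m : (m <= n)%N ->
  \prod_(i < m) (if r i then 1 else xi (s i) * tail_prod xi (s i).+1 (nrecords r i)) =
  \prod_(j < n) (xi j ^+ hits j m * (1 - xi j) ^+ passes j m).
Proof.
elim: m => [_|m IH mn].
  by rewrite big_ord0 big1// => j _; rewrite /hits /passes !big_ord0 !expr0 mulr1.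
rewrite big_ord_recr/= IH ?(ltnW mn)//.
transitivity (\prod_(j < n) ((xi j ^+ hits j m * (1 - xi j) ^+ passes j m) *
    (if r m then 1 else if (j : nat) == s m then xi j else
     if (s m < j < nrecords r m)%N then 1 - xi j else 1))); last first.
  apply: eq_bigr => j _; rewrite /hits /passes !big_ord_recr/= -/(hits j m) -/(passes j m).
  case rm: (r m) => /=; first by rewrite !addn0 mulr1.
  rewrite !exprD; case: eqVneq => [->|/negbTE sj].
    by rewrite ltnn expr0 expr1 mulr1 mulrAC.
  rewrite expr0 mulr1 -mulrA; congr (_ * (_ * _)).
  by case: (_ && _).
rewrite [RHS]big_split; congr (_ * _); case rm: (r m); first by rewrite big1.
rewrite (@prod_block xi (fun j => 1 - xi j))// s_nonrecord ?rm//.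
exact: leq_trans (nrecords_le r m) (ltnW mn).
Qed.

Variable alpha : R.
Hypothesis alpha1 : alpha < 1.

(** The mean of [xi_j ^ hits * (1 - xi_j) ^ passes]. The value 1 covers stick 0, which is constantly
    1 and never passed, and classes not open before [n], whose exponents are 0. *)
Definition beta_moment j m : R :=
  let b := fine (pattern_record R r j) - j%:R * alpha - 1 in
  if (0 < j < nrecords r n)%N then
    real_beta_fun (1 - alpha + (hits j m)%:R) (b + (passes j m)%:R) /
    real_beta_fun (1 - alpha) b
  else 1.

(** The sum of size minus [alpha] over the classes before [j]. By [param], for an open class it is
    the updated second Beta parameter of stick [j], and [sigma j.+1 m] is the sum of both updated
    parameters. *)
Let sigma j m : R := (below j m)%:R - j%:R * alpha.

Let sigma_gt0 j m : (0 < j <= nrecords r m)%N -> (m <= n)%N -> 0 < sigma j m.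
Proof.
move=> /andP[j0 jk] mn; have jb : (j <= below j m)%N.
  move: jk; rewrite leq_eqVlt => /orP[/eqP jk|/nrecords_ex[i [im ri <-]]].
    have [-> _] := below_all mn (eq_leq (esym jk)).
    by rewrite jk nrecords_le.
  by rewrite below_passes ?im//; apply: leq_trans (nrecords_le _ _) (leq_addr _ _).
rewrite subr_gt0; apply: (@lt_le_trans _ _ j%:R); last by rewrite ler_nat.
by rewrite gtr_pMr// ltr0n.
Qed.

Let param j m : (j < nrecords r m)%N -> (m <= n)%N ->
  [/\ fine (pattern_record R r j) - j%:R * alpha - 1 + (passes j m)%:R = sigma j m,
      1 - alpha + (hits j m)%:R = (class_size s j m)%:R - alpha
    & 1 - alpha + (hits j m)%:R + sigma j m = sigma j.+1 m].
Proof.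
move=> jk mn; have [i [im ri ij]] := nrecords_ex jk.
have h1 : 1 - alpha + (hits j m)%:R = (class_size s j m)%:R - alpha.
  by rewrite class_size_hits// jk addn1 -natr1; ring.
split => //.
  have := @below_passes i m; rewrite im mn ij /sigma => ->//.
  by rewrite -ij pattern_recordE// ij natrD -natr1/=; ring.
rewrite h1 /sigma belowS natrD -natr1; ring.
Qed.

Let param_gt0 j : (0 < j < nrecords r n)%N ->
  0 < fine (pattern_record R r j) - j%:R * alpha - 1.
Proof.
move=> /andP[j0 jk]; have [i [im ri ij]] := nrecords_ex jk.
rewrite -ij pattern_recordE// ij; apply: beta_param_gt0 => //.
by rewrite j0 ltnS -ij nrecords_le.
Qed.

Let size_gt j m : (j < nrecords r m)%N -> (m <= n)%N -> 0 < (class_size s j m)%:R - alpha.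
Proof.
move=> jk mn; rewrite class_size_hits// jk addn1 -natr1.
have h0 : 0 <= (hits j m)%:R :> R by [].
have a1 := alpha1; lra.
Qed.

(* Integrating out the stick [j] is a Beta update: the sums [sigma] of the Beta
   parameters telescope over the passed classes, which leaves the Gibbs
   prediction weight. *)
Lemma beta_moment_step j m (mn : (m < n)%N) : ~~ r m ->
  beta_moment j m.+1 = beta_moment j m *
   (if j == s m then ((class_size s j m)%:R - alpha) / sigma j.+1 m
    else if (s m < j < nrecords r m)%N then sigma j m / sigma j.+1 m else 1).
Proof.
move=> rm; have sk := s_nonrecord mn rm.
have kK : (nrecords r m <= nrecords r n)%N by apply: nrecords_mono; exact: ltnW.
have mn' := ltnW mn.
have hS : hits j m.+1 = (hits j m + (s m == j))%N by rewrite /hits big_ord_recr/= rm.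
have pS : passes j m.+1 = (passes j m + (s m < j < nrecords r m))%N.
  by rewrite /passes big_ord_recr/= rm.
have a0 : 0 < 1 - alpha by rewrite subr_gt0.
rewrite /beta_moment hS pS; case: ifPn => [jK|jK]; last first.
  (* A hit outside the Beta range is a hit of the oldest class. No class precedes it, so [sigma 1 m]
     is its size minus [alpha] and the factor is 1. *)
  have [js|js] := eqVneq j (s m).
    have j0 : j = 0%N by move: jK; rewrite js; lia.
    have [_ h1 h2] := param (leq_ltn_trans (leq0n _) sk) mn'.
    rewrite j0 mul1r -h2 h1 /sigma /below mul0r subr0 big1// addr0 divff// gt_eqF//.
    by rewrite size_gt// (leq_ltn_trans _ sk).
  by case: ifPn => [jj|]; rewrite ?mulr1//; move: jK jj; lia.
have b0 := param_gt0 jK.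
have aD : 0 < 1 - alpha + (hits j m)%:R by rewrite ltr_pwDl.
have bD : 0 < fine (pattern_record R r j) - j%:R * alpha - 1 + (passes j m)%:R.
  by rewrite ltr_pwDl.
have [js|js] := eqVneq j (s m).
  have jk : (j < nrecords r m)%N by rewrite js.
  have [p1 h1 h2] := param jk mn'.
  rewrite js ltnn/= addn0 -js natrD addrA real_beta_funDl// p1 h2 h1.
  ring.
rewrite addn0; case: ifPn => jk; last by rewrite addn0 mulr1.
have [p1 h1 h2] := param (proj2 (andP jk)) mn'.
rewrite natrD addrA real_beta_funDr// p1 h2.
ring.
Qed.

Lemma prod_beta_moment m : (m <= n)%N ->
  \prod_(j < n) beta_moment j m = prediction_weight alpha s m.
Proof.
elim: m => [_|m IH mn].
  rewrite /prediction_weight big_ord0 big1// => j _; rewrite /beta_moment.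
  case: ifPn => // jK; rewrite /hits /passes !big_ord0 !addr0 divff//.
  by rewrite gt_eqF//; apply: real_beta_fun_gt0; [rewrite subr_gt0|exact: param_gt0].
rewrite prediction_weightS -IH ?(ltnW mn)// -rs//; case rm: (r m).
  rewrite mulr1; apply: eq_bigr => j _.
  by rewrite /beta_moment /hits /passes !big_ord_recr/= rm !addn0.
have rmN := negbT rm; have sk := s_nonrecord mn rmN.
under eq_bigr do rewrite beta_moment_step//.
rewrite big_split; congr (_ * _) => /=.
rewrite (@prod_block (fun j => ((class_size s j m)%:R - alpha) / sigma j.+1 m)
  (fun j => sigma j m / sigma j.+1 m)); last first.
  by rewrite sk (leq_trans (nrecords_le r m) (ltnW mn)).
(* The remaining numerator cancels the denominator of the hit factor. The remaining denominator, at
   [k] open classes, is [m - alpha k], since all [m] elements lie in classes before [k]. *)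
have T : \prod_((s m).+1 <= j < nrecords r m) (sigma j m / sigma j.+1 m) =
    sigma (s m).+1 m / sigma (nrecords r m) m.
  have pos j : ((s m).+1 <= j <= nrecords r m)%N -> sigma j m != 0.
    by move=> /andP[sj jk]; rewrite gt_eqF// sigma_gt0 ?(ltnW mn)//; lia.
  rewrite -[LHS]invrK -prodfV; under eq_bigr do rewrite invf_div.
  have [E|sk'] := eqVneq (s m).+1 (nrecords r m).
    by rewrite -E big_geq// invr1 divff// E pos// leqnn sk.
  rewrite telescope_prodf ?invf_div//; last by rewrite ltn_neqAle sk' sk.
  by move=> j /andP[sj jk]; apply: pos; rewrite (ltnW jk) (leq_trans _ sj).
rewrite T nrE ?(ltnW mn)//.
have -> : m%:R - alpha * (nrecords r m)%:R = sigma (nrecords r m) m.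
  by have [+ _] := below_all (ltnW mn) (leqnn (nrecords r m)); rewrite /sigma => ->; ring.
have p1 : sigma (s m).+1 m != 0 by rewrite gt_eqF// sigma_gt0 ?(ltnW mn).
by rewrite mulrA divfK.
Qed.

End JoinCounts.

Section ModelLaw.
Context {R : realType}.
Local Notation U := (uniform_prob (@ltr01 R)).
Variables (alpha : R) (u : nat -> R -> R).
Hypotheses (alpha1 : alpha < 1) (iid : iid_uniform u).

Lemma uniform_prob_itv (a b : R) : 0 <= a -> a <= b -> b <= 1 ->
  U `[a, b[%classic = (b - a)%:E.
Proof.
move=> a0 ab b1; rewrite [LHS]uniform_prob_sub//.
  rewrite lebesgue_measure_itv/= lte_fin; case: ltP => h; first by rewrite EFinB.
  by rewrite (@le_anti _ _ a b) ?ab// subrr.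
move=> x /=; rewrite !in_itv/= => /andP[ax xb].
by rewrite (le_trans a0 ax) (ltW (lt_le_trans xb b1)).
Qed.

Definition pattern_stick (r : nat -> bool) (x : R) (j : nat) : R :=
  stick alpha j (pattern_record R r j) (u j x).

Definition model_label (r : nat -> bool) (x y : R) : nat -> nat :=
  paint_label r (pattern_stick r x) (fun m => u m y).

Lemma pattern_stick0 r x : pattern_stick r x 0 = 1.
Proof. by []. Qed.

Lemma pattern_stick01 r x j : 0 <= pattern_stick r x j <= 1.
Proof. exact: stick01. Qed.

Section FixedPrefix.
Variables (s : nat -> nat) (r : nat -> bool) (n : nat).
Hypotheses (r0 : r 0%N) (gs : growing s n)
  (rs : forall m, (m < n)%N -> r m = is_record s m).

(** For fixed sticks the prefix says that each [u m y] lies in an interval between two consecutive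
    thresholds. Its length is 1 at a record and otherwise, by [tail_prodS], the stick-breaking
    weight. *)
Lemma paint_prefix_prob (xi : nat -> R) :
  xi 0%N = 1 -> (forall j, 0 <= xi j <= 1) ->
  U [set y | forall m, (m < n)%N -> paint_label r xi (fun i => u i y) m = s m] =
  (\prod_(m < n) (if r m then 1 else
     xi (s m) * tail_prod xi (s m).+1 (nrecords r m)))%:E.
Proof.
move=> xi0 xi01; have [mu u01 uprod] := iid.
pose I m : set R := `[threshold r xi m (s m), threshold r xi m (s m).+1[%classic.
have mI m : measurable (u m @^-1` I m).
  by rewrite -[X in measurable X]setTI; apply: (mu m) => //; exact: measurable_itv.
have E m y : (m < n)%N -> (paint_label r xi (fun i => u i y) m = s m) <-> I m (u m y).
  move=> mn; rewrite /I /= in_itv/= -(@paint_label_eq _ _ _ r0 xi0 xi01 (fun i => u i y))//.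
  by split => [->|/eqP].
have -> : [set y | forall m, (m < n)%N -> paint_label r xi (fun i => u i y) m = s m] =
    \bigcap_(m in [set m | (m < n)%N]) (u m @^-1` I m).
  by apply/seteqP; split => y H m mn; [apply/E => //; exact: H|apply/E => //; exact: H].
transitivity (\int[U]_y (\prod_(m < n) \1_(I m) (u m y))%:E)%E.
  transitivity (\int[U]_y (\1_(\bigcap_(m in [set m | (m < n)%N]) (u m @^-1` I m)) y)%:E)%E.
    rewrite integral_indic//; last by apply: bigcap_measurableType => m _; exact: mI.
    by congr (U _); rewrite setIT.
  apply: eq_integral => y _; congr (_%:E); rewrite indicE.
  under eq_bigr do rewrite indicE; rewrite prod_natr_bool; congr (_%:R); congr nat_of_bool.
  apply/idP/allP => [|H].
    by rewrite inE => H m _; rewrite inE; exact: (H m (ltn_ord m)).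
  rewrite inE => m mn; have := H (Ordinal mn) (mem_index_enum _); by rewrite inE.
rewrite (uprod n (fun m => \1_(I m)))//; last first.
  by move=> m; apply: measurable_indic; exact: measurable_itv.
rewrite -prodEFin; apply: eq_bigr => m _.
rewrite integral_indic//; last exact: measurable_itv.
rewrite [LHS](_ : _ = U (I m)); last by congr (U _); rewrite setIT.
have mn := ltn_ord m; have nr : nclasses s m = nrecords r m.
  rewrite nclasses_records; apply: eq_nrecords => i im.
  by rewrite rs// (ltn_trans im).
have tle : threshold r xi m (s m) <= threshold r xi m (s m).+1.
  rewrite /threshold; case: ifP => _; last exact: tail_prod_mono.
  by rewrite ler_nat; lia.
rewrite uniform_prob_itv//; [|by case/andP: (threshold01 r xi01 m (s m))
                           |by case/andP: (threshold01 r xi01 m (s m).+1)].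
congr (_%:E); rewrite /threshold; case rm: (r m).
  have sm : s m = nrecords r m by rewrite -nr; apply/eqP; rewrite -/(is_record s m) -rs.
  by rewrite sm ltnSn ltnn subr0.
have sk : (s m < nrecords r m)%N.
  by rewrite ltn_neqAle -nr gs// andbT; rewrite rs// in rm; rewrite /is_record in rm; rewrite rm.
rewrite (tail_prodS xi sk); ring.
Qed.

Lemma moment_pattern_stick j : (j < n)%N ->
  (\int[U]_x (stick alpha j (pattern_record R r j) x ^+ hits s r j n *
    (1 - stick alpha j (pattern_record R r j) x) ^+ passes s r j n)%:E =
  (beta_moment s r n alpha j n)%:E)%E.
Proof.
move=> jn; have one : (\int[U]_x (1 : R)%:E = 1)%E.
  by rewrite integral_cst// mul1e; exact: probability_setT.
rewrite /beta_moment; case: ifPn => [/andP[j0 jK]|]; last first.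
  rewrite negb_and -leqNgt leqn0 -leqNgt => jK.
  rewrite -one; apply: eq_integral => x _; congr (_%:E).
  have [->|j0] := eqVneq j 0%N.
    have -> : passes s r 0 n = 0%N by rewrite /passes big1// => i _; rewrite ltn0 andbF.
    by rewrite /stick eqxx expr1n expr0 mulr1.
  rewrite (negbTE j0)/= in jK.
  have [b1 ->] := below_all gs rs (leqnn n) jK.
  have [b2 _] := below_all gs rs (leqnn n) (leqW jK).
  have := class_size_hits rs j (leqnn n); have := belowS s j n.
  rewrite b1 b2 ltnNge jK => /eqP; rewrite -{1}[n]addn0 eqn_add2l addn0 => /eqP <- <-.
  by rewrite !expr0 mulr1.
have [i [iln ri ij]] := nrecords_ex jK.
have pE : pattern_record R r j = (i.+1%:R)%:E by rewrite -ij pattern_recordE.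
have ji : (j < i.+1)%N by rewrite -ij ltnS nrecords_le.
have b0 : 0 < i.+1%:R - j%:R * alpha - 1 by rewrite beta_param_gt0// j0.
have a0 : 0 < 1 - alpha by rewrite subr_gt0.
rewrite pE/= -(beta_quantile_moment a0 b0).
apply: eq_integral => x _; rewrite /stick gtn_eqF// asboolT//; by exists i.+1.
Qed.

(** The inner measure is the probability given the sticks; integrating over [x] factors into Beta
    moments. Only the values of [r] below [n] are fixed, so the result is the same for every full
    record pattern with this beginning. *)
Lemma model_prefix_weight :
  (\int[U]_x U [set y | forall m, (m < n)%N -> model_label r x y m = s m] =
   (prediction_weight alpha s n)%:E)%E.
Proof.
have [mu u01 uprod] := iid.
have E x : U [set y | forall m, (m < n)%N -> model_label r x y m = s m] =
    (\prod_(j < n) (pattern_stick r x j ^+ hits s r j n *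
       (1 - pattern_stick r x j) ^+ passes s r j n))%:E.
  rewrite (paint_prefix_prob (pattern_stick0 r x) (pattern_stick01 r x)).
  by rewrite (prod_paint_weights gs rs _ (leqnn n)).
under eq_integral do rewrite E.
rewrite (uprod n (fun j v => stick alpha j (pattern_record R r j) v ^+ hits s r j n *
   (1 - stick alpha j (pattern_record R r j) v) ^+ passes s r j n)); first last.
- move=> j v; have /andP[v0 v1] := stick01 alpha j (pattern_record R r j) v.
  by rewrite mulr_ge0// exprn_ge0// subr_ge0.
- move=> j; have ms := measurableT_comp (measurable_stick alpha1 j)
    (@measurable_pair1 _ _ _ _ (pattern_record R r j)).
  apply: measurable_funM; first exact: measurable_funX.
  by apply: measurable_funX; apply: measurable_funB.
rewrite -(prod_beta_moment gs rs alpha1 (leqnn n)) -prodEFin.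
by apply: eq_bigr => j _; rewrite moment_pattern_stick.
Qed.

End FixedPrefix.
End ModelLaw.

(** * Almost sure limits of the resampled frequencies *)

Section Averages.
Context {R : realType}.

Definition average (f : nat -> R) (n : nat) : R := n%:R^-1 * \sum_(m < n) f m.

Lemma average_cvg (f : nat -> R) (l : R) :
  f n @[n --> \oo] --> l -> average f n @[n --> \oo] --> l.
Proof.
move=> /cesaro; rewrite -(cvg_shiftS (average f)); apply: cvg_trans; apply: near_eq_cvg.
by apply: nearW => n; rewrite /average /arithmetic_mean /series/= big_mkord.
Qed.

Lemma averageD f g n : average (fun m => f m + g m) n = average f n + average g n.
Proof. by rewrite /average big_split/= mulrDr. Qed.

Lemma averageN f n : average (fun m => - f m) n = - average f n.
Proof. by rewrite /average sumrN mulrN. Qed.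

Lemma le_average f g n : (forall m, f m <= g m) -> average f n <= average g n.
Proof. by move=> fg; rewrite ler_wpM2l ?invr_ge0//; apply: ler_sum. Qed.

Lemma cvg_bounded_average (f : nat -> R) (b : R) : (forall m, 0 <= f m) ->
  (forall n, \sum_(m < n) f m <= b) -> average f n @[n --> \oo] --> (0 : R).
Proof.
move=> f0 fb; have c : b * n%:R^-1 @[n --> \oo] --> (0 : R).
  rewrite -[X in _ --> X](mulr0 b); apply: cvgMr.
  rewrite -(cvg_shiftS (fun n => n%:R^-1 : R)); exact: cvg_harmonic.
apply: (@squeeze_cvgr _ _ _ _ (cst 0) (fun n => b * n%:R^-1)) => //; last exact: cvg_cst.
apply: nearW => n; rewrite /average; apply/andP; split.
  by rewrite mulr_ge0 ?invr_ge0// sumr_ge0.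
by rewrite mulrC ler_wpM2r// invr_ge0.
Qed.

End Averages.

Section PaintBoxLimits.
Context {R : realType}.
Variables (r : nat -> bool) (xi : nat -> R).
Hypotheses (xi01 : forall j, 0 <= xi j <= 1)
  (xi_absent : forall j, (forall m, r m -> nrecords r m <> j) -> xi j = 0).

Lemma tail_prod_cvg j : tail_prod xi j k @[k --> \oo] --> limn (tail_prod xi j).
Proof.
apply: nonincreasing_is_cvgn; last first.
  by exists 0 => _ [k _ <-]; case/andP: (tail_prod01 xi01 j k).
apply/nonincreasing_seqP => k; have [jk|kj] := leqP j k.
  rewrite {1}/tail_prod big_nat_recr//= ler_piMr//.
    by case/andP: (tail_prod01 xi01 j k).
  by rewrite gerBl; case/andP: (xi01 k).
by rewrite !tail_prod_ge// ltnW.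
Qed.

Lemma tail_prod_lim_rec j :
  limn (tail_prod xi j) = (1 - xi j) * limn (tail_prod xi j.+1).
Proof.
apply/cvg_lim => //.
have H : (1 - xi j) * tail_prod xi j.+1 k @[k --> \oo] --> (1 - xi j) * limn (tail_prod xi j.+1).
  by apply: cvgMr; exact: tail_prod_cvg.
apply: cvg_trans H; apply: near_eq_cvg.
by near=> k; rewrite [RHS]tail_prodS//; near: k; exact: nbhs_infty_gt.
Unshelve. all: by end_near. Qed.

(** If the number of records is unbounded, it runs to infinity along the products. Otherwise it
    stops at some [k], the sticks from [k] on are 0 by [xi_absent], and the products are constant
    from there. *)
Lemma tail_prod_records_cvg j :
  tail_prod xi j (nrecords r m) @[m --> \oo] --> limn (tail_prod xi j).
Proof.
have [H|/existsNP[K HK]] := pselect (forall k, exists m, (k < nrecords r m)%N).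
  apply/cvgrPdist_lt => e e0.
  have /cvgrPdist_lt/(_ e e0)[N _ HN] := @tail_prod_cvg j.
  have [M NM] := H N; exists M => // m /= Mm; apply: HN => /=.
  exact: leq_trans (ltnW NM) (nrecords_mono r Mm).
have Kb m : (nrecords r m <= K)%N.
  by rewrite leqNgt; apply/negP => ?; apply: HK; exists m.
have exK : exists K, `[< forall m, (nrecords r m <= K)%N >] by exists K; exact/asboolP.
case: (ex_minnP exK) => k /asboolP kb kmin.
have [M Mk] : exists M, nrecords r M = k.
  case: k kb kmin => [|k] kb kmin.
    by exists 0%N; apply/eqP; rewrite -leqn0.
  apply: contrapT => H; suff : (k.+1 <= k)%N by rewrite ltnn.
  apply: kmin; apply/asboolP => m; have := kb m; rewrite leq_eqVlt ltnS => /orP[/eqP mk|//].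
  by exfalso; apply: H; exists m.
have xik l : (k <= l)%N -> xi l = 0.
  move=> kl; apply: xi_absent => m rm ml; have := kb m.+1.
  by rewrite nrecordsS rm ml addn1 ltnNge kl.
have const K' : (k <= K')%N -> tail_prod xi j K' = tail_prod xi j k.
  elim: K' => [|i IH]; first by rewrite leqn0 => /eqP->.
  rewrite leq_eqVlt => /orP[/eqP->//|]; rewrite ltnS => ki.
  rewrite -IH//; have [ji|ij] := leqP j i.
    by rewrite /tail_prod big_nat_recr//= xik// subr0 mulr1.
  by rewrite !tail_prod_ge// ltnW.
have -> : limn (tail_prod xi j) = tail_prod xi j k.
  apply/cvg_lim => //.
  apply: (@cvg_trans _ (cst (tail_prod xi j k) @ \oo)); last exact: cvg_cst.
  by apply: near_eq_cvg; exists k => // i /= ki; rewrite const.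
apply: (@cvg_trans _ (cst (tail_prod xi j k) @ \oo)); last exact: cvg_cst.
apply: near_eq_cvg; exists M => // i /= Mi; rewrite const//.
by rewrite -Mk nrecords_mono.
Qed.

Lemma few_early_records j n :
  (\sum_(m < n) (r m && (nrecords r m < j)) <= j)%N.
Proof.
suff -> : (\sum_(m < n) (r m && (nrecords r m < j)))%N = minn j (nrecords r n).
  exact: geq_minl.
elim: n => [|n IH]; first by rewrite /nrecords !big_ord0 minn0.
rewrite big_ord_recr/= IH nrecordsS; case: (r n) => /=; last by rewrite !addn0.
by case: (ltnP (nrecords r n) j); lia.
Qed.

(* At a record the threshold is 0 or 1 instead of the tail product. Records do
   not count in the average if they have density 0, and otherwise all
   thresholds but finitely many are at most the tail product, which tends to 0. *)
Lemma average_threshold_cvg j :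
  ((nrecords r n)%:R / n%:R @[n --> \oo] --> (0 : R)) \/ limn (tail_prod xi j) = 0 ->
  average (fun m => threshold r xi m j) n @[n --> \oo] --> limn (tail_prod xi j).
Proof.
have ct := average_cvg (@tail_prod_records_cvg j).
set t := fun m => tail_prod xi j (nrecords r m) in ct.
have t01 m : 0 <= t m <= 1 by exact: tail_prod01.
case=> [K0|tau0].
  have ravg n : average (fun m => (r m)%:R) n = (nrecords r n)%:R / n%:R.
    by rewrite /average /nrecords natr_sum mulrC.
  pose lo n := average t n - (nrecords r n)%:R / n%:R.
  pose hi n := average t n + (nrecords r n)%:R / n%:R.
  apply: (@squeeze_cvgr _ _ _ _ lo hi).
  - apply: nearW => n; rewrite /lo /hi -ravg -averageN -!averageD.
    apply/andP; split; apply: le_average => m; rewrite /threshold;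
    have := t01 m; rewrite /t; case: (r m) => /andP[? ?];
    by case: (nrecords r m < j)%N => /=; lra.
  - by rewrite -[X in _ --> X]subr0; apply: cvgB.
  - by rewrite -[X in _ --> X]addr0; apply: cvgD.
rewrite tau0 in ct *.
pose hi n := average t n + average (fun m => (r m && (nrecords r m < j)%N)%:R) n.
apply: (@squeeze_cvgr _ _ _ _ (cst 0) hi).
- apply: nearW => n; rewrite /hi -averageD; apply/andP; split.
    rewrite /average mulr_ge0 ?invr_ge0// sumr_ge0// => m _.
    by case/andP: (threshold01 r xi01 m j).
  apply: le_average => m; rewrite /threshold; have /andP[t0 _] := t01 m.
  by case: (r m) => /=; rewrite ?addr0// ler_wpDl.
- exact: cvg_cst.
- rewrite -[X in _ --> X]addr0; apply: cvgD => //.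
  apply: (@cvg_bounded_average _ _ j%:R) => [m|n]; first by [].
  by rewrite -natr_sum ler_nat few_early_records.
Qed.

End PaintBoxLimits.

Section PaintFrequencies.
Context {R : realType}.
Variables (r : nat -> bool) (xi v : nat -> R).
Hypotheses (r0 : r 0%N) (xi0 : xi 0%N = 1) (xi01 : forall j, 0 <= xi j <= 1)
  (xi_absent : forall j, (forall m, r m -> nrecords r m <> j) -> xi j = 0)
  (v01 : forall m, 0 <= v m < 1)
  (slln : forall j, n%:R^-1 * (\sum_(m < n) ((v m < threshold r xi m j)%R%:R
     - threshold r xi m j)) @[n --> \oo] --> (0 : R))
  (dich : forall j, ((nrecords r n)%:R / n%:R @[n --> \oo] --> (0 : R)) \/
     limn (tail_prod xi j) = 0).

Lemma paint_below_cvg j :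
  average (fun m => (paint_label r xi v m < j)%N%:R) n @[n --> \oo] -->
  limn (tail_prod xi j).
Proof.
have H : n%:R^-1 * (\sum_(m < n) ((v m < threshold r xi m j)%R%:R
     - threshold r xi m j)) + average (fun m => threshold r xi m j) n @[n --> \oo] -->
    0 + limn (tail_prod xi j).
  by apply: cvgD; [exact: slln|exact: average_threshold_cvg].
rewrite add0r in H; apply: cvg_trans H; apply: near_eq_cvg; apply: nearW => n.
rewrite /average -mulrDr -big_split/=; congr (_ * _).
by apply: eq_bigr => m _; rewrite paint_label_lt// subrK.
Qed.

(** The labels below [j] have density the limit of [tail_prod xi j]. By [tail_prod_lim_rec] the
    difference of two consecutive such limits is the residual product. *)
Lemma paint_frequency j :
  label_frequency R (paint_label r xi v) j = residual_products xi j.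
Proof.
rewrite /label_frequency; apply/cvg_lim => //.
have -> : residual_products xi j = limn (tail_prod xi j.+1) - limn (tail_prod xi j).
  rewrite (tail_prod_lim_rec xi01 j) /residual_products -/(tail_prod xi j.+1); ring.
have H : average (fun m => (paint_label r xi v m < j.+1)%N%:R) n -
    average (fun m => (paint_label r xi v m < j)%N%:R) n @[n --> \oo] -->
    limn (tail_prod xi j.+1) - limn (tail_prod xi j).
  by apply: cvgB; exact: paint_below_cvg.
apply: cvg_trans H; apply: near_eq_cvg; apply: nearW => n.
rewrite -averageN -averageD /average mulrC /class_size natr_sum; congr (_ * _).
apply: eq_bigr => m _; rewrite ltnS leq_eqVlt.
by case: ltngtP => _ /=; rewrite ?subrr ?subr0.
Qed.

End PaintFrequencies.

Section ModelFrequencies.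
Context {R : realType}.
Local Notation U := (uniform_prob (@ltr01 R)).
Variables (alpha : R) (u : nat -> R -> R).
Hypotheses (alpha1 : alpha < 1) (iid : iid_uniform u).

Lemma null_bigcup (N : nat -> set R) :
  (forall k, measurable (N k)) -> (forall k, U (N k) = 0%E) ->
  measurable (\bigcup_k N k) /\ U (\bigcup_k N k) = 0%E.
Proof.
move=> mN N0; have mU : measurable (\bigcup_k N k) by exact: bigcupT_measurable.
split => //; apply/eqP; rewrite eq_le measure_ge0 andbT.
apply: (le_trans (measure_sigma_subadditive _ _ _ (@subset_refl _ _))) => //.
by rewrite eseries0// => k _ _; exact: N0.
Qed.

Variable r : nat -> bool.
Hypothesis r0 : r 0%N.

Lemma pattern_stick_absent x j :
  (forall m, r m -> nrecords r m <> j) -> pattern_stick alpha u r x j = 0.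
Proof.
move=> H; have j0 : j != 0%N.
  by apply/eqP => j0; apply: (H 0%N) => //; rewrite j0 /nrecords big_ord0.
rewrite /pattern_stick pattern_recordNE// /stick (negbTE j0) asboolF//.
by move=> -[].
Qed.

Lemma stick_mean_compl m : r m ->
  (\int[U]_x (1 - stick alpha (nrecords r m) (pattern_record R r (nrecords r m)) x)%:E =
   ((m%:R - (nrecords r m)%:R * alpha) /
     (m%:R + 1 - (nrecords r m).+1%:R * alpha))%:E)%E.
Proof.
move=> rm; rewrite pattern_recordE//; have jm : (nrecords r m <= m)%N by exact: nrecords_le.
have jz : nrecords r m = 0%N -> m = 0%N.
  by move=> jz; apply: (nrecords_inj rm r0); rewrite jz /nrecords big_ord0.
move: (nrecords r m) jm jz => j jm jz.
have [j0|jn0] := eqVneq j 0%N.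
  (* The oldest class opens at position 0: the stick is 1 and both sides vanish. *)
  rewrite [RHS](_ : _ = 0%E); last by rewrite jz// j0 !mul0r subrr mul0r.
  by apply: integral0_eq => x _; rewrite j0 /stick eqxx subrr.
have j0 : (0 < j)%N by rewrite lt0n.
have a0 : 0 < 1 - alpha by rewrite subr_gt0.
have b0 : 0 < m.+1%:R - j%:R * alpha - 1 by rewrite beta_param_gt0// j0 ltnS.
transitivity (\int[U]_x (quantile (beta_law (1 - alpha) (m.+1%:R - j%:R * alpha - 1)) x ^+ 0 *
    (1 - quantile (beta_law (1 - alpha) (m.+1%:R - j%:R * alpha - 1)) x) ^+ 1)%:E)%E.
  apply: eq_integral => x _; rewrite /stick (negbTE jn0) asboolT; last by exists m.+1.
  by rewrite expr0 mul1r expr1.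
rewrite (beta_quantile_moment a0 b0) addr0 real_beta_funDr//.
rewrite mulfK ?gt_eqF ?real_beta_fun_gt0//; congr (_%:E).
by rewrite -!natr1; congr (_ / _); ring.
Qed.

(** If records do not have density 0, some fraction [e] is exceeded for infinitely many [n]. Then
    every class occurs, the means of [1 - xi_j] are the ratios above, and [prod_ratio_cvg0] makes
    their products vanish from every starting index. *)
Lemma sparse_records_or_vanishing : exists N : set R,
  [/\ measurable N, U N = 0%E & forall x, ~ N x -> forall j,
    ((nrecords r n)%:R / n%:R @[n --> \oo] --> (0 : R)) \/
    limn (tail_prod (pattern_stick alpha u r x) j) = 0].
Proof.
have [K0|nK0] := pselect ((nrecords r n)%:R / n%:R @[n --> \oo] --> (0 : R)).
  by exists set0; split => // x _ j; left.
have [e e0 He] : exists2 e : R, 0 < e &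
    forall n0, exists n, (n0 <= n)%N /\ e * n%:R <= (nrecords r n)%:R.
  apply: contrapT => H; apply: nK0; apply/cvgr0Pnorm_lt => e e0.
  have /existsNP[n0 Hn0] : ~ forall n0, exists n, (n0 <= n)%N /\ e * n%:R <= (nrecords r n)%:R.
    by move=> He; apply: H; exists e.
  exists n0.+1 => // n /= n0n; have n0' : 0 < n%:R :> R by rewrite ltr0n (leq_ltn_trans _ n0n).
  rewrite ger0_norm ?divr_ge0// ltr_pdivrMr// ltNge; apply/negP => le.
  by apply: Hn0; exists n; rewrite ltnW.
have unb j : exists m, r m /\ nrecords r m = j.
  pose n0 := (Num.trunc (j.+1%:R / e)).+1.
  have [n [n0n en]] := He n0.
  have : (j < nrecords r n)%N.
    rewrite -(ltr_nat R); apply: lt_le_trans en; rewrite -ltr_pdivrMl// mulrC.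
    apply: (@lt_le_trans _ _ n0%:R); last by rewrite ler_nat.
    apply: le_lt_trans (truncnS_gt _); rewrite ler_pM2r ?invr_gt0// ler_nat//.
  by move=> /nrecords_ex[m [_ rm mj]]; exists m.
have [a /all_and2 [ra aE]] := choice unb.
have a_inc j : (a j < a j.+1)%N.
  rewrite ltnNge; apply/negP => /(nrecords_mono r).
  by rewrite !aE ltnn.
have Ka n j : (j < nrecords r n)%N -> (a j < n)%N.
  by rewrite ltnNge => jn; rewrite ltnNge; apply: contra jn => /(nrecords_mono r); rewrite aE.
pose F j v : R := 1 - stick alpha j (pattern_record R r j) v.
have mF j : measurable_fun setT (F j).
  apply: measurable_funB; first exact: measurable_cst.
  exact: (measurableT_comp (measurable_stick alpha1 j) (@measurable_pair1 _ _ _ _ (pattern_record R r j))).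
have F01 j v : 0 <= F j v <= 1.
  have /andP[s0 s1] := stick01 alpha j (pattern_record R r j) v.
  by rewrite subr_ge0 gerBl s0 s1.
have FE j : (\int[U]_x (F j x)%:E =
    (((a j)%:R - j%:R * alpha) / ((a j)%:R + 1 - (j.+1)%:R * alpha))%:E)%E.
  by have := stick_mean_compl (ra j); rewrite aE.
have cv j0 : ((\prod_(j0 <= j < n) \int[U]_x (F j x)%:E)%E @[n --> \oo] --> 0%E).
  under eq_fun do under eq_bigr do rewrite FE.
  under eq_fun do rewrite prodEFin.
  apply/fine_cvgP; split; first exact: nearW.
  exact: (@prod_ratio_cvg0 R alpha a alpha1 a_inc (nrecords r) e j0 e0 Ka He).
have [N HN] := choice (fun j0 => ae_prod_cvg0 iid mF F01 (cv j0)).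
have [mN N0] := null_bigcup (fun j => let: And3 h _ _ := HN j in h)
  (fun j => let: And3 _ h _ := HN j in h).
exists (\bigcup_j N j); split => // x Nx j; right.
have [_ _ cvx] := HN j; apply/cvg_lim => //; apply: cvx.
by move=> Njx; apply: Nx; exists j.
Qed.

(** The null sets are nested: the one for the choices [y] depends on [x], because the thresholds are
    deterministic, as [uniform_slln] asks, only once the sticks are fixed. *)
Lemma model_frequency_ae : exists N : set R,
  [/\ measurable N, U N = 0%E & forall x, ~ N x ->
    exists M : set R, [/\ measurable M, U M = 0%E & forall y, ~ M y ->
      label_frequency R (model_label alpha u r x y) =
      residual_map alpha u (pattern_record R r) x]].
Proof.
have [N [mN N0 HN]] := sparse_records_or_vanishing; exists N; split => // x Nx.
have xi01 := pattern_stick01 alpha u r x.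
have [M HM] := choice (fun j => uniform_slln iid
   (fun m => threshold01 r xi01 m j)).
have [mM M0] := null_bigcup (fun j => let: And3 h _ _ := HM j in h)
  (fun j => let: And3 _ h _ := HM j in h).
exists (\bigcup_j M j); split => // y My; apply/funext => j.
apply: (@paint_frequency _ r (pattern_stick alpha u r x) (fun m => u m y)) => //.
- exact: pattern_stick_absent.
- by move=> m; have [_ + _] := iid; apply.
- by move=> k; have [_ _] := HM k; apply => Mky; apply: My; exists k.
- exact: HN.
Qed.

End ModelFrequencies.

(** * Disintegration *)

Lemma probability_ae_cst d (T : measurableType d) (R : realType)
    (mu : probability T R) (Y M : set T) (b : bool) :
  measurable Y -> measurable M -> mu M = 0%E ->
  (forall y, ~ M y -> (Y y <-> b)) -> mu Y = (b%:R)%:E.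
Proof.
move=> mY mM M0 H; case: b H => H; apply/eqP; rewrite eq_le; apply/andP; split.
- exact: probability_le1.
- have TY : setT `<=` Y `|` M.
    by move=> y _; have [My|/H[_ /(_ isT)]] := pselect (M y); [right|left].
  have := le_measure mu _ _ TY; rewrite !inE => /(_ measurableT (measurableU _ _ mY mM)).
  rewrite [X in (X <= _)%E]probability_setT => /le_trans; apply.
  by apply: (le_trans (measureU2 _ _ _)) => //; rewrite [X in (_ + X)%E]M0 adde0.
- have YM : Y `<=` M.
    by move=> y Yy; apply: contrapT => /H[/(_ Yy)].
  by have := le_measure mu _ _ YM; rewrite !inE => /(_ mY mM); rewrite [X in (_ <= X)%E]M0.
- exact: measure_ge0.
Qed.

Section Disintegration.
Context d (T : measurableType d) (R : realType) (P : probability T R).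
Local Notation RU := (measurableTypeR R).
Local Notation U := (uniform_prob (@ltr01 R)).
Variables (alpha : R) (V : nat -> nat -> R) (Pi : nat -> T -> seq {fset nat}).
Hypotheses (alpha1 : alpha < 1) (egp : is_EGP P alpha V Pi).
Variable u : nat -> R -> R.
Hypothesis iid : iid_uniform u.

Let C (w : T) : nat_seq := label Pi w.
Let rec (w : T) : nat -> bool := is_record (label Pi w).
Let I (w : T) : ereal_seq R := pattern_record R (rec w).

Let rpPi : random_partition Pi. Proof. by have [] := egp. Qed.

Let C_growing w n : growing (C w) n. Proof. exact: growing_label egp w n. Qed.

Let rec0 w : rec w 0%N.
Proof. by have := @C_growing w 1%N 0%N isT; rewrite leqn0 /rec /is_record. Qed.

Let measurable_C : measurable_fun [set: T] C.
Proof.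
apply: measurable_to_nat_seq => s n; exact: (measurable_label_prefix egp s n).
Qed.

Let label_record_C w : label_record R (C w) = I w.
Proof. by rewrite label_recordE// => n; exact: C_growing. Qed.

Let measurable_I : measurable_fun [set: T] I.
Proof.
rewrite (_ : I = (label_record R : nat_seq -> ereal_seq R) \o C).
  exact: measurableT_comp (@measurable_label_record R) measurable_C.
by apply/funext => w; rewrite /= label_record_C.
Qed.

(* On the enlarged space the classes are forgotten except for their record
   indices, and are then sampled again from the sticks. *)
Let Omega := (T * (RU * RU))%type.

Let Phi (p : Omega) : nat_seq := model_label alpha u (rec p.1) p.2.1 p.2.2.

Let Phi_record p : is_record (Phi p) = rec p.1.
Proof.
apply: paint_label_record => //; first exact: pattern_stick01.
by have [_ u01 _] := iid.
Qed.

Let Phi_growing p n : growing (Phi p) n.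
Proof.
apply: paint_label_growing => //; first exact: pattern_stick01.
by have [_ u01 _] := iid.
Qed.

Let label_record_Phi p : label_record R (Phi p) = I p.1.
Proof. by rewrite label_recordE ?Phi_record// => n; exact: Phi_growing. Qed.

Let measurable_rec m : measurable_fun [set: Omega] (fun p => rec p.1 m).
Proof.
apply: (measurable_fun_bool true); rewrite setTI.
have := @measurable_fst _ _ T (RU * RU)%type measurableT _ (measurable_record egp m true).
by rewrite setTI.
Qed.

Let measurable_nrecords m (b : nat -> bool) :
  measurable_fun [set: Omega] (fun p => b (nrecords (rec p.1) m)).
Proof.
elim: m b => [|m IH] b.
  apply: (eq_measurable_fun (cst (b 0%N))); last exact: measurable_cst.
  by move=> p _; rewrite /nrecords big_ord0.
apply: (eq_measurable_fun (fun p : Omega => if rec p.1 m then b (nrecords (rec p.1) m).+1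
  else b (nrecords (rec p.1) m))).
  by move=> p _; rewrite nrecordsS; case: (rec p.1 m); rewrite ?addn1 ?addn0.
apply: measurable_fun_ifT; first exact: measurable_rec.
  exact: (IH (fun k => b k.+1)).
exact: IH.
Qed.

Let measurable_stick_Phi l :
  measurable_fun [set: Omega] (fun p => pattern_stick alpha u (rec p.1) p.2.1 l).
Proof.
apply: (@measurableT_comp _ _ _ Omega (ereal_seq R * RU)%type R
  (fun q => stick alpha l (q.1 l) (u l q.2)) _ (fun p => (I p.1, p.2.1))
  (measurable_stick_uniform alpha1 iid l)).
apply: measurable_fun_pair; first exact: measurableT_comp measurable_I measurable_fst.
exact: measurableT_comp measurable_fst measurable_snd.
Qed.

(** The number of classes, the upper limit of the product, is random. A fixed range with factors 1
    outside makes the product measurable factor by factor. *)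
Lemma tail_prod_widen (xi : nat -> R) j k m : (k <= m)%N ->
  tail_prod xi j k = \prod_(l < m) (if (j <= l < k)%N then 1 - xi l else 1).
Proof.
move=> km; rewrite -(big_mkord xpredT (fun l => if (j <= l < k)%N then 1 - xi l else 1)).
rewrite -big_mkcond /tail_prod [LHS](big_nat_widen _ _ _ _ _ km) [LHS](big_nat_widenl _ 0)//=.
by apply: eq_bigl => l; rewrite andbC.
Qed.

Let measurable_threshold m j : measurable_fun [set: Omega]
  (fun p => threshold (rec p.1) (pattern_stick alpha u (rec p.1) p.2.1) m j).
Proof.
apply: measurable_fun_ifT; first exact: measurable_rec.
  apply: (eq_measurable_fun (fun p : Omega => if (nrecords (rec p.1) m < j)%N then 1 else 0 : R)).
    by move=> p _; case: (_ < _)%N.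
  apply: (measurable_fun_ifT (measurable_nrecords m (fun k => (k < j)%N))); exact: measurable_cst.
apply: (eq_measurable_fun (fun p : Omega => \prod_(l < m)
    (if (j <= l < nrecords (rec p.1) m)%N then 1 - pattern_stick alpha u (rec p.1) p.2.1 l else 1))).
  by move=> p _; rewrite -tail_prod_widen// nrecords_le.
apply: measurable_prod => l _.
apply: (measurable_fun_ifT (measurable_nrecords m (fun k => (j <= l < k)%N))).
  by apply: measurable_funB; [exact: measurable_cst|exact: measurable_stick_Phi].
exact: measurable_cst.
Qed.

Let measurable_Phi : measurable_fun [set: Omega] Phi.
Proof.
have [mu u01 _] := iid.
apply: measurable_to_nat_seq => s n.
rewrite (_ : [set p | _] = \bigcap_(m in [set m | (m < n)%N]) [set p | Phi p m = s m]); last first.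
  by apply/seteqP; split => p H m mn; exact: H.
apply: bigcap_measurableType => m _.
pose th j (p : Omega) := threshold (rec p.1) (pattern_stick alpha u (rec p.1) p.2.1) m j.
have mth j : measurable_fun [set: Omega] (th j) by exact: measurable_threshold.
have mv : measurable_fun [set: Omega] (fun p : Omega => u m p.2.2).
  exact: (measurableT_comp (mu m) (measurableT_comp measurable_snd measurable_snd)).
have E p : (Phi p m == s m) = (th (s m) p <= u m p.2.2 < th (s m).+1 p).
  by apply: paint_label_eq => //; exact: pattern_stick01.
have := measurable_and (measurable_fun_ler (mth (s m)) mv) (measurable_fun_ltr mv (mth (s m).+1)).
move=> /(_ measurableT [set true] Logic.I); rewrite setTI.
congr (measurable _); apply/seteqP; split => p /=; rewrite -E.
  by move=> /eqP.
by move=> ->; rewrite eqxx.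
Qed.

Let UU : probability (RU * RU)%type R := (U \x U)%E.
Let Q : probability Omega R := (P \x UU)%E.

Local Open Scope ereal_scope.

Let QE (S : set Omega) : Q S = \int[P]_w \int[U]_x U [set y | S (w, (x, y))].
Proof.
apply: eq_integral => w _; apply: eq_integral => x _ /=; congr (U _).
by apply/seteqP; split => y; rewrite /xsection /= inE /= inE.
Qed.

(** Resampling keeps the records of [w]. So the inner integral is the prediction weight when [w] has
    the record pattern of [s] up to [n], and 0 otherwise; integrating gives the product of
    [prob_label_prefix]. A prefix without restricted growth is impossible on both sides. *)
Let law_prefix s n : Q (Phi @^-1` prefix_set s n) = P (C @^-1` prefix_set s n).
Proof.
case: n => [|n].
  rewrite (_ : prefix_set s 0 = setT); last by apply/seteqP; split.
  by rewrite !preimage_setT !probability_setT.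
have [gs|ngs] := pselect (growing s n.+1); last first.
  have E c : growing c n.+1 -> ~ prefix_set s n.+1 c.
    move=> gc cs; apply: ngs => m mn; rewrite -cs// -(@eq_nclasses c s).
      exact: gc.
    by move=> i im; apply: cs; exact: ltn_trans mn.
  rewrite (_ : Phi @^-1` _ = set0); last first.
    by apply/seteqP; split => // p /(E _ (@Phi_growing p n.+1)).
  rewrite (_ : C @^-1` _ = set0) ?measure0//.
  by apply/seteqP; split => // p /(E _ (@C_growing p n.+1)).
have mrec := measurable_record_prefix egp (is_record s) n.+1.
rewrite [RHS](prob_label_prefix egp gs) QE.
rewrite -(integral_cst P mrec) integral_mkcond; apply: eq_integral => w _.
rewrite patchE; case: ifPn => [|]; rewrite ?inE ?notin_setE => wr.
  apply: (model_prefix_weight alpha1 iid (rec0 w) gs) => m mn.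
  exact: wr.
apply: integral0_eq => x _; rewrite (_ : [set y | _] = set0) ?measure0//.
apply/seteqP; split => // y /= H; apply: wr => m mn.
rewrite -/(rec w) -(Phi_record (w, (x, y)) : _ = rec w) /is_record H//; congr (_ == _).
by apply: eq_nclasses => i im; apply: H; exact: ltn_trans mn.
Qed.

Let law_eq S : measurable S -> Q (Phi @^-1` S) = P (C @^-1` S).
Proof.
move=> mS; have := @nat_seq_measure_unique R
  (distribution Q (to_mfun measurable_Phi)) (distribution P (to_mfun measurable_C)).
apply => //; first by rewrite -ge0_fin_numE//; exact: fin_num_measure.
Qed.

(** For almost every [x] the frequency event holds for almost all [y] or almost none, according to
    whether the residual products at [x] lie in [A]; the inner probability is thus an indicator. *)
Let section_law (A : set (real_seq R)) w : measurable A ->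
  \int[U]_x U [set y | A (label_frequency R (Phi (w, (x, y))))] =
  U [set x | A (residual_map alpha u (I w) x)].
Proof.
move=> mA; pose S : set Omega := Phi @^-1` ((label_frequency R : nat_seq -> real_seq R) @^-1` A).
have mS : measurable S.
  have mL : measurable ((label_frequency R : nat_seq -> real_seq R) @^-1` A).
    by rewrite -[X in measurable X]setTI; exact: measurable_label_frequency.
  by rewrite -[S]setTI; exact: measurable_Phi.
have mSw : measurable (xsection S w) by exact: measurable_xsection.
have SE x : [set y | A (label_frequency R (Phi (w, (x, y))))] = xsection (xsection S w) x.
  by apply/seteqP; split => y; rewrite /xsection /= inE /= inE.
have mY x : measurable [set y : RU | A (label_frequency R (Phi (w, (x, y))))].
  by rewrite SE; exact: measurable_xsection.
pose B : set RU := [set x | A (residual_map alpha u (I w) x)].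
have mB : measurable B.
  by rewrite -[B]setTI; exact: (measurable_residual_map2 alpha1 iid (I w)).
have [N [mN N0 HN]] := model_frequency_ae alpha1 iid (rec0 w).
rewrite -[RHS]/(U B) -[X in U X]setIT -integral_indic//.
apply: ge0_ae_eq_integral => //.
- under eq_fun do rewrite SE.
  exact: (measurable_fun_xsection U mSw).
- exact/measurable_EFinP/measurable_indic.
exists N; split => // x; apply: contra_notP => /HN[M [mM M0 HM]] _.
have E y : ~ M y -> A (label_frequency R (Phi (w, (x, y)))) <-> B x.
  by move=> /HM E; rewrite /Phi/= E.
rewrite indicE; apply: (probability_ae_cst (mY x) mM M0) => y /E Ey.
by apply: (iff_trans Ey); split; rewrite inE.
Qed.

(** The joint event is a label event, so [law_eq] moves it to the enlarged space. There the records
    depend on [w] only: the condition [B] just restricts the outer integral, and [section_law]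
    identifies the inner one with the kernel. *)
Lemma gibbs_disintegration :
  is_regular_conditional_distribution P
    (limit_frequency R Pi : T -> real_seq R)
    (record_index R Pi : T -> ereal_seq R)
    (residual_pkernel alpha1 iid).
Proof.
have XE : (limit_frequency R Pi : T -> real_seq R) =
    (label_frequency R : nat_seq -> real_seq R) \o C.
  by apply/funext => w; exact: limit_frequencyE.
have IE : (record_index R Pi : T -> ereal_seq R) = I.
  by apply/funext => w; rewrite record_indexE// -label_record_C.
rewrite XE IE; split.
- exact: measurableT_comp (@measurable_label_frequency R) measurable_C.
- exact: measurable_I.
move=> A B mA mB.
pose S : set nat_seq := (label_frequency R : nat_seq -> real_seq R) @^-1` A `&`
  (label_record R : nat_seq -> ereal_seq R) @^-1` B.
have mS : measurable S.
  apply: measurableI; rewrite -[X in measurable X]setTI.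
    exact: measurable_label_frequency.
  exact: measurable_label_record.
rewrite (_ : _ `&` _ = C @^-1` S); last first.
  by apply/seteqP; split => w [Aw Bw]; split => //; move: Bw;
    rewrite /preimage /= label_record_C.
rewrite -(law_eq mS).
transitivity (\int[P]_w \int[U]_x U [set y | S (Phi (w, (x, y)))]); first exact: QE.
rewrite [RHS]integral_mkcond; apply: eq_integral => w _.
rewrite patchE; case: ifPn => [|]; rewrite ?inE ?notin_setE => Bw.
  apply: (etrans _ (section_law w mA)).
  apply: eq_integral => x _; congr (U _); apply/seteqP; split => y /=; first by case.
  by move=> Ay; split => //; rewrite /preimage/= label_record_Phi.
apply: integral0_eq => x _; rewrite (_ : [set y | _] = set0) ?measure0//.
by apply/seteqP; split => // y [_]; rewrite /preimage/= label_record_Phi.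
Qed.

End Disintegration.

Theorem proposition3 (R : realType) (d : measure_display)
    (T : measurableType d) (P : probability T R)
    (alpha : R) (V : nat -> nat -> R) (Pi : nat -> T -> seq {fset nat}) :
  alpha < 1 ->
  is_EGP P alpha V Pi ->
  exists kappa : R.-pker (ereal_seq R) ~> (real_seq R),
    (forall w : T,
       is_residual_law alpha (record_index R Pi w)
         (kappa (record_index R Pi w))) /\
    is_regular_conditional_distribution P
      (limit_frequency R Pi : T -> real_seq R)
      (record_index R Pi : T -> ereal_seq R)
      kappa.
Proof.
move=> alpha1 egp; have [u iid] := @iid_uniform_ex R.
exists (residual_pkernel alpha1 iid); split; last exact: gibbs_disintegration egp _ _.
move=> w; apply: residual_kernel_law => j _.
have [_ rpPi _] := egp.
rewrite record_indexE// label_recordE; last by move=> n; exact: growing_label egp w n.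
exact: pattern_record_admissible.
Qed.
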